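(* Let $n\ge2$, $I\in\mathcal I_n$, $\Sigma\in\Sigma_I$, and $U=P_UL_U$, where $P_U$ is an $n\times n$ permutation matrix with entries $1$ at the positions $(k,p_k+1)$, $k=1,\dots,n$, and $L_U$ is a constant unit lower-triangular $n\times n$ matrix, and let $\Phi_k(x,\lambda)$, $k=1,\dots,n$, be the Weyl solutions of the half-line problem $\mathcal L_I(\Sigma,U)$, $\lambda=\rho^n$. Let $\Gamma$ be one of the sectors $$\Gamma_r=\Bigl\{\rho\colon\tfrac{\pi(r-1)}n<\arg\rho<\tfrac{\pi r}n\Bigr\},\quad r=1,\dots,2n,$$ and let the roots $\omega_1,\dots,\omega_n$ of $\omega^n=1$ be numbered so that $\mathrm{Re}(\rho\omega_1)<\mathrm{Re}(\rho\omega_2)<\dots<\mathrm{Re}(\rho\omega_n)$ for $\rho\in\Gamma$. Then, for each fixed $x>0$ and each $\varphi$ such that $\{\rho\colon\arg\rho=\varphi\}\subset\Gamma$, the following asymptotic relation holds along the ray $\arg\rho=\varphi$: $$\Phi_k^{[j]}(x,\lambda)=\rho^{-p_k}a_{k,k}^0(\rho\omega_k)^j\exp(\rho\omega_kx)(1+o(1)),\quad|\rho|\to\infty,\quad k=1,\dots,n,\ j=0,\dots,n-1,$$ where $a_{k,k}^0:=\dfrac{d_{k-1,k-1}}{d_{k,k}}\ne0$, $d_{k,k}=\det[\omega_l^{p_s}]_{l,s=1}^k$, $k=1,\dots,n$, and $d_{0,0}:=1$.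
   Context: Notation: $\mathbb R_+=(0,\infty)$; $n=2m+\tau$ with $m\in\mathbb N$, $\tau\in\{0,1\}$; $C_i^s=\frac{i!}{s!(i-s)!}$ are the binomial coefficients, with $C_i^{-1}:=0$; $\delta_{s,k}$ is the Kronecker delta. Singularity orders: $\mathcal I_n$ is the set of integer sequences $I=(i_\nu)_{\nu=0}^{n-2}$ with $0\le i_{2k}\le m-k$ for $k=0,\dots,m-1$ and $0\le i_{2k+1}\le m-k-1$ for $k=0,\dots,m+\tau-2$. The set $K(I)\subseteq\{0,\dots,n-2\}$: if $n=2m+1$, then $K(I)=\varnothing$; if $n=2m$, then $2k\in K(I)\Leftrightarrow i_{2k}=m-k$, and $2k+1\in K(I)\Leftrightarrow i_{2k+1}=m-k-1$. Coefficients: $\Sigma_I$ is the set of $\Sigma=(\sigma_\nu)_{\nu=0}^{n-2}$ with $\sigma_\nu\in L_1(\mathbb R_+)$ for all $\nu$ and, in addition, $\sigma_\nu\in L_2(\mathbb R_+)$ for $\nu\in K(I)$. Differential expression (derivatives in the sense of distributions): $$\ell_n(y):=y^{(n)}+\sum_{k=0}^{m-1}(-1)^{i_{2k}+k}\bigl(\sigma_{2k}^{(i_{2k})}y^{(k)}\bigr)^{(k)}+\sum_{k=0}^{m+\tau-2}(-1)^{i_{2k+1}+k+1}\Bigl[\bigl(\sigma_{2k+1}^{(i_{2k+1})}y^{(k)}\bigr)^{(k+1)}+\bigl(\sigma_{2k+1}^{(i_{2k+1})}y^{(k+1)}\bigr)^{(k)}\Bigr].$$ Matrix $Q$: $\mathscr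 Q_I(\Sigma)=[q_{r,j}]_{r,j=0}^m:=\sum_{\nu=0}^{n-2}\sigma_\nu(x)\chi_{\nu,i_\nu}$, where the constant matrices $\chi_{\nu,i}=[\chi_{\nu,i;r,j}]_{r,j=0}^m$ have entries $\chi_{2k,i;s+k,i-s+k}=C_i^s$ $(s=0,\dots,i)$, $\chi_{2k+1,i;s+k,i+1-s+k}=C_{i+1}^s-2C_i^{s-1}$ $(s=0,\dots,i+1)$, and all other entries zero. Matrix $F$: $\mathscr F_I(\Sigma)=\mathscr S_n(\mathscr Q_I(\Sigma))$, where $F=[f_{k,j}]_{k,j=1}^n=\mathscr S_n(Q)$ is given as follows. If $n=2m$: $f_{m,j}=(-1)^{m+1}q_{j-1,m}$ for $1\le j\le m$; $f_{k,m+1}=(-1)^{k+1}q_{m,2m-k}$ for $m+1\le k\le 2m$; $f_{k,j}=(-1)^{k+1}q_{j-1,2m-k}+(-1)^{m+k}q_{j-1,m}q_{m,2m-k}$ for $m+1\le k\le 2m$, $1\le j\le m$. If $n=2m+1$: $f_{k,j}=(-1)^kq_{j-1,2m+1-k}$ for $m+1\le k\le 2m+1$, $1\le j\le m+1$. In both cases $f_{k,k+1}=1$ for $k=1,\dots,n-1$, and all remaining entries are zero. Quasi-derivatives and solutions: $F=\mathscr F_I(\Sigma)$; $y^{[0]}:=y$, $y^{[k]}:=(y^{[k-1]})'-\sum_{j=1}^kf_{k,j}y^{[j-1]}$, $k=1,\dots,n$; $\mathcal D_F:=\{y\colon y^{[k]}\in AC_{loc}(\mathbb R_+),\ k=0,\dots,n-1\}$;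 $\vec y:=\mathrm{col}(y^{[0]},\dots,y^{[n-1]})$. A solution of $\ell_n(y)=\lambda y$ on $\mathbb R_+$ is a function $y\in\mathcal D_F$ with $\vec y\,'=(F(x)+\Lambda)\vec y$, where $\Lambda=\lambda E_{n,1}$ and $E_{n,1}$ has $1$ at position $(n,1)$ and zeros elsewhere (equivalently, $y^{[n]}=\lambda y$). Values at $x=0$ are limits as $x\to0+$. Problem $\mathcal L_I(\Sigma,U)$ consists of the equation $\ell_n(y)=\lambda y$ on $\mathbb R_+$ and the boundary forms $$U_s(y):=y^{[p_s]}(0)+\sum_{j=1}^{p_s}u_{s,j}y^{[j-1]}(0),\quad s=1,\dots,n,$$ where $U=P_UL_U=[u_{k,j}]_{k,j=1}^n$ and $(p_k)_{k=1}^n$ is a permutation of $0,\dots,n-1$. Weyl solutions: $\Phi_k(x,\lambda)$, $k=1,\dots,n$, is the solution of $\ell_n(y)=\lambda y$, $\lambda=\rho^n$, with $U_s(\Phi_k)=\delta_{s,k}$, $s=1,\dots,k$, and $\Phi_k(x,\lambda)=O(\exp(\rho\omega_kx))$ as $x\to\infty$. *)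

(* Defs.v *)
From mathcomp Require Import all_boot all_order all_algebra all_fingroup.
From mathcomp Require Import all_classical all_reals all_analysis.
From mathcomp Require Import complex.
Set Implicit Arguments.
Unset Strict Implicit.
Unset Printing Implicit Defensive.
Import Order.TTheory GRing.Theory Num.Theory.
Import numFieldNormedType.Exports.
Local Open Scope classical_set_scope.
Local Open Scope ring_scope.
Local Open Scope complex_scope.

Definition modc (R : realType) (z : R[i]) : R := ComplexField.Normc.normc z.

Definition cexp (R : realType) (z : R[i]) : R[i] :=
  (expR (complex.Re z) * cos (complex.Im z))
    +i* (expR (complex.Re z) * sin (complex.Im z)).

Definition is_cderive (R : realType) (f : R -> R[i]) (x : R) (d : R[i]) : Prop :=
  is_derive x 1 (fun t => complex.Re (f t)) (complex.Re d) /\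
  is_derive x 1 (fun t => complex.Im (f t)) (complex.Im d).

Definition at0 (R : realType) (f : R -> R[i]) : R[i] :=
  lim (complex.Re (f t) @[t --> 0^'+]) +i* lim (complex.Im (f t) @[t --> 0^'+]).

Definition Rplus (R : realType) : set R := [set x | 0 < x].

(* Measurability is Borel measurability; every element of L_p(R_+), being a
   class modulo null sets, has such a representative. *)
Definition Lp_Rplus (R : realType) (p : nat) (f : R -> R[i]) : Prop :=
  [/\ measurable_fun (@Rplus R) (fun x => complex.Re (f x)),
      measurable_fun (@Rplus R) (fun x => complex.Im (f x)) &
      (\int[@lebesgue_measure R]_(x in @Rplus R) (modc (f x) ^+ p)%:E < +oo)%E].

(* The intervals ]u_i, v_i[, i < N, are pairwise disjoint subintervals
   of [a, b]. *)
Definition abs_continuous_on (R : realType) (a b : R) (f : R -> R[i]) : Prop :=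
  forall e : R, 0 < e -> exists2 d : R, 0 < d &
    forall (N : nat) (u v : 'I_N -> R),
      (forall i, a <= u i /\ u i <= v i /\ v i <= b) ->
      (forall i j, i != j -> v i <= u j \/ v j <= u i) ->
      \sum_(i < N) (v i - u i) < d ->
      \sum_(i < N) modc (f (v i) - f (u i)) < e.

Definition AC_loc (R : realType) (f : R -> R[i]) : Prop :=
  forall a b : R, 0 < a -> a <= b -> abs_continuous_on a b f.

(* Writing n = 2m + tau: m = n./2 and tau = odd n.  The index nu = 0, ..., n-2 is
   an element of 'I_n.-1, with nu = 2k or nu = 2k+1 and k = nu./2. *)

Definition max_order (n nu : nat) : nat :=
  (if odd nu then n./2 - nu./2 - 1 else n./2 - nu./2)%N.

Definition singularity_orders (n : nat) (I : 'I_n.-1 -> nat) : Prop :=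
  forall nu : 'I_n.-1, (I nu <= max_order n nu)%N.

Definition K_set (n : nat) (I : 'I_n.-1 -> nat) : {set 'I_n.-1} :=
  [set nu : 'I_n.-1 | ~~ odd n && (I nu == max_order n nu)].

Definition Sigma_set (R : realType) (n : nat) (I : 'I_n.-1 -> nat) :
    set ('I_n.-1 -> R -> R[i]) :=
  [set sigma | (forall nu, Lp_Rplus 1 (sigma nu)) /\
               (forall nu, nu \in K_set I -> Lp_Rplus 2 (sigma nu))].

Definition chi (R : realType) (m nu i : nat) : 'M[R[i]]_(m.+1) :=
  \matrix_(r < m.+1, j < m.+1)
    if odd nu then
      \sum_(0 <= s < i.+2 |
            (r == s + nu./2 :> nat)%N && (j == i.+1 - s + nu./2 :> nat)%N)
         ('C(i.+1, s)%:R - 2 * (if s is s'.+1 then 'C(i, s') else 0%N)%:R)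
    else
      \sum_(0 <= s < i.+1 |
            (r == s + nu./2 :> nat)%N && (j == i - s + nu./2 :> nat)%N)
         'C(i, s)%:R.

Definition Q_mx (R : realType) (n : nat) (I : 'I_n.-1 -> nat)
    (sigma : 'I_n.-1 -> R -> R[i]) (x : R) : 'M[R[i]]_(n./2.+1) :=
  \sum_(nu < n.-1) sigma nu x *: chi R n./2 nu (I nu).

(* q a b is q_{a,b} with 0 <= a, b <= m, while the row and column indices k, j
   of F run over 1, ..., n in the formulas below. *)
Definition S_mx (R : realType) (n : nat) (Q : 'M[R[i]]_(n./2.+1)) : 'M[R[i]]_n :=
  let m := n./2 in
  let q (a b : nat) : R[i] := Q (inord a) (inord b) in
  \matrix_(k0 < n, j0 < n)
    let k := k0.+1 in let j := j0.+1 in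
    if (j == k.+1)%N then 1
    else if odd n then
      if (m.+1 <= k)%N && (j <= m.+1)%N then (-1) ^+ k * q j.-1 (2 * m + 1 - k)%N
      else 0
    else if (k == m)%N && (j <= m)%N then (-1) ^+ m.+1 * q j.-1 m
    else if (m.+1 <= k)%N && (j == m.+1)%N then (-1) ^+ k.+1 * q m (2 * m - k)%N
    else if (m.+1 <= k)%N && (j <= m)%N then
      (-1) ^+ k.+1 * q j.-1 (2 * m - k)%N
        + (-1) ^+ (m + k) * (q j.-1 m * q m (2 * m - k)%N)
    else 0.

Definition F_mx (R : realType) (n : nat) (I : 'I_n.-1 -> nat)
    (sigma : 'I_n.-1 -> R -> R[i]) (x : R) : 'M[R[i]]_n :=
  S_mx (Q_mx I sigma x).

(* Y = col(y^[0], ..., y^[n-1]).  Since y^[k] is only determined almost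
   everywhere by y^[k-1], Y consists of locally absolutely continuous
   representatives, which are unique on R_+. *)
Definition quasi_derivatives (R : realType) (n : nat) (F : R -> 'M[R[i]]_n)
    (y : R -> R[i]) (Y : R -> 'cV[R[i]]_n) : Prop :=
  [/\ forall k : 'I_n, AC_loc (fun t => Y t k 0),
      forall k : 'I_n, k = 0%N :> nat -> forall x : R, 0 < x -> Y x k 0 = y x &
      forall k k' : 'I_n, k' = k.+1 :> nat ->
        {ae @lebesgue_measure R, forall x : R, 0 < x ->
          exists2 d : R[i], is_cderive (fun t => Y t k 0) x d &
            Y x k' 0 = d - \sum_(j < n | (j <= k)%N) F x k j * Y x j 0}].

Definition D_F (R : realType) (n : nat) (F : R -> 'M[R[i]]_n) :
    set (R -> R[i]) :=
  [set y | exists Y, quasi_derivatives F y Y].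

Definition qvec (R : realType) (n : nat) (F : R -> 'M[R[i]]_n) (y : R -> R[i]) :
    R -> 'cV[R[i]]_n :=
  xget (fun=> 0) [set Y | quasi_derivatives F y Y].

Definition qder (R : realType) (n : nat) (F : R -> 'M[R[i]]_n) (y : R -> R[i])
    (j : 'I_n) (x : R) : R[i] := qvec F y x j 0.

Definition Lambda_mx (R : realType) (n : nat) (lambda : R[i]) : 'M[R[i]]_n :=
  \matrix_(k, j)
    (if (k == n.-1 :> nat) && (j == 0%N :> nat) then lambda else 0).

Definition solution (R : realType) (n : nat) (F : R -> 'M[R[i]]_n)
    (lambda : R[i]) : set (R -> R[i]) :=
  [set y | D_F F y /\
    {ae @lebesgue_measure R, forall x : R, 0 < x -> forall k : 'I_n,
      is_cderive (qder F y k) x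
        (((F x + Lambda_mx n lambda) *m qvec F y x) k 0)}].

(* p k is p_{k+1}, so that perm_mx p has its ones at the positions
   (k, p_k + 1) in 1-based numbering. *)
Definition boundary_form (R : realType) (n : nat) (F : R -> 'M[R[i]]_n)
    (p : 'S_n) (U : 'M[R[i]]_n) (s : 'I_n) (y : R -> R[i]) : R[i] :=
  at0 (qder F y (p s)) + \sum_(j < n | (j < p s)%N) U s j * at0 (qder F y j).

(* The defining conditions of Phi_k(., rho ^ n); w stands for omega_k. *)
Definition weyl_conditions (R : realType) (n : nat) (F : R -> 'M[R[i]]_n)
    (p : 'S_n) (U : 'M[R[i]]_n) (w : R[i]) (k : 'I_n) (rho : R[i]) :
    set (R -> R[i]) :=
  [set y | [/\ solution F (rho ^+ n) y,
    forall s : 'I_n, (s <= k)%N -> boundary_form F p U s y = (s == k)%:R &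
    exists M : R, \forall x \near +oo,
      modc (y x) <= M * modc (cexp (rho * w * x%:C))]].

(* "The" Weyl solution; it takes the value 0 at the exceptional rho for which
   there is none. *)
Definition weyl (R : realType) (n : nat) (F : R -> 'M[R[i]]_n)
    (p : 'S_n) (U : 'M[R[i]]_n) (w : R[i]) (k : 'I_n) (rho : R[i]) : R -> R[i] :=
  xget (fun=> 0) (weyl_conditions F p U w k rho).

Definition ray (R : realType) (phi : R) : set R[i] :=
  [set rho | exists2 t : R, 0 < t & rho = t%:C * cexp (0 +i* phi)].

Definition sector (R : realType) (n r : nat) : set R[i] :=
  [set rho | exists2 theta : R,
     pi * r.-1%:R / n%:R < theta < pi * r%:R / n%:R & ray theta rho].

Definition dminor (R : realType) (n : nat) (omega : 'I_n -> R[i]) (p : 'S_n)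
    (k : nat) (hk : (k <= n)%N) : R[i] :=
  \det (\matrix_(l < k, s < k) omega (widen_ord hk l) ^+ p (widen_ord hk s)).

Definition a0 (R : realType) (n : nat) (omega : 'I_n -> R[i]) (p : 'S_n)
    (k : 'I_n) : R[i] :=
  dminor omega p (ltnW (ltn_ord k)) / dminor omega p (ltn_ord k).

(* Main.v *)
Require Import Defs.
From mathcomp Require Import all_boot all_order all_algebra all_fingroup.
From mathcomp Require Import all_classical all_reals all_analysis.
From mathcomp Require Import measurable_realfun complex.
From mathcomp Require Import ring lra zify.
Set Implicit Arguments.
Unset Strict Implicit.
Unset Printing Implicit Defensive.
Import Order.TTheory GRing.Theory Num.Theory.
Import numFieldNormedType.Exports.
Local Open Scope classical_set_scope.
Local Open Scope ring_scope.
Local Open Scope complex_scope.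

(** Put [Y_k = rho^k * \sum_l omega_l^k V_l].  The companion system becomes
    [V' = (rho diag(omega) + B) V], where [B] is dominated by a fixed integrable
    function and, because [tr F = 0], the diagonal of [B] is [O(1/|rho|)] times
    that function.  Writing [V = exp (rho omega_l x) z] and integrating the
    decaying components of [z] from [0] and the growing ones from infinity gives a
    fixed point problem.  Its kernels are bounded by [exp (- c |rho| |x - t|)]
    off the component [l], so their L1 norms tend to [0] uniformly in [x]; with a
    suitable weight on the components the map is a contraction, and
    [z -> e_l] uniformly on the half-line.  This yields Birkhoff solutions
    [y_l ~ exp (rho omega_l x)] that are regular up to [x = 0].  The growth
    condition at infinity forces the Weyl solution to be a combination of
    [y_1, ..., y_k], and the boundary conditions determine the coefficients by
    Cramer's rule; since [omega_1, ..., omega_k] are consecutive roots of unity,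
    the limiting determinant is a nonzero multiple of a Vandermonde determinant.
    At a fixed [x > 0] the terms with [l < k] are exponentially small relative to
    the [k]-th one.

    Coefficients are extended by [0] to [x <= 0], so that the system lives on the
    whole line and the values at [0+] are plain values at [0]. *)

(** * Complex modulus, exponential and limits *)

(** The coefficients are merely integrable, so no integration by parts can produce powers of
    [1/|rho|]: off the component [l], smallness comes only from the concentration of the kernels at
    [t = x], tested against a truncated L1 function. On the component [l] the exponent vanishes and
    the kernel does not decay. There the diagonal entry of [B] has to be small by itself, and the
    other entries are compensated by the smallness of the other components; this asymmetry dictates
    the weights. The diagonal entries of [B] are [1/n] times the sum over [i <= k] of
    [(rho omega_l)^(i-k) f_{k,i}], whose terms with [i = k] add up to [tr F / n]. For even [n] the
    entries of [F] contain products of entries of [Q]; they are integrable because only the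
    [sigma_nu] with [nu] in [K(I)] reach the last row and column of [Q].

    Quasi-derivatives and Weyl solutions are obtained by choice, so every explicit formula for them
    rests on a uniqueness statement. The uniform control of [z] on the line is used at both ends: at
    [0] for the boundary forms, at infinity to read off coefficients from growth. *)

Section ComplexModulus.
Variable R : realType.
Implicit Types z w : R[i].

Lemma Re_add z w : complex.Re (z + w) = complex.Re z + complex.Re w.
Proof. by case: z w => [a b] [c d]. Qed.

Lemma Im_add z w : complex.Im (z + w) = complex.Im z + complex.Im w.
Proof. by case: z w => [a b] [c d]. Qed.

Lemma Re_opp z : complex.Re (- z) = - complex.Re z.
Proof. by case: z. Qed.

Lemma Im_opp z : complex.Im (- z) = - complex.Im z.
Proof. by case: z. Qed.

Lemma Re_mul z w : complex.Re (z * w) =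
  complex.Re z * complex.Re w - complex.Im z * complex.Im w.
Proof. by case: z w => [a b] [c d]. Qed.

Lemma Im_mul z w : complex.Im (z * w) =
  complex.Re z * complex.Im w + complex.Im z * complex.Re w.
Proof. by case: z w => [a b] [c d]. Qed.

Lemma complexP z w :
  complex.Re z = complex.Re w -> complex.Im z = complex.Im w -> z = w.
Proof. by case: z w => [a b] [c d] /= -> ->. Qed.

Lemma modcE z :
  modc z = Num.sqrt (complex.Re z ^+ 2 + complex.Im z ^+ 2).
Proof. by case: z. Qed.

Lemma modc_ge0 z : 0 <= modc z.
Proof. by rewrite modcE sqrtr_ge0. Qed.

Lemma modc0 : modc (0 : R[i]) = 0.
Proof. exact: ComplexField.Normc.normc0. Qed.

Lemma modc1 : modc (1 : R[i]) = 1.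
Proof. exact: ComplexField.Normc.normc1. Qed.

Lemma modc_eq0 z : (modc z == 0) = (z == 0).
Proof.
apply/eqP/eqP => [|->]; last exact: modc0.
exact: ComplexField.Normc.eq0_normc.
Qed.

Lemma modc_gt0 z : (0 < modc z) = (z != 0).
Proof. by rewrite lt_def modc_eq0 modc_ge0 andbT. Qed.

Lemma modcM z w : modc (z * w) = modc z * modc w.
Proof. exact: ComplexField.Normc.normcM. Qed.

Lemma modcV z : modc z^-1 = (modc z)^-1.
Proof. exact: ComplexField.Normc.normcV. Qed.

Lemma modcX z m : modc (z ^+ m) = modc z ^+ m.
Proof. by elim: m => [|m IH]; rewrite ?expr0 ?modc1// !exprS modcM IH. Qed.

Lemma modcN z : modc (- z) = modc z.
Proof. exact: normcN. Qed.

Lemma le_modcD z w : modc (z + w) <= modc z + modc w.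
Proof. exact: le_normcD. Qed.

Lemma modcB z w : modc (z - w) = modc (w - z).
Proof. by rewrite -modcN opprB. Qed.

Lemma le_modc_sum (I : Type) (s : seq I) (P : pred I) (f : I -> R[i]) :
  modc (\sum_(i <- s | P i) f i) <= \sum_(i <- s | P i) modc (f i).
Proof.
elim/big_rec2: _ => [|i a z _ h]; first by rewrite modc0.
by rewrite (le_trans (le_modcD _ _))// lerD2l.
Qed.

Lemma Re_le_modc z : `|complex.Re z| <= modc z.
Proof. by rewrite modcE -sqrtr_sqr ler_wsqrtr// lerDl sqr_ge0. Qed.

Lemma Im_le_modc z : `|complex.Im z| <= modc z.
Proof. by rewrite modcE -sqrtr_sqr ler_wsqrtr// lerDr sqr_ge0. Qed.

Lemma sqr_modc z : modc z ^+ 2 = complex.Re z ^+ 2 + complex.Im z ^+ 2.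
Proof. by rewrite modcE sqr_sqrtr// addr_ge0// sqr_ge0. Qed.

Lemma modc_le_ReIm z : modc z <= `|complex.Re z| + `|complex.Im z|.
Proof.
rewrite -(@ler_pXn2r _ 2)// ?nnegrE ?modc_ge0 ?addr_ge0//.
rewrite sqr_modc sqrrD !real_normK ?num_real//.
by rewrite addrAC lerDl mulrn_wge0// mulr_ge0.
Qed.

Lemma modc_real (a : R) : modc a%:C = `|a|.
Proof. by rewrite modcE /= expr0n addr0 sqrtr_sqr. Qed.

Lemma ReZ (a : R) z : complex.Re (a%:C * z) = a * complex.Re z.
Proof. by rewrite Re_mul /= mul0r subr0. Qed.

Lemma ImZ (a : R) z : complex.Im (a%:C * z) = a * complex.Im z.
Proof. by rewrite Im_mul /= mul0r addr0. Qed.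

Lemma cexp0 : cexp (0 : R[i]) = 1.
Proof. by rewrite /cexp /= expR0 cos0 sin0 mulr1 mulr0. Qed.

Lemma cexpD z w : cexp (z + w) = cexp z * cexp w.
Proof.
by apply: complexP; rewrite ?Re_mul ?Im_mul /= Re_add Im_add expRD ?cosD ?sinD; ring.
Qed.

Lemma modc_cexp z : modc (cexp z) = expR (complex.Re z).
Proof.
rewrite modcE /= !exprMn -mulrDr cos2Dsin2 mulr1 sqrtr_sqr.
by rewrite ger0_norm// expR_ge0.
Qed.

Lemma cexp_neq0 z : cexp z != 0.
Proof. by rewrite -modc_gt0 modc_cexp expR_gt0. Qed.

Lemma cexpN z : cexp (- z) = (cexp z)^-1.
Proof.
apply: (mulfI (cexp_neq0 z)).
by rewrite -cexpD subrr cexp0 divff// cexp_neq0.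
Qed.

End ComplexModulus.

(** * Limits of complex-valued functions along a filter *)

Section ComplexLimits.
Variables (R : realType) (T : Type) (G : set_system T).
Context {FG : Filter G}.
Implicit Types f g : T -> R[i].

(** Complex convergence is encoded by a real limit, so real squeezing suffices throughout and the
    error term of the theorem already has this form. *)
Definition cto f (c : R[i]) := modc (f t - c) @[t --> G] --> (0 : R).

Lemma cto_squeeze f c (h : T -> R) :
  (\forall t \near G, modc (f t - c) <= h t) -> h t @[t --> G] --> (0 : R) ->
  cto f c.
Proof.
move=> fh h0; apply: squeeze_cvgr h0; last exact: (@cvg_cst _ 0 _ G).
by near=> t; rewrite modc_ge0 /=; near: t.
Unshelve. all: by end_near. Qed.

Lemma cto_near f g c : (\forall t \near G, f t = g t) -> cto f c -> cto g c.
Proof.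
move=> fg fc; apply: cto_squeeze fc; near=> t.
by rewrite (_ : f t = g t)//; near: t.
Unshelve. all: by end_near. Qed.

Lemma cto_cst c : cto (fun=> c) c.
Proof.
rewrite /cto; under eq_fun do rewrite subrr modc0; exact: cvg_cst.
Qed.

Lemma ctoD f g c d : cto f c -> cto g d -> cto (fun t => f t + g t) (c + d).
Proof.
move=> fc gd; apply: (@cto_squeeze _ _ (fun t => modc (f t - c) + modc (g t - d))).
  by near=> t; rewrite opprD addrACA le_modcD.
by rewrite -[0](addr0 (0 : R)); exact: cvgD.
Unshelve. all: by end_near. Qed.

Lemma ctoM f g c d : cto f c -> cto g d -> cto (fun t => f t * g t) (c * d).
Proof.
move=> fc gd; apply: (@cto_squeeze _ _ (fun t => modc (f t - c) * modc (g t - d)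
    + (modc c * modc (g t - d) + modc (f t - c) * modc d))).
  near=> t; rewrite -!modcM.
  have -> : f t * g t - c * d =
    (f t - c) * (g t - d) + (c * (g t - d) + (f t - c) * d) by ring.
  by rewrite (le_trans (le_modcD _ _))// lerD2l le_modcD.
have -> : (0 : R) = 0 * 0 + (modc c * 0 + 0 * modc d) by ring.
by apply: cvgD; [exact: cvgM|apply: cvgD; apply: cvgM => //; exact: cvg_cst].
Unshelve. all: by end_near. Qed.

Lemma cto_sum (I : Type) (s : seq I) (P : pred I) (f : I -> T -> R[i])
    (c : I -> R[i]) : (forall i, P i -> cto (f i) (c i)) ->
  cto (fun t => \sum_(i <- s | P i) f i t) (\sum_(i <- s | P i) c i).
Proof.
move=> fc; elim: s => [|i s IH].
  by rewrite big_nil; under eq_fun do rewrite big_nil; exact: cto_cst.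
rewrite big_cons; under eq_fun do rewrite big_cons.
by case: ifP => // Pi; apply: ctoD => //; exact: fc.
Qed.

Lemma cto_prod (I : Type) (s : seq I) (P : pred I) (f : I -> T -> R[i])
    (c : I -> R[i]) : (forall i, P i -> cto (f i) (c i)) ->
  cto (fun t => \prod_(i <- s | P i) f i t) (\prod_(i <- s | P i) c i).
Proof.
move=> fc; elim: s => [|i s IH].
  by rewrite big_nil; under eq_fun do rewrite big_nil; exact: cto_cst.
rewrite big_cons; under eq_fun do rewrite big_cons.
by case: ifP => // Pi; apply: ctoM => //; exact: fc.
Qed.

(** The determinant unfolds to the Leibniz sum over permutations, a polynomial in the entries. *)
Lemma cto_det k (A : T -> 'M[R[i]]_k) (A0 : 'M[R[i]]_k) :
  (forall i j, cto (fun t => A t i j) (A0 i j)) ->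
  cto (fun t => \det (A t)) (\det A0).
Proof.
move=> AA0; apply: cto_sum => s _; apply: ctoM; first exact: cto_cst.
by apply: cto_prod => i _; exact: AA0.
Qed.

Lemma cto_neq0 f c : c != 0 -> cto f c -> \forall t \near G, f t != 0.
Proof.
rewrite -modc_gt0 => c0 /cvgrPdist_lt /(_ _ c0).
apply: filterS => t; rewrite sub0r normrN ger0_norm ?modc_ge0// => h.
by apply/eqP => ft0; move: h; rewrite ft0 sub0r modcN ltxx.
Qed.

Lemma ctoV f c : c != 0 -> cto f c -> cto (fun t => (f t)^-1) c^-1.
Proof.
move=> c0 fc; have mc0 : 0 < modc c by rewrite modc_gt0.
apply: (@cto_squeeze _ _ (fun t => modc (f t - c) * (2 / modc c ^+ 2))).
  have /cvgrPdist_lt /(_ (modc c / 2)) := fc.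
  rewrite divr_gt0// => /(_ isT) fc2.
  near=> t.
  have h : modc (f t - c) < modc c / 2.
    by rewrite -[ltLHS]ger0_norm ?modc_ge0// -normrN -sub0r; near: t.
  have h2 : modc c / 2 <= modc (f t).
    have := le_modcD (f t) (c - f t); rewrite addrC subrK modcB; lra.
  have ft0 : f t != 0 by rewrite -modc_gt0; apply: lt_le_trans h2; rewrite divr_gt0.
  have -> : (f t)^-1 - c^-1 = - ((f t - c) * (f t * c)^-1).
    by field; rewrite ft0 c0.
  rewrite modcN modcM modcV modcM; apply: ler_wpM2l; first exact: modc_ge0.
  rewrite expr2 -[X in X / _]invrK -invfM lef_pV2 ?posrE ?mulr_gt0 ?invr_gt0 ?modc_gt0//.
  by rewrite mulrA ler_pM2r// mulrC.
by rewrite -[0](mul0r (2 / modc c ^+ 2)); apply: cvgM => //; exact: cvg_cst.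
Unshelve. all: by end_near. Qed.

Lemma cto_Re f c : cto f c -> complex.Re (f t) @[t --> G] --> complex.Re c.
Proof.
move=> /cvgrPdist_lt fc; apply/cvgrPdist_lt => e e0; near=> t.
rewrite distrC -Re_opp -Re_add (le_lt_trans (Re_le_modc _))//.
rewrite -[ltLHS]ger0_norm ?modc_ge0// -normrN -sub0r.
by near: t; exact: fc.
Unshelve. all: by end_near. Qed.

Lemma cto_Im f c : cto f c -> complex.Im (f t) @[t --> G] --> complex.Im c.
Proof.
move=> /cvgrPdist_lt fc; apply/cvgrPdist_lt => e e0; near=> t.
rewrite distrC -Im_opp -Im_add (le_lt_trans (Im_le_modc _))//.
rewrite -[ltLHS]ger0_norm ?modc_ge0// -normrN -sub0r.
by near: t; exact: fc.
Unshelve. all: by end_near. Qed.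

Lemma cto_ReIm f c : complex.Re (f t) @[t --> G] --> complex.Re c ->
  complex.Im (f t) @[t --> G] --> complex.Im c -> cto f c.
Proof.
move=> fr fi; apply: (@cto_squeeze _ _ (fun t =>
   `|complex.Re (f t) - complex.Re c| + `|complex.Im (f t) - complex.Im c|)).
  by near=> t; rewrite -Re_opp -Re_add -Im_opp -Im_add modc_le_ReIm.
rewrite -[0](addr0 (0 : R)); apply: cvgD.
  by rewrite -(@normr0 _ R) -(subrr (complex.Re c)); apply: cvg_norm; apply: cvgB => //; exact: cvg_cst.
by rewrite -(@normr0 _ R) -(subrr (complex.Im c)); apply: cvg_norm; apply: cvgB => //; exact: cvg_cst.
Unshelve. all: by end_near. Qed.

End ComplexLimits.

(** * Absolutely continuous functions *)

Section AbsoluteContinuity.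
Variable R : realType.
Local Notation mu := (@lebesgue_measure R).

Definition fragments (a b : R) N (u v : 'I_N -> R) :=
  (forall i, a <= u i /\ u i <= v i /\ v i <= b) /\
  (forall i j, i != j -> v i <= u j \/ v j <= u i).

Definition rac (a b : R) (f : R -> R) := forall e : R, 0 < e ->
  exists2 d : R, 0 < d & forall N (u v : 'I_N -> R), fragments a b u v ->
    \sum_(i < N) (v i - u i) < d -> \sum_(i < N) `|f (v i) - f (u i)| < e.

Lemma abs_continuous_onP a b (f : R -> R[i]) : abs_continuous_on a b f <->
  rac a b (fun t => complex.Re (f t)) /\ rac a b (fun t => complex.Im (f t)).
Proof.
split=> [fac|[fr fi] e e0].
  split=> e /fac[d d0 h]; exists d => // N u v [uv uv'] /h -/(_ uv uv').
    by apply: le_lt_trans; apply: ler_sum => i _; rewrite -Re_opp -Re_add Re_le_modc.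
  by apply: le_lt_trans; apply: ler_sum => i _; rewrite -Im_opp -Im_add Im_le_modc.
have e20 : 0 < e / 2 by rewrite divr_gt0.
have [d1 d10 h1] := fr _ e20; have [d2 d20 h2] := fi _ e20.
exists (Num.min d1 d2); first by rewrite lt_min d10.
move=> N u v uv uv'; rewrite lt_min => /andP[/h1 -/(_ (conj uv uv')) s1].
move=> /h2 -/(_ (conj uv uv')) s2.
rewrite [e]splitr; apply: le_lt_trans (ltrD s1 s2).
rewrite -big_split; apply: ler_sum => i _ /=.
by rewrite -Re_opp -Re_add -Im_opp -Im_add modc_le_ReIm.
Qed.

Lemma rac_unif a b f : rac a b f -> forall e, 0 < e -> exists2 d, 0 < d &
  forall u v, a <= u -> u <= v -> v <= b -> v - u < d -> `|f v - f u| < e.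
Proof.
move=> fac e /fac[d d0 h]; exists d => // u v au uv vb vud.
have := h 1%N (fun=> u) (fun=> v).
rewrite !big_ord1; apply => //; split=> // i j.
by rewrite !ord1 eqxx.
Qed.

Lemma rac_bounded a b f : rac a b f ->
  exists M, forall x, a <= x <= b -> `|f x| <= M.
Proof.
move=> /rac_unif /(_ 1 ltr01)[d d0 h].
(* Steps of length [d / 2] stay strictly below [d], so each changes [f] by less than [1]. *)
have step k x : a <= x <= b -> x - a <= k%:R * (d / 2) -> `|f x - f a| <= k%:R.
  elim: k x => [|k IH] x /andP[ax xb].
    by rewrite mul0r subr_le0 => xa; rewrite (@le_anti _ _ x a) ?subrr ?normr0 ?xa.
  move=> xk; have [xd|xd] := leP (x - a) (d / 2).
    have : `|f x - f a| < 1 by apply: h => //; lra.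
    move=> /ltW /le_trans; apply.
    by rewrite -natr1 lerDr.
  rewrite -natr1 in xk *.
  have h1 : `|f x - f (x - d / 2)| < 1 by apply: h => //; lra.
  have h2 : `|f (x - d / 2) - f a| <= k%:R.
    by apply: IH; [apply/andP; split; lra|move: xk; rewrite mulrDl mul1r; lra].
  have -> : f x - f a = (f (x - d/2) - f a) + (f x - f (x - d/2)) by ring.
  by rewrite (le_trans (ler_normD _ _))// lerD// ltW.
have [k kh] : exists k : nat, (b - a) / (d / 2) <= k%:R.
  exists (Num.truncn (`|(b - a) / (d / 2)|)).+1.
  by rewrite (le_trans (ler_norm _))// ltW// truncnS_gt.
exists (k%:R + `|f a|) => x xab.
have -> : f x = (f x - f a) + f a by ring.
rewrite (le_trans (ler_normD _ _))// lerD2r step//.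
move: kh; rewrite ler_pdivrMr ?divr_gt0//; apply: le_trans.
by case/andP: xab => _; lra.
Qed.

Lemma rac_ext a b f g : (forall x, a <= x <= b -> f x = g x) ->
  rac a b f -> rac a b g.
Proof.
move=> fg fac e /fac[d d0 h]; exists d => // N u v uv /(h _ _ _ uv).
apply: le_lt_trans; apply: ler_sum => i _; case: uv => /(_ i)[au [uv vb]] _.
by rewrite !fg// ?au ?vb ?(le_trans uv)// (le_trans au).
Qed.

(** Common source of the closure properties: each of them bounds the increments of the new function
    by those of finitely many absolutely continuous ones. *)
Lemma rac_dom a b (fs : seq (R -> R)) (C : R) f : 0 <= C ->
  (forall u v, a <= u -> u <= v -> v <= b ->
     `|f v - f u| <= C * \sum_(g <- fs) `|g v - g u|) ->
  (forall g, g \in fs -> rac a b g) -> rac a b f.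
Proof.
move=> C0 fC fsac.
have fsac' : forall e, 0 < e -> exists2 d, 0 < d &
    forall N (u v : 'I_N -> R), fragments a b u v -> \sum_(i < N) (v i - u i) < d ->
    \sum_(i < N) \sum_(g <- fs) `|g (v i) - g (u i)| < e.
  elim: fs fsac {fC} => [_|g fs IH fsac] e e0.
    by exists 1 => // N u v _ _; rewrite big1// => i _; rewrite big_nil.
  have e20 : 0 < e / 2 by rewrite divr_gt0.
  have [d1 d10 h1] := fsac g (mem_head _ _) _ e20.
  have [|d2 d20 h2] := IH _ _ e20.
    by move=> k kfs; apply: fsac; rewrite inE kfs orbT.
  exists (Num.min d1 d2); first by rewrite lt_min d10.
  move=> N u v uv; rewrite lt_min => /andP[/h1 -/(_ uv) s1 /h2 -/(_ uv) s2].
  rewrite [e]splitr; apply: le_lt_trans (ltrD s1 s2).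
  by rewrite -big_split; apply: ler_sum => i _ /=; rewrite big_cons.
(* [C] may be [0], so the tolerance is divided by [C + 1]. *)
move=> e e0; have C1 : 0 < C + 1 by rewrite ltr_wpDl.
have [|d d0 h] := fsac' (e / (C + 1)); first by rewrite divr_gt0.
exists d => // N u v uv /(h _ _ _ uv); rewrite ltr_pdivlMr// mulrC; apply: le_lt_trans.
rewrite mulr_sumr; apply: ler_sum => i _; case: uv => /(_ i)[au [uv vb]] _.
by rewrite (le_trans (fC _ _ au uv vb))// ler_wpM2r ?sumr_ge0// lerDl.
Qed.

Lemma rac_cst a b c : rac a b (fun=> c).
Proof.
apply: (@rac_dom _ _ [::] 0) => // u v _ _ _.
by rewrite subrr normr0 mul0r.
Qed.

Lemma racD a b f g : rac a b f -> rac a b g -> rac a b (fun x => f x + g x).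
Proof.
move=> fac gac; apply: (@rac_dom _ _ [:: f; g] 1) => // [u v _ _ _|h].
  by rewrite mul1r !big_cons big_nil addr0 opprD addrACA ler_normD.
by rewrite !inE => /orP[]/eqP ->.
Qed.

Lemma racM a b f g : rac a b f -> rac a b g -> rac a b (fun x => f x * g x).
Proof.
move=> fac gac; have [M fM] := rac_bounded fac; have [M' gM] := rac_bounded gac.
apply: (@rac_dom _ _ [:: f; g] (`|M| + `|M'|)) => [|u v au uv vb|h].
- by rewrite addr_ge0.
- rewrite !big_cons big_nil addr0.
  have -> : f v * g v - f u * g u = f v * (g v - g u) + g u * (f v - f u) by ring.
  rewrite (le_trans (ler_normD _ _))// !normrM addrC mulrDr.
  apply: lerD; apply: ler_wpM2r => //.
    by rewrite (le_trans (gM _ _)) ?au ?(le_trans uv)// (le_trans (ler_norm _))// lerDr.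
  by rewrite (le_trans (fM _ _)) ?vb ?(le_trans au)// (le_trans (ler_norm _))// lerDl.
by rewrite !inE => /orP[]/eqP ->.
Qed.

Lemma racN a b f : rac a b f -> rac a b (fun x => - f x).
Proof.
move=> fac; apply: (@rac_dom _ _ [:: f] 1) => // [u v _ _ _|h].
  by rewrite mul1r !big_cons big_nil addr0 -opprD normrN.
by rewrite mem_seq1 => /eqP ->.
Qed.

Lemma rac_sum a b (I : Type) (s : seq I) (P : pred I) (f : I -> R -> R) :
  (forall i, P i -> rac a b (f i)) -> rac a b (fun x => \sum_(i <- s | P i) f i x).
Proof.
move=> fac; elim: s => [|i s IH].
  by apply: rac_ext (rac_cst a b 0) => x _; rewrite big_nil.
have [Pi|Pi] := boolP (P i).
  by apply: rac_ext (racD (fac _ Pi) IH) => x _; rewrite big_cons Pi.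
by apply: rac_ext IH => x _; rewrite big_cons (negbTE Pi).
Qed.

Lemma rac_lip a b (C : R) f : 0 <= C ->
  (forall u v, a <= u -> u <= v -> v <= b -> `|f v - f u| <= C * `|v - u|) ->
  rac a b f.
Proof.
move=> C0 fC; have idac : rac a b id.
  move=> e e0; exists e => // N u v [uv _].
  apply: le_lt_trans; apply: ler_sum => i _; have [_ [uvi _]] := uv i.
  by rewrite ger0_norm// subr_ge0.
apply: (@rac_dom _ _ [:: id] C) => //.
  by move=> u v au uv vb; rewrite big_cons big_nil addr0 fC.
by move=> g; rewrite mem_seq1 => /eqP ->.
Qed.

Lemma rac_expR a b f : rac a b f -> rac a b (fun x => expR (f x)).
Proof.
move=> fac; have [M fM] := rac_bounded fac.
apply: (@rac_dom _ _ [:: f] (expR M)) => // [u v au uv vb|h].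
(* The tangent inequality [exp (y - x) >= 1 + (y - x)] makes [exp] Lipschitz with constant [exp M]
   below [M]. *)
- have key (x y : R) : x <= M -> y <= M -> expR x - expR y <= expR M * `|x - y|.
    move=> xM yM; apply: (@le_trans _ _ (expR x * (x - y))).
      have := expR_ge1Dx (y - x); rewrite expRD expRN.
      have ex0 := expR_gt0 x.
      rewrite -(ler_pM2l ex0) mulrCA divff ?gt_eqF// mulr1; lra.
    apply: (@le_trans _ _ (expR x * `|x - y|)).
      by rewrite ler_wpM2l ?expR_ge0 ?ler_norm.
    by rewrite ler_wpM2r// ler_expR.
  have fu : f u <= M by rewrite (le_trans (ler_norm _))// fM// au (le_trans uv).
  have fv : f v <= M by rewrite (le_trans (ler_norm _))// fM// vb (le_trans au).
  rewrite big_cons big_nil addr0 ler_norml key// andbT lerNl opprB distrC.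
  exact: key.
by rewrite mem_seq1 => /eqP ->.
Qed.

Lemma rac_continuous a b f x : rac a b f -> a < x < b -> {for x, continuous f}.
Proof.
move=> /rac_unif fac /andP[ax xb]; apply/cvgrPdist_lt => e /fac[d d0 h].
near=> t.
have at_ : a <= t by rewrite ltW//; near: t; exact: lt_nbhsr.
have tb : t <= b by rewrite ltW//; near: t; exact: lt_nbhsl.
have td : `|x - t| < d.
  by near: t; have /cvgrPdist_lt := @cvg_id _ (nbhs x); exact.
have [xt|/ltW tx] := leP x t.
  by rewrite distrC h ?(ltW ax)//; move: td; rewrite distrC ger0_norm ?subr_ge0.
by rewrite h ?(ltW xb)//; move: td; rewrite ger0_norm ?subr_ge0.
Unshelve. all: by end_near. Qed.

(** Completeness in the form behind Cousin's lemma. Some point [u] with [P u] lies close to the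
    supremum of all such points, and the step tagged at the supremum carries [P] beyond it unless
    [b] is already within reach. *)
Lemma real_induction (a b : R) (P : R -> Prop) : a <= b -> P a ->
  (forall x, a <= x <= b -> exists2 d, 0 < d & forall u v, a <= u -> u <= x ->
     x <= v -> v <= b -> x - u < d -> v - x < d -> P u -> P v) ->
  P b.
Proof.
move=> ab Pa ext; pose S := [set c | a <= c <= b /\ P c].
have Sa : S a by rewrite /S /= lexx ab.
have supS : has_sup S by split; [exists a|exists b => c [/andP[]]].
have as_ : a <= sup S by apply: sup_upper_bound.
have sb : sup S <= b by apply: ge_sup; [exists a|move=> c [/andP[]]].
have [d d0 h] := ext _ (introT andP (conj as_ sb)).
have [u [/andP[au ub] Pu] us] := sup_adherent d0 supS.
have us' : u <= sup S by apply: sup_upper_bound => //; split; rewrite ?au.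
have [bs|sb'] := ltP b (sup S + d / 2).
  by apply: (h u) => //; lra.
have : S (sup S + d / 2).
  split; first by apply/andP; split; lra.
  by apply: (h u) => //; lra.
move=> /(sup_upper_bound supS); lra.
Qed.

Lemma sum_integral_fragments a b N (u v : 'I_N -> R) (U : set R)
    (w : R -> R) : fragments a b u v -> measurable U ->
  (forall i, `]u i, v i] `<=` U) -> measurable_fun setT w ->
  (forall x, 0 <= w x) ->
  (\sum_(i < N) \int[mu]_(x in `]u i, v i]) (w x)%:E <=
    \int[mu]_(x in U) (w x)%:E)%E.
Proof.
move=> [uv uv'] mU AU mw w0; have mw' : measurable_fun setT (EFin \o w).
  exact/measurable_EFinP.
under eq_bigr do rewrite integral_mkcond.
rewrite -ge0_integral_sum//; last 2 first.
- by move=> i; apply/(measurable_restrictT _ _).1 => //; exact: measurable_funTS.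
- by move=> i x _; rewrite patchE; case: ifP => //; rewrite lee_fin.
rewrite [leRHS]integral_mkcond; apply: ge0_le_integral => //.
- by move=> x _; apply: sume_ge0 => i _; rewrite patchE; case: ifP => //; rewrite lee_fin.
- by apply: emeasurable_sum => i; apply/(measurable_restrictT _ _).1 => //; exact: measurable_funTS.
- by apply/(measurable_restrictT _ _).1 => //; exact: measurable_funTS.
(* Fragments may share endpoints; with half-open intervals each point still lies in at most one of
   them, so the sum of the restrictions is at most [w] on [U]. *)
move=> x _; have [[i xi]|noi] := pselect (exists i, x \in `]u i, v i]%classic).
  rewrite (bigD1 i)//= big1 ?adde0; last first.
    move=> j ji; rewrite patchE; case: ifP => // xj; exfalso.
    move: xi xj; rewrite !inE /= !in_itv /= => /andP[h1 h2] /andP[h3 h4].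
    case: (uv' _ _ ji) => h.
    by have := lt_le_trans h1 (le_trans h4 h); rewrite ltxx.
  by have := lt_le_trans h3 (le_trans h2 h); rewrite ltxx.
  rewrite !patchE xi; case: ifP => // /negP[]; rewrite inE; apply: (AU i).
  by move: xi; rewrite inE.
rewrite big1 => [|i _]; first by rewrite patchE; case: ifP => //; rewrite lee_fin.
by rewrite patchE; case: ifP => // xi; exfalso; apply: noi; exists i.
Qed.

(** Two-sided linear approximation at [x]: subtracting it at [u <= x] and at [v >= x] controls
    [f v - f u] on an interval tagged by [x]. *)
Lemma is_derive_lin (f : R -> R) (x d e : R) : is_derive x 1 f d -> 0 < e ->
  exists2 r, 0 < r & forall y, `|y - x| < r ->
    `|f y - f x - d * (y - x)| <= e * `|y - x|.
Proof.
move=> [fd <-] e0; have : h^-1 *: (f (h + x) - f x) @[h --> 0^'] --> 'D_1 f x.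
  have := fd; rewrite /derivable => /cvgP h.
  move: fd => /cvg_ex[l hl]; rewrite /derive.
  have -> : (fun h : R => h^-1 *: (f (h + x) - f x)) =
    (fun h : R => h^-1 *: (f (h *: 1 + x) - f x)).
    by apply/funext => k; rewrite [k *: _]mulr1.
  by rewrite (cvg_lim _ hl)//.
move=> /cvgrPdist_lt /(_ _ e0)[r /= r0 h]; exists r => // y yx.
have [->|yx0] := eqVneq y x; first by rewrite !subrr mulr0 subr0 normr0 mulr0.
have := h (y - x); rewrite /= sub0r normrN => /(_ yx).
rewrite subr_eq0 => /(_ yx0); rewrite subrK => {}h.
have n0 : y - x != 0 by rewrite subr_eq0.
have -> : f y - f x - 'D_1 f x * (y - x) =
   - ((y - x) * ('D_1 f x - (y - x)^-1 *: (f y - f x))).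
  by rewrite /GRing.scale /=; field.
by rewrite normrN normrM mulrC ler_wpM2r// ltW.
Qed.

End AbsoluteContinuity.

(** * Monotonicity from the almost everywhere sign of the derivative *)

Section Monotonicity.
Variable R : realType.
Local Notation mu := (@lebesgue_measure R).

Lemma fragments_cons (a b : R) N (u v : 'I_N -> R) c u0 v0 :
  fragments a c u v -> a <= u0 -> c <= u0 -> u0 <= v0 -> v0 <= b ->
  fragments a b (fun i : 'I_N.+1 => oapp u u0 (unlift ord0 i))
                (fun i : 'I_N.+1 => oapp v v0 (unlift ord0 i)).
Proof.
move=> [uv uv'] au cu uv0 vb; split=> [i|i j].
  case: unliftP => [k _|_] /=; last by [].
  have [? [? vc]] := uv k; split => //; split => //.
  exact: le_trans vc (le_trans cu (le_trans uv0 vb)).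
case: unliftP => [k ->|->]; case: unliftP => [l ->|->] //=.
- by rewrite (inj_eq (@lift_inj _ _)) => /uv'.
- by move=> _; left; have [_ [_ vc]] := uv k; exact: le_trans vc cu.
- by move=> _; right; have [_ [_ vc]] := uv l; exact: le_trans vc cu.
Qed.

Lemma length_fragments a b N (u v : 'I_N -> R) (U : set R) :
  fragments a b u v -> measurable U -> (forall i, `]u i, v i] `<=` U) ->
  ((\sum_(i < N) (v i - u i))%:E <= mu U)%E.
Proof.
move=> uv mU AU.
have := @sum_integral_fragments _ _ _ _ _ _ _ (cst 1) uv mU AU (measurable_cst _)
  (fun=> ler01).
have mu1 A : measurable A -> (\int[mu]_(x in A) (cst (1 : R) x)%:E = mu A)%E.
  by move=> mA; rewrite -[RHS]mul1e -integral_cst.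
rewrite mu1//; apply: le_trans.
rewrite -sumEFin; apply: lee_sum => i _.
rewrite mu1// lebesgue_measure_itv /= lte_fin.
case: ifP => // /negbT; rewrite -leNgt => vu.
by rewrite lee_fin subr_le0.
Qed.

(* Cousin's lemma splits [a, b] into small intervals, each tagged by a point
   where f' <= 0 or by a point of an exceptional null set; the latter intervals
   lie in an open set of small measure. *)
Lemma rac_nonincreasing (a b : R) f : a <= b -> rac a b f ->
  {ae mu, forall x : R, a < x < b -> exists2 d, is_derive x 1 f d & d <= 0} ->
  f b <= f a.
Proof.
move=> ab fac [N0 [mN0 N00 sN0]]; apply/ler_addgt0Pr => e e0.
have e20 : 0 < e / 2 by rewrite divr_gt0.
have [d d0 fd] := fac _ e20.
pose ep := e / 2 / (b - a + 1).
have ba1 : 0 < b - a + 1 by rewrite ltr_wpDl// subr_ge0.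
have ep0 : 0 < ep by rewrite divr_gt0.
(* The endpoints join the exceptional set because the derivative is controlled only inside []a,
   b[]. *)
pose D : set R := N0 `|` [set a; b].
have mab : measurable ([set a; b] : set R) by apply: measurableU; exact: measurable_set1.
have mD : measurable D by exact: measurableU.
have D0 : mu D = 0%E.
  apply: null_set_setU => //; apply: null_set_setU; try exact: measurable_set1;
    exact: lebesgue_measure_set1.
have Doo : (mu D < +oo)%E by rewrite D0 ltry.
have [U [oU DU UD]] := lebesgue_regularity_outer mD Doo d0.
have mU : measurable U by exact: open_measurable.
have muU : (mu U < d%:E)%E.
  rewrite -(setDUK DU); apply: le_lt_trans UD.
  apply: (@le_trans _ _ (mu D + mu (U `\` D))%E).
    by apply: measureU2 => //; exact: measurableD.
  by rewrite D0 add0e.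
(* Increase is charged either to the slope [ep], worth at most [e / 2] in total, or to fragments
   inside [U], whose total length is below the [d] of absolute continuity. *)
pose P c := exists N (u v : 'I_N -> R), [/\ fragments a c u v,
  forall i, `]u i, v i] `<=` U &
  f c - f a <= ep * (c - a) + \sum_(i < N) (f (v i) - f (u i))].
have : P b.
  apply: (@real_induction _ a b) => //.
    exists 0%N, (fun=> a), (fun=> a); split=> [|i|]; first by split=> -[].
      by case: i.
    by rewrite !subrr mulr0 big_ord0 addr0.
  move=> x /andP[ax xb]; have [xD|xD] := pselect (D x).
    have [r r0 xr] := (nbhs_ballP _ _).1 (open_nbhs_nbhs (conj oU (DU _ xD))).
    exists r => // u0 v0 au ux xv vb xur vxr [N [u [v [uv uvU h]]]].
    exists N.+1, (fun i : 'I_N.+1 => oapp u u0 (unlift ord0 i)),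
                 (fun i : 'I_N.+1 => oapp v v0 (unlift ord0 i)).
    split.
    - by apply: fragments_cons uv _ _ _ _ => //; exact: le_trans xv.
    - move=> i; case: unliftP => [j _|_] /=; first exact: uvU.
      move=> t /=; rewrite in_itv /= => /andP[t1 t2]; apply: xr.
      by rewrite /ball /= ltr_norml; apply/andP; split; lra.
    rewrite big_ord_recl unlift_none /=; under eq_bigr do rewrite liftK /=.
    have : 0 <= ep * (v0 - u0) by apply: mulr_ge0; lra.
    by move: h; rewrite !mulrBr; lra.
  have [d' fd' d'0] : exists2 d', is_derive x 1 f d' & d' <= 0.
    have xN : ~ N0 x by move=> xN; apply: xD; left.
    have : ~ ~ (a < x < b -> exists2 d, is_derive x 1 f d & d <= 0).
      by move=> h; apply: xN; apply: sN0.
    move/contrapT; apply; rewrite !lt_neqAle ax xb !andbT.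
    by apply/andP; split; apply/eqP => xe; apply: xD; right; rewrite xe /=; [left|right].
  have [r r0 h] := is_derive_lin fd' ep0.
  exists r => // u0 v0 au ux xv vb xur vxr [N [u [v [[uv uv'] uvU k]]]].
  exists N, u, v; split=> //.
    split=> // i; have [? [? vc]] := uv i; split=> //; split=> //.
    by rewrite (le_trans vc)// (le_trans ux).
  have := h u0; rewrite distrC ger0_norm ?subr_ge0// => /(_ xur) /ler_normlP[h1 _].
  have := h v0; rewrite ger0_norm ?subr_ge0// => /(_ vxr) /ler_normlP[_ h2].
  have : d' * (v0 - u0) <= 0 by rewrite mulr_le0_ge0// subr_ge0 (le_trans ux).
  by move: k h1 h2; rewrite !mulrBr; lra.
move=> [N [u [v [uv uvU h]]]].
have sd : \sum_(i < N) (v i - u i) < d.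
  by rewrite -lte_fin; apply: le_lt_trans muU; exact: length_fragments uv mU uvU.
have := fd _ _ _ uv sd.
have : \sum_(i < N) (f (v i) - f (u i)) <= \sum_(i < N) `|f (v i) - f (u i)|.
  by apply: ler_sum => i _; exact: ler_norm.
have : ep * (b - a) <= e / 2.
  by rewrite /ep mulrAC ler_pdivrMr// ler_wpM2l ?ltW//; lra.
lra.
Qed.

End Monotonicity.

(** * Integrals on the line *)

Section RealIntegrals.
Variable R : realType.
Local Notation mu := (@lebesgue_measure R).
Implicit Types w h f : R -> R.

Definition rint w : R := \int[mu]_x w x.
Definition integ w := mu.-integrable setT (EFin \o w).

Lemma integ_meas w : integ w -> measurable_fun setT w.
Proof. by move=> /(measurable_int mu) /measurable_EFinP. Qed.

Lemma integ_dom w f : integ w -> measurable_fun setT f ->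
  (forall x, `|f x| <= w x) -> integ f.
Proof.
move=> iw mf fw; apply: le_integrable iw => //; first exact/measurable_EFinP.
move=> x _ /=; rewrite lee_fin (le_trans (fw x))//.
exact: ler_norm.
Qed.

Lemma integD w f : integ w -> integ f -> integ (fun x => w x + f x).
Proof. by move=> iw jf; apply: (integrableD measurableT iw jf). Qed.

Lemma integB w f : integ w -> integ f -> integ (fun x => w x - f x).
Proof. by move=> iw jf; apply: (integrableB measurableT iw jf). Qed.

Lemma integZ c w : integ w -> integ (fun x => c * w x).
Proof. by move=> iw; apply: (integrableZl measurableT c iw). Qed.

Lemma integ_norm w : integ w -> integ (fun x => `|w x|).
Proof. by move=> iw; apply: (integrable_norm iw). Qed.

Lemma rintD w f : integ w -> integ f -> rint (fun x => w x + f x) = rint w + rint f.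
Proof. by move=> iw jf; rewrite /rint RintegralD. Qed.

Lemma rintB w f : integ w -> integ f -> rint (fun x => w x - f x) = rint w - rint f.
Proof. by move=> iw jf; rewrite /rint RintegralB. Qed.

Lemma rintZ c w : integ w -> rint (fun x => c * w x) = c * rint w.
Proof. by move=> iw; rewrite /rint RintegralZl. Qed.

Lemma rint_ge0 w : (forall x, 0 <= w x) -> 0 <= rint w.
Proof. by move=> w0; apply: Rintegral_ge0. Qed.

Lemma le_rint w f : integ w -> integ f -> (forall x, w x <= f x) ->
  rint w <= rint f.
Proof. by move=> iw jf wf; apply: le_Rintegral. Qed.

Lemma EFin_rint w : integ w -> (rint w)%:E = (\int[mu]_x (w x)%:E)%E.
Proof. by move=> iw; rewrite /rint /Rintegral fineK//; apply: integrable_fin_num. Qed.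

(** Splits an integrable function into a part bounded by [k] and an excess of small L1 norm; the
    excess vanishes pointwise as [k] grows and is dominated by [w]. *)
Lemma integ_tail w : integ w -> (forall x, 0 <= w x) ->
  forall e, 0 < e -> exists k : nat,
    integ (fun x => Num.max (w x - k%:R) 0) /\
    rint (fun x => Num.max (w x - k%:R) 0) < e.
Proof.
move=> iw w0 e e0; have mw := integ_meas iw.
pose g (k : nat) x := Num.max (w x - k%:R) 0.
have mg k : measurable_fun setT (g k).
  by apply: measurable_maxr => //; apply: measurable_funB.
have gw k x : `|g k x| <= w x.
  rewrite /g ger0_norm ?le_max ?lexx ?orbT// ge_max w0 andbT.
  by rewrite lerBlDr lerDl.
have ig k : integ (g k) by apply: integ_dom iw _ _.
have [|||||_ _] := @dominated_convergence _ _ R mu setT measurableT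
  (fun k x => (g k x)%:E) (cst 0%E) (EFin \o w).
- by move=> k; apply/measurable_EFinP; exact: mg.
- exact: measurable_cst.
- apply/aeW => x _; apply: cvg_near_cst; near=> k.
  rewrite /g /=; congr EFin; apply/max_idPr; rewrite subr_le0.
  by near: k; exact: nbhs_infty_ger.
- exact: iw.
- by apply/aeW => x k _ /=; rewrite lee_fin.
rewrite integral0 => /fine_cvgP[_] /cvgrPdist_lt /(_ _ e0)[k _ /(_ k (leqnn k))].
rewrite sub0r normrN => h; exists k; split; first exact: ig.
by apply: le_lt_trans h; exact: ler_norm.
Unshelve. all: by end_near. Qed.

(** Dominated convergence would not be uniform in [x]. Three contributions of [e / 3] are: the part
    of [w] below height [k] within distance [d] of [x], the excess over [k] anywhere, and the rest,
    where the exponential is at most [exp (- c d)]. *)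
Lemma kernel_small w : integ w -> (forall x, 0 <= w x) ->
  forall e : R, 0 < e -> exists2 K : R, 0 < K & forall k : R, K <= k -> forall x,
    rint (fun t => expR (- k * `|x - t|) * w t) <= e.
Proof.
move=> iw w0 e e0; have mw := integ_meas iw.
have e3 : 0 < e / 3 by rewrite divr_gt0.
have [k [ik tk]] := integ_tail iw w0 e3.
(* Makes height [k] times length [2 d] at most [e / 3]. *)
pose d := e / 3 / (2 * (k%:R + 1)).
have k1 : 0 < 2 * (k%:R + 1) :> R by rewrite mulr_gt0// ltr_wpDl.
have d0 : 0 < d by rewrite divr_gt0.
have kd : k%:R * (2 * d) <= e / 3.
  rewrite /d; have -> : k%:R * (2 * (e / 3 / (2 * (k%:R + 1)))) =
     e / 3 * (k%:R / (k%:R + 1)) by field; rewrite gt_eqF// ltr_wpDl.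
  by rewrite ler_piMr ?(ltW e3)// ler_pdivrMr ?ltr_wpDl// mul1r lerDl ler01.
have W0 : 0 <= rint w by exact: rint_ge0.
(* From [exp (c d) >= 1 + c d], a rate [c >= K] gives [exp (- c d) * rint w <= e / 3]. *)
pose K := (rint w * 3 / e + 1) / d.
have K0 : 0 < K.
  rewrite divr_gt0// ltr_wpDl//.
  by apply: divr_ge0; [exact: mulr_ge0|exact: ltW].
exists K => // c Kc x; have c0 : 0 < c by exact: lt_le_trans Kc.
have small : expR (- c * d) * rint w <= e / 3.
  rewrite mulNr expRN mulrC ler_pdivrMr ?expR_gt0//.
  have h : rint w * 3 / e <= expR (c * d).
    apply: (@le_trans _ _ (1 + c * d)); last exact: expR_ge1Dx.
    have : K * d <= c * d by rewrite ler_pM2r.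
    by rewrite {1}/K divfK ?gt_eqF//; lra.
  have -> : rint w = e / 3 * (rint w * 3 / e) by field; rewrite gt_eqF.
  by rewrite ler_pM2l.
pose w1 := fun t => k%:R * \1_(`[x - d, x + d]%classic) t : R.
have ind : integ (\1_(`[x - d, x + d]%classic) : R -> R).
  exact: integrable_indic_itv.
have iw1 : integ w1 by exact: integZ.
pose w2 := fun t => Num.max (w t - k%:R) 0.
pose w3 := fun t => expR (- c * d) * w t.
have iw3 : integ w3 by exact: integZ.
have mexp : measurable_fun setT (fun t : R => expR (- c * `|x - t|)).
  apply: measurableT_comp => //; apply: measurable_funM => //.
  by apply: measurableT_comp => //; apply: measurable_funB.
apply: (@le_trans _ _ (rint (fun t => w1 t + (w2 t + w3 t)))).
  apply: le_rint.
  - apply: integ_dom iw _ _; first exact: measurable_funM.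
    move=> t; rewrite normrM ger0_norm ?expR_ge0// ger0_norm// ler_piMl//.
    by rewrite -expR0 ler_expR mulNr oppr_le0 mulr_ge0// ltW.
  - by apply: integD => //; exact: integD.
  move=> t; rewrite /w1 /w2 /w3 indicE.
  have wk : w t <= k%:R + Num.max (w t - k%:R) 0.
    by rewrite -lerBlDl le_max lexx.
  have m0 : 0 <= Num.max (w t - k%:R) 0 by rewrite le_max lexx orbT.
  have [td|td] := boolP (t \in _).
    rewrite mulr1 addrA; apply: ler_wpDr; first by rewrite mulr_ge0 ?expR_ge0.
    apply: le_trans wk; rewrite ler_piMl//.
    by rewrite -expR0 ler_expR mulNr oppr_le0 mulr_ge0// ltW.
  rewrite mulr0 add0r ler_wpDl// ler_wpM2r// ler_expR.
  rewrite !mulNr lerN2 ler_pM2l//; apply/ltW.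
  rewrite ltNge; apply/negP => h; move/negP: td; apply; rewrite inE /= in_itv /=.
  by move: h; rewrite ler_norml => /andP[h1 h2]; apply/andP; split; lra.
rewrite rintD//; last exact: integD.
rewrite rintD// /w1 rintZ// /w3 rintZ//.
have -> : rint \1_(`[x - d, x + d]%classic) = 2 * d.
  rewrite /rint /Rintegral integral_indic// setIT.
  rewrite [X in fine X](_ : _ = (2 * d)%:E)//.
  apply: etrans (lebesgue_measure_itv `[x - d, x + d]) _; rewrite /= lte_fin ifT; last by lra.
  by rewrite -EFinD; congr EFin; ring.
rewrite /w2; lra.
Qed.

Definition prim h x := \int[mu]_(t in `]-oo, x]) h t.
(** Integrability on left half-lines only: the factor [exp (- k t)] in the variation of constants
    formula may grow at infinity. *)
Definition left_integ h := measurable_fun setT h /\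
  forall y, mu.-integrable `]-oo, y] (EFin \o h).

Lemma integ_left h : integ h -> left_integ h.
Proof.
move=> ih; split=> [|y]; first exact: integ_meas.
by apply: integrableS ih.
Qed.

Lemma left_integ_dom w h : left_integ w -> measurable_fun setT h ->
  (forall y, exists C, forall x, x <= y -> `|h x| <= C * w x) -> left_integ h.
Proof.
move=> [mw iw] mh hC; split=> // y; have [C hy] := hC y.
apply: le_integrable (integrableZl _ C (iw y)) => //.
  by apply/measurable_EFinP; exact: measurable_funTS.
move=> x; rewrite /= in_itv /= => xy; rewrite lee_fin.
by rewrite (le_trans (hy _ xy))// ler_norm.
Qed.

Lemma prim_derive h : left_integ h ->
  {ae mu, forall x : R, is_derive x 1 (prim h) (h x)}.
Proof.
move=> [mh ih].
have loch : locally_integrable setT h.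
  split => //; first exact: openT.
  move=> K _ cK; have [M [_ KM]] := compact_bounded cK.
  have /integrableP[_ hM] := ih (M + 1).
  apply: le_lt_trans hM; apply: ge0_subset_integral => //=.
  - exact: compact_measurable.
  - by apply/measurable_EFinP/measurableT_comp => //; exact: measurable_funTS.
  - move=> x Kx; rewrite /= in_itv /=.
    by apply: le_trans (KM (M + 1) _ _ Kx); rewrite ?ler_norm ?ltrDl.
have := FTC1Ny ih loch; apply: filterS; first exact: (ae_filter_ringOfSetsType mu).
move=> x [dx dE].
by split => //; rewrite -dE derive1E.
Qed.

(** Truncate [|h|] at a height [k]: the bounded part contributes at most [k] times the total length
    of the fragments, and the excess has integral below [e / 2] over all of them together. *)
Lemma rac_prim h a b : left_integ h -> rac a b (prim h).
Proof.
move=> [mh ih].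
pose w := (fun t => `|h t|) \_ `]-oo, b].
have iw : integ w.
  rewrite /integ /w -restrict_EFin; apply/integrable_restrict => //.
  by rewrite setTI; exact: (integrable_norm (ih b)).
have w0 x : 0 <= w x by rewrite /w patchE; case: ifP.
move=> e e0; have e2 : 0 < e / 2 by rewrite divr_gt0.
have [k [ik tk]] := integ_tail iw w0 e2.
have k1 : 0 < k%:R + 1 :> R by rewrite ltr_wpDl.
exists (e / 2 / (k%:R + 1)); first by rewrite divr_gt0.
move=> N u v uv sd.
pose wk x := Num.max (w x - k%:R) 0.
have wk0 x : 0 <= wk x by rewrite le_max lexx orbT.
have mwk : measurable_fun setT wk by exact: integ_meas ik.
have s1 i : `|prim h (v i) - prim h (u i)| <=
    k%:R * (v i - u i) + \int[mu]_(t in `]u i, v i]) wk t.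
  have [au [uvi vb]] := uv.1 i.
  rewrite /prim (Rintegral_itvB (ih (v i)))//.
  have iuv : mu.-integrable `]u i, v i] (EFin \o h).
    by apply: integrableS (ih (v i)) => // t; rewrite /= !in_itv /= => /andP[].
  apply: le_trans (le_normr_Rintegral _ iuv) _ => //.
  have mS : mu.-integrable `]u i, v i] (EFin \o wk) by apply: integrableS ik.
  have kS : mu.-integrable `]u i, v i] (EFin \o cst (k%:R : R)).
    apply: measurable_bounded_integrable => //.
      by rewrite /= lebesgue_measure_itv /=; case: ifP => _; rewrite ?ltry// -EFinD ltry.
    exact: bounded_cst.
  apply: (@le_trans _ _ (\int[mu]_(t in `]u i, v i]) (k%:R + wk t))).
    apply: le_Rintegral => //; first exact: integrable_norm.
      by have := integrableD _ kS mS; exact.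
    move=> t; rewrite /= in_itv /= => /andP[_ tv].
    have -> : `|h t| = w t.
      by rewrite /w patchE ifT// inE /= in_itv /= (le_trans tv).
    by rewrite -lerBlDl le_max lexx.
  have muE : mu `]u i, v i] = (v i - u i)%:E.
    rewrite lebesgue_measure_itv /= lte_fin; case: ltP => [_|vu]; first by rewrite -EFinD.
    by congr EFin; apply/eqP; rewrite eq_sym subr_eq0 eq_le vu.
  rewrite (RintegralD _ kS mS)// lerD2r Rintegral_cst//.
  by rewrite (_ : fine _ = v i - u i)//; exact: (congr1 fine muE).
apply: (@le_lt_trans _ _ (\sum_(i < N) (k%:R * (v i - u i) +
    \int[mu]_(t in `]u i, v i]) wk t))); first by apply: ler_sum.
rewrite big_split /= -mulr_sumr [e]splitr.
apply: ltr_leD.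
  apply: (@le_lt_trans _ _ ((k%:R + 1) * \sum_(i < N) (v i - u i))).
    rewrite ler_wpM2r ?lerDl// sumr_ge0// => i _.
    by rewrite subr_ge0; case: (uv.1 i) => _ [].
  by rewrite mulrC -ltr_pdivlMr.
apply: le_trans (ltW tk); rewrite -lee_fin EFin_rint//.
have iS i : mu.-integrable `]u i, v i] (EFin \o wk) by apply: integrableS ik.
rewrite -sumEFin.
have := @sum_integral_fragments _ _ _ _ _ _ setT wk uv measurableT _ mwk wk0.
move=> /(_ (fun=> @subsetT _ _)); apply: le_trans.
apply: lee_sum => i _; rewrite /Rintegral fineK//.
exact: integrable_fin_num.
Qed.

End RealIntegrals.

(** * Integrals of complex-valued functions on the line *)

Section ComplexIntegrals.
Variable R : realType.
Local Notation mu := (@lebesgue_measure R).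
Implicit Types (f g : R -> R[i]) (w : R -> R).

Definition cmeas f := measurable_fun setT (fun t => complex.Re (f t)) /\
  measurable_fun setT (fun t => complex.Im (f t)).

Definition cint f : R[i] :=
  rint (fun t => complex.Re (f t)) +i* rint (fun t => complex.Im (f t)).

Lemma cmeas_ext f g : f =1 g -> cmeas f -> cmeas g.
Proof. by move=> /funext ->. Qed.

Lemma cmeas_cst c : cmeas (fun=> c).
Proof. by split; exact: measurable_cst. Qed.

Lemma cmeasD f g : cmeas f -> cmeas g -> cmeas (fun t => f t + g t).
Proof.
move=> [fr fi] [gr gi]; split; first under eq_fun do rewrite Re_add.
  exact: measurable_funD.
by under eq_fun do rewrite Im_add; exact: measurable_funD.
Qed.

Lemma cmeasM f g : cmeas f -> cmeas g -> cmeas (fun t => f t * g t).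
Proof.
move=> [fr fi] [gr gi]; split; first under eq_fun do rewrite Re_mul.
  by apply: measurable_funB; exact: measurable_funM.
by under eq_fun do rewrite Im_mul; apply: measurable_funD; exact: measurable_funM.
Qed.

Lemma cmeas_sum (I : Type) (s : seq I) (P : pred I) (f : I -> R -> R[i]) :
  (forall i, P i -> cmeas (f i)) -> cmeas (fun t => \sum_(i <- s | P i) f i t).
Proof.
move=> mf; elim: s => [|i s IH].
  by apply: cmeas_ext (cmeas_cst 0) => t; rewrite big_nil.
have [Pi|Pi] := boolP (P i).
  by apply: cmeas_ext (cmeasD (mf _ Pi) IH) => t; rewrite big_cons Pi.
by apply: cmeas_ext IH => t; rewrite big_cons (negbTE Pi).
Qed.

Lemma cmeas_if (p : R -> bool) f g : measurable_fun setT p -> cmeas f -> cmeas g ->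
  cmeas (fun t => if p t then f t else g t).
Proof.
move=> mp [fr fi] [gr gi]; split.
  rewrite (_ : (fun t => _) = fun t => if p t then complex.Re (f t) else complex.Re (g t)).
    by apply: measurable_fun_ifT.
  by apply/funext => t; case: ifP.
rewrite (_ : (fun t => _) = fun t => if p t then complex.Im (f t) else complex.Im (g t)).
  by apply: measurable_fun_ifT.
by apply/funext => t; case: ifP.
Qed.

Definition cinteg f := integ (fun t => complex.Re (f t)) /\
  integ (fun t => complex.Im (f t)).

Lemma cinteg_dom w f : integ w -> cmeas f -> (forall t, modc (f t) <= w t) ->
  cinteg f.
Proof.
move=> iw [mr mi] fw; split; apply: integ_dom iw _ _ => // t.
  by rewrite (le_trans (Re_le_modc _)).
by rewrite (le_trans (Im_le_modc _)).
Qed.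

Lemma cintegZ c f : cinteg f -> cinteg (fun t => c * f t).
Proof.
move=> [fr fi]; split.
  rewrite (_ : (fun t => _) = fun t => complex.Re c * complex.Re (f t) -
    complex.Im c * complex.Im (f t)); last by apply/funext => t; rewrite Re_mul.
  by apply: integB; exact: integZ.
rewrite (_ : (fun t => _) = fun t => complex.Re c * complex.Im (f t) +
  complex.Im c * complex.Re (f t)); last by apply/funext => t; rewrite Im_mul.
by apply: integD; exact: integZ.
Qed.

Lemma cintD f g : cinteg f -> cinteg g ->
  cint (fun t => f t + g t) = cint f + cint g.
Proof.
move=> [fr fi] [gr gi]; apply: complexP; rewrite ?Re_add ?Im_add /= -rintD//;
  by congr rint; apply/funext => t; rewrite ?Re_add ?Im_add.
Qed.

Lemma cintZ c f : cinteg f -> cint (fun t => c * f t) = c * cint f.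
Proof.
move=> [fr fi]; apply: complexP; rewrite ?Re_mul ?Im_mul /= -!rintZ//.
  by rewrite -rintB; [congr rint; apply/funext => t; rewrite Re_mul|exact: integZ..].
by rewrite -rintD; [congr rint; apply/funext => t; rewrite Im_mul|exact: integZ..].
Qed.

Lemma cintB f g : cinteg f -> cinteg g ->
  cint (fun t => f t - g t) = cint f - cint g.
Proof.
move=> jf jg; rewrite -[- cint g]mulN1r -cintZ// -cintD//; last exact: cintegZ.
by congr cint; apply/funext => t; rewrite mulN1r.
Qed.

(* Rotate [cint f] onto the positive real axis. *)
Lemma le_modc_cint w f : integ w -> cmeas f -> (forall t, modc (f t) <= w t) ->
  modc (cint f) <= rint w.
Proof.
move=> iw mf fw; have jf := cinteg_dom iw mf fw.
have [->|z0] := eqVneq (cint f) 0.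
  by rewrite modc0 rint_ge0// => t; rewrite (le_trans (modc_ge0 _) (fw t)).
pose c := (modc (cint f))^-1%:C * (conjc (cint f)).
have mz : 0 < modc (cint f) by rewrite modc_gt0.
have modJ z : modc (conjc z) = modc z :> R by case: z => a b; rewrite !modcE /= sqrrN.
have c1 : modc c = 1.
  by rewrite /c modcM modJ modc_real ger0_norm ?invr_ge0 ?ltW// mulVf ?gt_eqF.
have -> : modc (cint f) = complex.Re (cint (fun t => c * f t)).
  rewrite cintZ// /c -mulrA ReZ mulrC.
  have -> : complex.Re (conjc (cint f) * cint f) = modc (cint f) ^+ 2.
    by rewrite sqr_modc; case: (cint f) => a b; rewrite Re_mul /=; ring.
  by rewrite expr2 mulfK// gt_eqF.
apply: le_rint => //; first exact: (cintegZ _ jf).1.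
move=> t; rewrite (le_trans (ler_norm _))// (le_trans (Re_le_modc _))//.
by rewrite modcM c1 mul1r.
Qed.

Lemma rint_dct (f : nat -> R -> R) (g : R -> R) w : integ w ->
  (forall k, measurable_fun setT (f k)) -> (forall k t, `|f k t| <= w t) ->
  (forall t, f k t @[k --> \oo] --> g t) ->
  rint (f k) @[k --> \oo] --> rint g.
Proof.
move=> iw mf fw fg.
have mg : measurable_fun setT g.
  by apply: measurable_fun_cvg mf _ => t _; exact: fg.
have [|||||_ _] := @dominated_convergence _ _ R mu setT measurableT
  (fun k x => (f k x)%:E) (EFin \o g) (EFin \o w).
- by move=> k; apply/measurable_EFinP; exact: mf.
- exact/measurable_EFinP.
- apply/aeW => t _; apply: cvg_EFin; [by apply: nearW|exact: fg].
- exact: iw.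
- by apply/aeW => t k _ /=; rewrite lee_fin.
rewrite /=.
have ig : integ g.
  apply: integ_dom iw mg _ => t.
  by apply: (cvgr_to_le (cvg_norm (fg t))); apply: nearW => k.
by rewrite -EFin_rint// => /fine_cvgP[_].
Qed.

End ComplexIntegrals.

(** * Fixed points of integral operators *)

Section FixedPoint.
Variable R : realType.
Implicit Types (f g : R -> R[i]) (w : R -> R).

Lemma cto_unique (T : Type) (G : set_system T) {FG : ProperFilter G}
    (f : T -> R[i]) c d : cto G f c -> cto G f d -> c = d.
Proof.
move=> fc fd; apply: complexP; first exact: (cvg_unique _ (cto_Re fc) (cto_Re fd)).
exact: (cvg_unique _ (cto_Im fc) (cto_Im fd)).
Qed.

Lemma cto_le (T : Type) (G : set_system T) {FG : ProperFilter G}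
    (f : T -> R[i]) c M : cto G f c -> (\forall t \near G, modc (f t) <= M) ->
  modc c <= M.
Proof.
move=> fc fM; apply/ler_addgt0Pl => e e0; have [t [h1 h2]] : exists t,
    modc (f t - c) < e /\ modc (f t) <= M.
  apply: (@filter_ex _ G); move: fc => /cvgrPdist_lt /(_ _ e0) fc.
  near=> t; split; last by near: t.
  by rewrite -[ltLHS]ger0_norm ?modc_ge0// -normrN -sub0r; near: t.
have -> : c = (c - f t) + f t by ring.
by rewrite (le_trans (le_modcD _ _))// lerD// ltW// modcB.
Unshelve. all: by end_near. Qed.

Lemma cint_dct (f : nat -> R -> R[i]) g w : integ w ->
  (forall k, cmeas (f k)) -> (forall k t, modc (f k t) <= w t) ->
  (forall t, cto \oo (fun k => f k t) (g t)) ->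
  cto \oo (fun k => cint (f k)) (cint g).
Proof.
move=> iw mf fw fg; apply: cto_ReIm => /=; apply: (rint_dct iw).
- by move=> k; exact: (mf k).1.
- by move=> k t; rewrite (le_trans (Re_le_modc _)).
- by move=> t; exact: cto_Re.
- by move=> k; exact: (mf k).2.
- by move=> k t; rewrite (le_trans (Im_le_modc _)).
- by move=> t; exact: cto_Im.
Qed.

Lemma geometric_cvg (a : nat -> R) C :
  (forall k, `|a k.+1 - a k| <= C * (1 / 2) ^+ k) -> exists l : R, a k @[k --> \oo] --> l.
Proof.
move=> aC; have : cvgn (series (telescope a)).
  apply: normed_cvg; apply: (@series_le_cvg _ _ (geometric C (1 / 2))).
  - by move=> k /=.
  - by move=> k; rewrite /geometric /= (le_trans (normr_ge0 _) (aC k)).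
  - by move=> k; exact: aC.
  by apply: is_cvg_geometric_series; rewrite ger0_norm; lra.
move=> /cvg_ex[l hl]; exists (a 0%N + l).
rewrite (_ : (fun k => a k) = fun k => a 0%N + series (telescope a) k); last first.
  by apply/funext => k; rewrite -eq_sum_telescope.
by apply: cvgD => //; exact: cvg_cst.
Qed.

Lemma geometric_cto (a : nat -> R[i]) C :
  (forall k, modc (a k.+1 - a k) <= C * (1 / 2) ^+ k) -> exists l, cto \oo a l.
Proof.
move=> aC.
have [|lr hr] := @geometric_cvg (fun k => complex.Re (a k)) C.
  by move=> k; rewrite -Re_opp -Re_add (le_trans (Re_le_modc _)).
have [|li hi] := @geometric_cvg (fun k => complex.Im (a k)) C.
  by move=> k; rewrite -Im_opp -Im_add (le_trans (Im_le_modc _)).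
by exists (lr +i* li); exact: cto_ReIm.
Qed.

Lemma cmeas_cto (f : nat -> R -> R[i]) g : (forall k, cmeas (f k)) ->
  (forall t, cto \oo (fun k => f k t) (g t)) -> cmeas g.
Proof.
move=> mf fg; split.
  apply: (@measurable_fun_cvg _ _ _ _ (fun k t => complex.Re (f k t))).
    by move=> k; exact: (mf k).1.
  by move=> t _; exact: cto_Re.
apply: (@measurable_fun_cvg _ _ _ _ (fun k t => complex.Im (f k t))).
  by move=> k; exact: (mf k).2.
by move=> t _; exact: cto_Im.
Qed.

Section Picard.
Variables (n : nat) (G : 'I_n -> R -> 'I_n -> R -> R[i]).
Variables (W : 'I_n -> R -> 'I_n -> R -> R) (u : 'I_n -> R) (f : 'I_n -> R[i]).

Definition kop (z : 'I_n -> R -> R[i]) j x :=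
  \sum_i cint (fun t => G j x i t * z i t).

Hypothesis u0 : forall j, 0 <= u j.
Hypothesis mG : forall j x i, cmeas (G j x i).
Hypothesis iW : forall j x i, integ (W j x i).
Hypothesis GW : forall j x i t, modc (G j x i t) <= W j x i t.
Hypothesis Wu : forall j x, \sum_i rint (W j x i) * u i <= u j / 2.
Hypothesis fu : forall j, modc (f j) <= u j.
Hypothesis mkop : forall z C, (forall i, cmeas (z i)) ->
  (forall i t, modc (z i t) <= C) -> forall j, cmeas (kop z j).

Lemma kop_summand_le z c j x i t : modc (z i t) <= c * u i ->
  modc (G j x i t * z i t) <= c * u i * W j x i t.
Proof.
move=> zc; rewrite modcM mulrC.
by apply: ler_pM; rewrite ?modc_ge0.
Qed.

Lemma kop_le z c j x : 0 <= c -> (forall i, cmeas (z i)) ->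
  (forall i t, modc (z i t) <= c * u i) -> modc (kop z j x) <= c / 2 * u j.
Proof.
move=> c0 mz zc; rewrite (le_trans (le_modc_sum _ _ _))//.
apply: (@le_trans _ _ (c * \sum_i rint (W j x i) * u i)); last first.
  by rewrite mulrAC -mulrA; apply: ler_wpM2l.
rewrite mulr_sumr; apply: ler_sum => i _.
rewrite [_ * u i]mulrC mulrA -rintZ//; apply: le_modc_cint.
- exact: integZ.
- exact: cmeasM.
- by move=> t; exact: kop_summand_le.
Qed.

Lemma kopB z z' c j x : (forall i, cmeas (z i)) -> (forall i, cmeas (z' i)) ->
  (forall i t, modc (z i t) <= c * u i) -> (forall i t, modc (z' i t) <= c * u i) ->
  kop z j x - kop z' j x = kop (fun i t => z i t - z' i t) j x.
Proof.
move=> mz mz' zc zc'; rewrite /kop -sumrB; apply: eq_bigr => i _.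
rewrite -cintB; first by congr cint; apply/funext => t; rewrite mulrBr.
  by apply: (cinteg_dom (integZ (c * u i) (iW j x i)));
    [exact: cmeasM|move=> t; exact: kop_summand_le].
by apply: (cinteg_dom (integZ (c * u i) (iW j x i)));
  [exact: cmeasM|move=> t; exact: kop_summand_le].
Qed.

Definition picard k := iter k (fun z j x => f j + kop z j x) (fun j _ => f j).

Let bound z c := (forall i, cmeas (z i)) /\ (forall i t, modc (z i t) <= c * u i).

Lemma bound_uniform z c : bound z c -> exists C, forall i t, modc (z i t) <= C.
Proof.
move=> [_ zc]; exists (\sum_i `|c * u i|) => i t.
rewrite (le_trans (zc i t))// (le_trans (ler_norm _))// (bigD1 i)//=.
by rewrite lerDl sumr_ge0.
Qed.

(** The constant [2] reproduces itself: [|f| <= u], and the operator halves the bound [2 u]. *)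
Lemma picard_bound k : bound (picard k) 2.
Proof.
elim: k => [|k IH].
  split=> [i|i t]; first exact: cmeas_cst.
  by rewrite /picard /= (le_trans (fu i))// ler_peMl// ler1n.
have [C hC] := bound_uniform IH; case: IH => IHm IHb; split=> [i|i t].
  by apply: cmeasD; [exact: cmeas_cst|exact: mkop IHm hC i].
rewrite /picard /= (le_trans (le_modcD _ _))//.
have := kop_le i t (ler0n R 2) IHm IHb.
rewrite divff// mul1r => h; have := lerD (fu i) h.
by rewrite mulrDl mul1r.
Qed.

Lemma picard_step k j x :
  modc (picard k.+1 j x - picard k j x) <= (1 / 2) ^+ k * u j.
Proof.
elim: k j x => [|k IH] j x.
  rewrite /picard /= addrAC subrr add0r.
  have f1 i t : modc (picard 0 i t) <= 1 * u i by rewrite mul1r; exact: fu.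
  have h := kop_le j x ler01 (picard_bound 0).1 f1.
  by rewrite expr0 (le_trans h)// ler_wpM2r//; lra.
have [mk bk] := picard_bound k; have [mk1 bk1] := picard_bound k.+1.
rewrite [picard k.+2 j x](_ : _ = f j + kop (picard k.+1) j x)//.
rewrite [in X in _ - X](_ : picard k.+1 j x = f j + kop (picard k) j x)//.
rewrite opprD addrACA subrr add0r (kopB j x mk1 mk bk1 bk).
rewrite (_ : (1 / 2) ^+ k.+1 * u j = (1 / 2) ^+ k / 2 * u j); last first.
  by rewrite exprSr mulrA mulr1.
apply: kop_le.
- by apply: exprn_ge0; lra.
- move=> i; apply: cmeasD => //; under eq_fun do rewrite -mulN1r.
  by apply: cmeasM => //; exact: cmeas_cst.
- by move=> i t; exact: IH.
Qed.

(** Banach iteration for the norm [sup |z_i| / u_i], in which [Wu] bounds the operator by [1/2].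
    Limits are taken pointwise, so that measurability survives and the equation holds at every
    point. *)
Lemma picard_fixpoint : exists z : 'I_n -> R -> R[i],
  [/\ forall i, cmeas (z i), forall i t, modc (z i t) <= 2 * u i &
      forall j x, z j x = f j + kop z j x].
Proof.
have /choice[z hz] : forall jx : 'I_n * R,
    exists l, cto \oo (fun k => picard k jx.1 jx.2) l.
  move=> [j x]; apply: (@geometric_cto _ (u j)) => k /=.
  by rewrite mulrC; exact: picard_step.
have {}hz j x : cto \oo (fun k => picard k j x) (z (j, x)) by exact: (hz (j, x)).
exists (fun j x => z (j, x)); split=> [i|i t|j x].
- apply: (@cmeas_cto (fun k => picard k i)) => [k|t]; last exact: hz.
  by case: (picard_bound k).
- by apply: (cto_le (hz i t)); apply: nearW => k; case: (picard_bound k).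
(* Two limits of the shifted iterates: [z], and by dominated convergence [f + kop z]. *)
apply: (@cto_unique _ \oo _ (fun k => picard k.+1 j x)).
  by have := hz j x; rewrite /cto -(cvg_shiftS (fun k => modc (picard k j x - z (j, x)))).
apply: ctoD; first exact: cto_cst.
apply: cto_sum => i _; apply: (@cint_dct _ _ (fun t => 2 * u i * W j x i t)).
- exact: integZ.
- by move=> k; apply: cmeasM => //; case: (picard_bound k).
- by move=> k t; apply: kop_summand_le; case: (picard_bound k).
- by move=> t; apply: ctoM; [exact: cto_cst|exact: hz].
Qed.

End Picard.
End FixedPoint.

(** * Complex derivatives and exponential kernels *)

Section ComplexCalculus.
Variable R : realType.
Local Notation mu := (@lebesgue_measure R).
Implicit Types (f g : R -> R[i]) (a b x : R) (c d e k : R[i]).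
Local Notation ac := abs_continuous_on.

Lemma ac_ext a b f g : (forall x, a <= x <= b -> f x = g x) ->
  ac a b f -> ac a b g.
Proof.
move=> fg /abs_continuous_onP[fr fi]; apply/abs_continuous_onP; split.
  by apply: rac_ext fr => x /fg ->.
by apply: rac_ext fi => x /fg ->.
Qed.

Lemma ac_cst a b c : ac a b (fun=> c).
Proof. by apply/abs_continuous_onP; split; exact: rac_cst. Qed.

Lemma acD a b f g : ac a b f -> ac a b g -> ac a b (fun x => f x + g x).
Proof.
move=> /abs_continuous_onP[fr fi] /abs_continuous_onP[gr gi].
apply/abs_continuous_onP; split.
  by apply: rac_ext (racD fr gr) => x _; rewrite Re_add.
by apply: rac_ext (racD fi gi) => x _; rewrite Im_add.
Qed.

Lemma acM a b f g : ac a b f -> ac a b g -> ac a b (fun x => f x * g x).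
Proof.
move=> /abs_continuous_onP[fr fi] /abs_continuous_onP[gr gi].
apply/abs_continuous_onP; split.
  by apply: rac_ext (racD (racM fr gr) (racN (racM fi gi))) => x _; rewrite Re_mul.
by apply: rac_ext (racD (racM fr gi) (racM fi gr)) => x _; rewrite Im_mul.
Qed.

Lemma ac_sum a b (I : Type) (s : seq I) (P : pred I) (f : I -> R -> R[i]) :
  (forall i, P i -> ac a b (f i)) -> ac a b (fun x => \sum_(i <- s | P i) f i x).
Proof.
move=> fac; elim: s => [|i s IH].
  by apply: ac_ext (ac_cst a b 0) => x _; rewrite big_nil.
have [Pi|Pi] := boolP (P i).
  by apply: ac_ext (acD (fac _ Pi) IH) => x _; rewrite big_cons Pi.
by apply: ac_ext IH => x _; rewrite big_cons (negbTE Pi).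
Qed.

Lemma rac_bounded_derive a b (f f' : R -> R) C :
  (forall x, is_derive x 1 f (f' x)) -> (forall x, `|f' x| <= C) -> rac a b f.
Proof.
move=> df fC; apply: (@rac_lip _ _ _ C); first exact: le_trans (fC 0).
move=> u v _ uv _.
have cf : {within `[u, v], continuous f}.
  by apply: derivable_within_continuous => x _; case: (df x).
have [c _ ->] := MVT_segment uv (fun x _ => df x) cf.
by rewrite normrM ler_wpM2r.
Qed.

Lemma is_derive_scale (f : R -> R) (c d x : R) : is_derive (c * x) 1 f d ->
  is_derive x 1 (fun t => f (c * t)) (c * d).
Proof.
move=> fd; have lin : is_derive x 1 ( *%R c) c.
  by apply: is_derive_eq; rewrite /GRing.scale /= mulr1.
by apply: is_derive_eq (is_derive1_comp fd lin) _; rewrite /GRing.scale /= mulrC.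
Qed.

Lemma ac_cexp a b k : ac a b (fun x => cexp (k * x%:C)).
Proof.
have e : rac a b (fun x => expR (complex.Re k * x)).
  apply: rac_expR; apply: (@rac_lip _ _ _ `|complex.Re k|) => // u v _ _ _.
  by rewrite -mulrBr normrM.
have id2 x : complex.Re (k * x%:C) = complex.Re k * x by rewrite mulrC ReZ mulrC.
have id3 x : complex.Im (k * x%:C) = complex.Im k * x by rewrite mulrC ImZ mulrC.
apply/abs_continuous_onP; split.
  apply: (@rac_ext _ _ _ (fun x => expR (complex.Re k * x) * cos (complex.Im k * x))).
    by move=> x _; rewrite /= id2 id3.
  apply: racM => //; apply: (@rac_bounded_derive _ _ _
    (fun x => - sin (complex.Im k * x) * complex.Im k) `|complex.Im k|) => x.
    by rewrite mulrC; apply: is_derive_scale.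
  by rewrite normrM normrN ler_piMl// ler_norml sin_geN1 sin_le1.
apply: (@rac_ext _ _ _ (fun x => expR (complex.Re k * x) * sin (complex.Im k * x))).
  by move=> x _; rewrite /= id2 id3.
apply: racM => //; apply: (@rac_bounded_derive _ _ _
  (fun x => cos (complex.Im k * x) * complex.Im k) `|complex.Im k|) => x.
  by rewrite mulrC; apply: is_derive_scale.
by rewrite normrM ler_piMl// ler_norml cos_geN1 cos_le1.
Qed.

Lemma is_cderive_cst c x : is_cderive (fun=> c) x 0.
Proof. by split; exact: is_derive_cst. Qed.

Lemma is_cderiveD f g x d e : is_cderive f x d -> is_cderive g x e ->
  is_cderive (fun t => f t + g t) x (d + e).
Proof.
move=> [fr fi] [gr gi]; split.
  by under eq_fun do rewrite Re_add; rewrite Re_add; exact: is_deriveD.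
by under eq_fun do rewrite Im_add; rewrite Im_add; exact: is_deriveD.
Qed.

Lemma is_cderiveM f g x d e : is_cderive f x d -> is_cderive g x e ->
  is_cderive (fun t => f t * g t) x (d * g x + f x * e).
Proof.
move=> [fr fi] [gr gi]; split.
  under eq_fun do rewrite Re_mul.
  apply: is_derive_eq (is_deriveB (is_deriveM fr gr) (is_deriveM fi gi)) _.
  by rewrite /GRing.scale /= Re_add !Re_mul; ring.
under eq_fun do rewrite Im_mul.
apply: is_derive_eq (is_deriveD (is_deriveM fr gi) (is_deriveM fi gr)) _.
by rewrite /GRing.scale /= Im_add !Im_mul; ring.
Qed.

Lemma is_cderive_sum (I : Type) (s : seq I) (P : pred I) (f : I -> R -> R[i]) x
    (d : I -> R[i]) : (forall i, P i -> is_cderive (f i) x (d i)) ->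
  is_cderive (fun t => \sum_(i <- s | P i) f i t) x (\sum_(i <- s | P i) d i).
Proof.
move=> fd; elim: s => [|i s IH].
  by rewrite big_nil; under eq_fun do rewrite big_nil; exact: is_cderive_cst.
rewrite big_cons; under eq_fun do rewrite big_cons.
by case: ifP => // Pi; apply: is_cderiveD => //; exact: fd.
Qed.

Lemma is_cderive_near f g x d : (\forall t \near x, f t = g t) ->
  is_cderive f x d -> is_cderive g x d.
Proof.
move=> fg [fr fi]; split; [apply: near_eq_is_derive fr|apply: near_eq_is_derive fi];
  by apply: filterS fg => t ->.
Qed.

Lemma is_cderive_unique f x d e : is_cderive f x d -> is_cderive f x e -> d = e.
Proof.
move=> [fr fi] [gr gi]; apply: complexP.
  by rewrite -(@derive_val _ _ _ _ _ _ _ fr) (@derive_val _ _ _ _ _ _ _ gr).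
by rewrite -(@derive_val _ _ _ _ _ _ _ fi) (@derive_val _ _ _ _ _ _ _ gi).
Qed.

Lemma is_cderive_cexp k x :
  is_cderive (fun t => cexp (k * t%:C)) x (k * cexp (k * x%:C)).
Proof.
have id2 t : complex.Re (k * t%:C) = complex.Re k * t by rewrite mulrC ReZ mulrC.
have id3 t : complex.Im (k * t%:C) = complex.Im k * t by rewrite mulrC ImZ mulrC.
have de : is_derive x 1 (fun t => expR (complex.Re k * t))
    (complex.Re k * expR (complex.Re k * x)).
  exact: is_derive_scale.
have dc : is_derive x 1 (fun t => cos (complex.Im k * t))
    (complex.Im k * - sin (complex.Im k * x)).
  exact: is_derive_scale.
have ds : is_derive x 1 (fun t => sin (complex.Im k * t))
    (complex.Im k * cos (complex.Im k * x)).
  exact: is_derive_scale.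
split.
  rewrite (_ : (fun t => _) = fun t => expR (complex.Re k * t) * cos (complex.Im k * t)).
    apply: is_derive_eq (is_deriveM de dc) _.
    by rewrite /GRing.scale /= Re_mul /= id2 id3; ring.
  by apply/funext => t; rewrite /= id2 id3.
rewrite (_ : (fun t => _) = fun t => expR (complex.Re k * t) * sin (complex.Im k * t)).
  apply: is_derive_eq (is_deriveM de ds) _.
  by rewrite /GRing.scale /= Im_mul /= id2 id3; ring.
by apply/funext => t; rewrite /= id2 id3.
Qed.

End ComplexCalculus.

(** * Bounded solutions of scalar equations through exponential Green kernels *)

Section ExponentialKernel.
Variable R : realType.
Local Notation mu := (@lebesgue_measure R).
Implicit Types (f g : R -> R[i]) (w : R -> R) (k : R[i]) (x t : R).

(* The bounded Green kernel of [T' = k T + g] on the line. *)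
Definition kern k x t : R[i] :=
  if complex.Re k <= 0 then (if t <= x then cexp (k * (x - t)%:C) else 0)
  else (if t <= x then 0 else - cexp (k * (x - t)%:C)).

Lemma modc_kern_le k (c : R) x t : c <= `|complex.Re k| ->
  modc (kern k x t) <= expR (- c * `|x - t|).
Proof.
move=> ck; rewrite /kern.
have Rek : complex.Re (k * (x - t)%:C) = (x - t) * complex.Re k by rewrite mulrC ReZ.
have := expR_ge0 (- c * `|x - t|).
case: ifPn => k0; case: ifPn => tx; rewrite ?modc0 // => _.
  rewrite modc_cexp Rek ler_expR ger0_norm ?subr_ge0//.
  rewrite mulrC ler_wpM2r ?subr_ge0//; move: ck; rewrite ler0_norm//; lra.
rewrite -ltNge in tx; rewrite -ltNge in k0.
rewrite modcN modc_cexp Rek ler_expR ltr0_norm ?subr_lt0//.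
have -> : - c * - (x - t) = (x - t) * c by ring.
by rewrite ler_nM2l ?subr_lt0//; move: ck; rewrite gtr0_norm.
Qed.

Lemma cmeas_cexp k : cmeas (fun t => cexp (k * t%:C)).
Proof.
have id2 t : complex.Re (k * t%:C) = complex.Re k * t by rewrite mulrC ReZ mulrC.
have id3 t : complex.Im (k * t%:C) = complex.Im k * t by rewrite mulrC ImZ mulrC.
have me : measurable_fun setT (fun t : R => expR (complex.Re k * t)).
  by apply: measurableT_comp => //; apply: measurable_funM.
split.
  rewrite (_ : (fun t => _) = fun t => expR (complex.Re k * t) * cos (complex.Im k * t)).
    apply: measurable_funM => //; apply: measurableT_comp; last exact: measurable_funM.
    by apply: continuous_measurable_fun; exact: continuous_cos.
  by apply/funext => t; rewrite /= id2 id3.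
rewrite (_ : (fun t => _) = fun t => expR (complex.Re k * t) * sin (complex.Im k * t)).
  apply: measurable_funM => //; apply: measurableT_comp; last exact: measurable_funM.
  by apply: continuous_measurable_fun; exact: continuous_sin.
by apply/funext => t; rewrite /= id2 id3.
Qed.

Lemma measurable_le x : measurable_fun setT (fun t : R => t <= x).
Proof. exact: measurable_fun_ler. Qed.

Lemma cexp_sub k x t :
  cexp (k * (x - t)%:C) = cexp (k * x%:C) * cexp (- k * t%:C).
Proof.
rewrite -cexpD; congr cexp.
by apply: complexP;
  rewrite ?Re_mul ?Im_mul ?Re_add ?Im_add ?Re_mul ?Im_mul ?Re_opp ?Im_opp /=; ring.
Qed.

Lemma cmeas_kern k x : cmeas (kern k x).
Proof.
rewrite /kern; have [k0|k0] := boolP (complex.Re k <= 0); apply: cmeas_if; try exact: measurable_le;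
  try exact: cmeas_cst.
  apply: cmeas_ext (cmeasM (cmeas_cst (cexp (k * x%:C))) (cmeas_cexp (- k))) => t.
  by rewrite cexp_sub.
apply: cmeas_ext (cmeasM (cmeas_cst (- cexp (k * x%:C))) (cmeas_cexp (- k))) => t.
by rewrite cexp_sub mulNr.
Qed.

Definition cprim f x : R[i] :=
  prim (fun t => complex.Re (f t)) x +i* prim (fun t => complex.Im (f t)) x.

Definition cleft f := left_integ (fun t => complex.Re (f t)) /\
  left_integ (fun t => complex.Im (f t)).

Lemma cprimE f x : cprim f x = cint (fun t => if t <= x then f t else 0).
Proof.
have aux (v : R -> R) : prim v x = rint (fun t => if t <= x then v t else 0).
  rewrite /prim Rintegral_mkcond; congr Rintegral; apply/funext => t.
  by rewrite patchE mem_setE in_itv.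
rewrite /cprim /cint !aux; congr (rint _ +i* rint _); apply/funext => t; by case: ifP.
Qed.

Lemma ac_cprim a b f : cleft f -> abs_continuous_on a b (cprim f).
Proof.
by move=> [fr fi]; apply/abs_continuous_onP; split; exact: rac_prim.
Qed.

Lemma is_cderive_cprim f : cleft f ->
  {ae mu, forall x : R, is_cderive (cprim f) x (f x)}.
Proof.
move=> [fr fi]; have := prim_derive fi; have := prim_derive fr.
by apply: filterS2; first exact: (ae_filter_ringOfSetsType mu).
Qed.

Section Representation.
Variables (k : R[i]) (g : R -> R[i]) (w : R -> R).
Hypotheses (iw : integ w) (w0 : forall t, 0 <= w t)
  (wneg : forall t, t <= 0 -> w t = 0) (mg : cmeas g)
  (gw : forall t, modc (g t) <= w t).

Let h t := cexp (- k * t%:C) * g t.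

Let mh : cmeas h.
Proof. by apply: cmeasM => //; exact: cmeas_cexp. Qed.

Let modh t : modc (h t) <= expR (- complex.Re k * t) * w t.
Proof.
rewrite modcM modc_cexp ler_pM ?expR_ge0 ?modc_ge0// ler_expR.
by rewrite mulrC ReZ Re_opp mulrC.
Qed.

Let hint : 0 < complex.Re k -> cinteg h.
Proof.
move=> k0; apply: (cinteg_dom iw mh) => t; rewrite (le_trans (modh t))//.
have [t0|t0] := leP t 0; first by rewrite wneg ?mulr0.
by rewrite ler_piMl// -expR0 ler_expR mulNr oppr_le0 mulr_ge0 ?ltW.
Qed.

Lemma kern_left : cleft h.
Proof.
have [k0|k0] := leP (complex.Re k) 0; last first.
  by have [hr hi] := hint k0; split; exact: integ_left.
have key y t : t <= y -> modc (h t) <= expR (- complex.Re k * y) * w t.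
  move=> ty; rewrite (le_trans (modh t))// ler_wpM2r// ler_expR.
  by rewrite ler_wpM2l// oppr_ge0.
split; apply: (left_integ_dom (integ_left iw)).
- exact: mh.1.
- move=> y; exists (expR (- complex.Re k * y)) => t /key.
  by apply: le_trans; exact: Re_le_modc.
- exact: mh.2.
- move=> y; exists (expR (- complex.Re k * y)) => t /key.
  by apply: le_trans; exact: Im_le_modc.
Qed.

(** The kernel factors as [exp (k x) exp (- k t)] on one side of [x]. For [Re k > 0] the integral
    over [t > x] is the whole integral minus the primitive, which gives [c = - cint h]; that
    integral exists because [exp (- k t)] is bounded on [t >= 0] and [w] vanishes on [t <= 0]. For
    [Re k <= 0] the constant is [0]. *)
Lemma kern_repr : exists c, forall x,
  cint (fun t => kern k x t * g t) = cexp (k * x%:C) * (c + cprim h x).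
Proof.
have ih x : cinteg (fun t => if t <= x then h t else 0).
  have [[mr ir] [mi ii]] := kern_left.
  have aux (v : R -> R) : left_integ v -> integ (fun t => if t <= x then v t else 0).
    move=> [mv iv]; rewrite /integ (_ : _ \o _ = (EFin \o v) \_ `]-oo, x]).
      by rewrite -integrable_mkcond//; exact: iv.
    by apply/funext => t; rewrite patchE /= mem_setE in_itv /=; case: ifP.
  split.
    rewrite (_ : (fun t => _) = fun t => if t <= x then complex.Re (h t) else 0).
      exact: aux.
    by apply/funext => t; case: ifP.
  rewrite (_ : (fun t => _) = fun t => if t <= x then complex.Im (h t) else 0).
    exact: aux.
  by apply/funext => t; case: ifP.
have [k0|k0] := leP (complex.Re k) 0.
  exists 0 => x; rewrite add0r cprimE -cintZ//; congr cint; apply/funext => t.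
  rewrite /kern k0; case: ifP => _; last by rewrite mul0r mulr0.
  by rewrite cexp_sub /h mulrA.
exists (- cint h) => x.
rewrite addrC cprimE -cintB//; last exact: hint.
rewrite -cintZ; last first.
  have [hr hi] := hint k0; have [hr' hi'] := ih x; split.
    rewrite (_ : (fun t => _) = fun t => complex.Re (if t <= x then h t else 0) - complex.Re (h t)).
      exact: integB.
    by apply/funext => t; rewrite Re_add Re_opp.
  rewrite (_ : (fun t => _) = fun t => complex.Im (if t <= x then h t else 0) - complex.Im (h t)).
    exact: integB.
  by apply/funext => t; rewrite Im_add Im_opp.
congr cint; apply/funext => t; rewrite /kern leNgt k0 /=.
case: ifP => _; first by rewrite subrr mulr0 mul0r.
by rewrite sub0r cexp_sub /h mulrN mulrA mulNr.
Qed.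

(** Product rule on the representation: the [exp (- k x)] inside [h] cancels the outer exponential
    and leaves [g]. *)
Lemma kern_solution : let T x := cint (fun t => kern k x t * g t) in
  (forall a b, abs_continuous_on a b T) /\
  {ae mu, forall x : R, is_cderive T x (k * T x + g x)}.
Proof.
move=> T; have [c cE] := kern_repr; have hl := kern_left; split=> [a b|].
  apply: ac_ext (acM (ac_cexp a b k) (acD (ac_cst a b c) (ac_cprim a b hl))) => x _.
  by rewrite -cE.
have := is_cderive_cprim hl.
apply: filterS; first exact: (ae_filter_ringOfSetsType mu).
move=> x dx; rewrite (_ : T = fun x => cexp (k * x%:C) * (c + cprim h x)); last first.
  by apply/funext => y; exact: cE.
have := is_cderiveM (is_cderive_cexp k x) (is_cderiveD (is_cderive_cst c x) dx).
rewrite add0r /h mulrA -cexpD.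
have -> : k * x%:C + - k * x%:C = 0 by rewrite mulNr subrr.
by rewrite cexp0 mul1r mulrA.
Qed.

End Representation.

(** Supplies the measurability of the iterated integrals, through their continuity. *)
Lemma ac_cmeas f : (forall a b, abs_continuous_on a b f) -> cmeas f.
Proof.
move=> fac; split; apply: continuous_measurable_fun => x.
  have /abs_continuous_onP[fr _] := fac (x - 1) (x + 1).
  by apply: (rac_continuous fr); apply/andP; split; lra.
have /abs_continuous_onP[_ fi] := fac (x - 1) (x + 1).
by apply: (rac_continuous fi); apply/andP; split; lra.
Qed.

End ExponentialKernel.

(** * Integrable perturbations of a constant diagonal system *)

Section PerturbedDiagonalSystem.
Variable R : realType.
Local Notation mu := (@lebesgue_measure R).

Lemma ae_forall_fin (I : finType) (P : I -> R -> Prop) :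
  (forall i, {ae mu, forall x : R, P i x}) -> {ae mu, forall x : R, forall i, P i x}.
Proof.
move=> h; have FF := ae_filter_ringOfSetsType mu.
exact: (@filter_forall _ _ _ (almost_everywhere mu) FF).
Qed.

Lemma sum_const_ord n (x : R) : \sum_(i < n) x = n%:R * x.
Proof. by rewrite sumr_const card_ord mulr_natl. Qed.

Section System.
Variables (n : nat) (l : 'I_n) (B : 'I_n -> 'I_n -> R -> R[i]) (b : R -> R)
  (k : 'I_n -> R[i]) (dl c S : R).
Hypotheses (ib : integ b) (b0 : forall t, 0 <= b t)
  (bneg : forall t, t <= 0 -> b t = 0) (mB : forall j i, cmeas (B j i))
  (Bb : forall j i t, modc (B j i t) <= b t) (dl0 : 0 <= dl)
  (Bll : forall t, modc (B l l t) <= dl * b t)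
  (kl : k l = 0) (c0 : 0 <= c) (kc : forall j, j != l -> c <= `|complex.Re (k j)|).

Let nb := rint b.
Let ker x t := expR (- c * `|x - t|) * b t.
Let wt := 4 * n%:R * nb + 1.

Hypotheses (kerS : forall x, rint (ker x) <= S)
  (S_small : S * n%:R <= 1 / (2 * wt)) (dl_small : dl * nb <= 1 / 4).

Let nb0 : 0 <= nb.
Proof. exact: rint_ge0. Qed.

Let wt1 : 1 <= wt.
Proof. by rewrite /wt lerDr !mulr_ge0. Qed.

Let wt0 : 0 < wt.
Proof. exact: lt_le_trans wt1. Qed.

Let iwt0 : 0 <= 1 / wt.
Proof. by apply: divr_ge0 => //; exact: ltW. Qed.

Let nbw0 : 0 <= nb / wt.
Proof. by apply: divr_ge0 => //; exact: ltW. Qed.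

Let ker_integ x : integ (ker x).
Proof.
have mexp : measurable_fun setT (fun t : R => expR (- c * `|x - t|)).
  apply: measurableT_comp => //; apply: measurable_funM => //.
  by apply: measurableT_comp => //; apply: measurable_funB.
apply: (integ_dom ib) => [|t].
  by apply: measurable_funM => //; exact: integ_meas.
rewrite /ker normrM (ger0_norm (expR_ge0 _)) (ger0_norm (b0 t)) ler_piMl//.
by rewrite -expR0 ler_expR mulNr oppr_le0 mulr_ge0.
Qed.

(* The [l]-th row of the operator is bounded but not small, the other rows are small:
   weighting the other components by [1 / wt] makes the whole operator a contraction. *)
Let u (j : 'I_n) : R := if j == l then 1 else 1 / wt.
Let G j x i t := kern (k j) x t * B j i t.
Let W (j : 'I_n) x (i : 'I_n) t : R :=
  if j == l then (if i == l then dl * b t else b t) else ker x t.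
Let f (j : 'I_n) : R[i] := (j == l)%:R.

Let u_ge0 j : 0 <= u j.
Proof. by rewrite /u; case: ifP. Qed.

Let u_le1 j : u j <= 1.
Proof. rewrite /u; case: ifP => // _; by rewrite ler_pdivrMr// mul1r. Qed.

Let W_integ j x i : integ (W j x i).
Proof.
rewrite /W; have [_|_] := eqVneq j l; last exact: ker_integ.
by have [_|_] := eqVneq i l => //; exact: integZ.
Qed.

Let kern_le1 x t : modc (kern (k l) x t) <= 1.
Proof.
by rewrite (le_trans (@modc_kern_le _ _ 0 _ _ _))// oppr0 mul0r expR0.
Qed.

Let GW j x i t : modc (G j x i t) <= W j x i t.
Proof.
rewrite modcM /W; have [->|jl] := eqVneq j l.
  case: eqVneq => [->|_]; first by rewrite -[leRHS]mul1r ler_pM ?modc_ge0.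
  by rewrite -[leRHS]mul1r ler_pM ?modc_ge0.
by rewrite ler_pM ?modc_ge0// modc_kern_le// kc.
Qed.

(** Row [l]: at most [1/4] from the diagonal entry by [dl_small], and at most [n nb / wt <= 1/4]
    from the others, which is why [wt] contains [4 n nb]. Any other row: at most
    [n S <= 1 / (2 wt)], half its own weight. *)
Let Wu j x : \sum_i rint (W j x i) * u i <= u j / 2.
Proof.
rewrite /W [in u j]/u; case: ifP => jl.
  rewrite (bigD1 l)//= eqxx rintZ// {1}/u eqxx mulr1.
  have h : \sum_(i < n | i != l) rint (fun t => if i == l then dl * b t else b t) * u i
      <= \sum_(i < n) nb / wt.
    rewrite [leRHS](bigD1 l)//=; apply: ler_wpDl => //.
    apply: ler_sum => i il; rewrite (negbTE il) /u (negbTE il).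
    by rewrite mul1r.
  have h2 : \sum_(i < n) nb / wt <= 1 / 4.
    by rewrite sum_const_ord mulrA ler_pdivrMr// /wt; lra.
  have -> : (1 : R) / 2 = 1 / 4 + 1 / 4 by field.
  by rewrite lerD// (le_trans h).
apply: (@le_trans _ _ (\sum_(i < n) S)).
  apply: ler_sum => i _; rewrite -[leRHS]mulr1.
  by apply: ler_pM => //; first by apply: rint_ge0 => t; rewrite mulr_ge0 ?expR_ge0.
rewrite sum_const_ord mulrC (le_trans S_small)//.
by rewrite le_eqVlt; apply/orP; left; apply/eqP; field; rewrite gt_eqF.
Qed.

Let fu j : modc (f j) <= u j.
Proof. by rewrite /f /u; case: ifP; rewrite ?modc0 ?modc1. Qed.

Let term z C j i : (forall i, cmeas (z i)) -> (forall i t, modc (z i t) <= C) ->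
  let T x := cint (fun t => G j x i t * z i t) in
  (forall a b, abs_continuous_on a b T) /\
  {ae mu, forall x : R, is_cderive T x (k j * T x + B j i x * z i x)}.
Proof.
move=> mz zC T.
have TE : T = fun x => cint (fun t => kern (k j) x t * (B j i t * z i t)).
  by apply/funext => x; congr cint; apply/funext => t; rewrite /G mulrA.
rewrite TE; apply: (@kern_solution R (k j) _ (fun t => `|C| * b t)).
- exact: integZ.
- by move=> t; rewrite mulr_ge0.
- by move=> t /bneg ->; rewrite mulr0.
- exact: cmeasM.
- move=> t; rewrite modcM mulrC ler_pM ?modc_ge0//.
  by rewrite (le_trans (zC _ _))// ler_norm.
Qed.

(** The contraction needs only the fixed threshold [S]; the final estimate is stated for every bound
    [S'] of the kernel integrals, so that [S'] may tend to [0] later. It is a bootstrap: [|z| <= 2]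
    makes the components off [l] at most [2 n S'], and inserting this into row [l] makes its
    off-diagonal terms small too. *)
Lemma perturbed_system : exists z : 'I_n -> R -> R[i],
  [/\ forall j a a', abs_continuous_on a a' (z j),
      {ae mu, forall x : R, forall j,
        is_cderive (z j) x (k j * z j x + \sum_i B j i x * z i x)} &
      forall S', (forall x, rint (ker x) <= S') -> forall j x,
        modc (z j x - (j == l)%:R) <=
          (2 * n%:R + nb * (2 * n%:R ^+ 2 + 2)) * (S' + dl)].
Proof.
have [|||||||z [mz zu zE]] := @picard_fixpoint R n G W u f => //.
- by move=> j x i; apply: cmeasM => //; exact: cmeas_kern.
- move=> z C mz zC j; apply: cmeas_sum => i _; apply: ac_cmeas => a a'.
  by have [h _] := term j i mz zC; exact: h.
have z2 i t : modc (z i t) <= 2.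
  by rewrite (le_trans (zu i t))// -[leRHS]mulr1 ler_wpM2l.
have zE' j : z j = fun x => f j + kop G z j x by apply/funext => x; exact: zE.
exists z; split.
- move=> j a a'; rewrite zE'; apply: acD; first exact: ac_cst.
  by apply: ac_sum => i _; have [h _] := term j i mz z2; exact: h.
- have h j : {ae mu, forall x : R, forall i,
      is_cderive (fun x => cint (fun t => G j x i t * z i t)) x
      (k j * cint (fun t => G j x i t * z i t) + B j i x * z i x)}.
    by apply: ae_forall_fin => i; have [_] := term j i mz z2.
  have := ae_forall_fin h; apply: filterS; first exact: (ae_filter_ringOfSetsType mu).
  move=> x {}h j; rewrite {1}zE'.
  have := is_cderiveD (is_cderive_cst (f j) x)
    (@is_cderive_sum _ _ (index_enum 'I_n) xpredT _ _ _ (fun i _ => h j i)).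
  rewrite add0r big_split /= -mulr_sumr.
  (* The inhomogeneity [f] is supported at [l], where the exponent [k l] is [0]. *)
  suff -> : k j * z j x = k j * kop G z j x by [].
  rewrite zE mulrDr (_ : k j * f j = 0) ?add0r// /f.
  by have [->|_] := eqVneq j l; rewrite ?kl ?mul0r ?mulr0.
move=> S' kS'.
have S'0 : 0 <= S'.
  by rewrite (le_trans _ (kS' 0))// rint_ge0// => t; rewrite mulr_ge0 ?expR_ge0.
have nbn : 0 <= nb * (2 * n%:R ^+ 2 + 2) by rewrite mulr_ge0// addr_ge0 ?mulr_ge0 ?exprn_ge0.
have zf j x : z j x - (j == l)%:R = kop G z j x by rewrite zE /f addrAC subrr add0r.
have small j x : j != l -> modc (z j x) <= 2 * n%:R * S'.
  move=> jl; have := zf j x; rewrite (negbTE jl) subr0 => ->.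
  rewrite (le_trans (le_modc_sum _ _ _))//.
  apply: (@le_trans _ _ (\sum_(i < n) 2 * S')).
    apply: ler_sum => i _; apply: (@le_trans _ _ (rint (fun t => 2 * ker x t))).
      apply: le_modc_cint; first exact: integZ.
        by apply: cmeasM => //; apply: cmeasM => //; exact: cmeas_kern.
      move=> t; rewrite modcM mulrC ler_pM ?modc_ge0//.
      by have := GW j x i t; rewrite /W (negbTE jl).
    by rewrite rintZ// ler_wpM2l.
  by rewrite sum_const_ord; lra.
move=> j x; have [->|jl] := eqVneq j l; last first.
  rewrite subr0 (le_trans (small _ _ jl))// [_ * (S' + dl)]mulrDl; apply: ler_wpDr.
    by rewrite mulr_ge0// addr_ge0.
  by rewrite ler_wpM2l ?mulr_ge0// lerDl.
have := zf l x; rewrite eqxx => ->.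
rewrite /kop (bigD1 l)//= (le_trans (le_modcD _ _))//.
have h1 : modc (cint (fun t => G l x l t * z l t)) <= 2 * dl * nb.
  rewrite -rintZ//; apply: le_modc_cint; first exact: integZ.
    by apply: cmeasM => //; apply: cmeasM => //; exact: cmeas_kern.
  move=> t; rewrite modcM mulrC -mulrA ler_pM ?modc_ge0//.
  by have := GW l x l t; rewrite /W eqxx.
have h2 : modc (\sum_(i < n | i != l) cint (fun t => G l x i t * z i t)) <=
    \sum_(i < n) 2 * n%:R * S' * nb.
  rewrite (le_trans (le_modc_sum _ _ _))// [leRHS](bigD1 l)//=.
  apply: ler_wpDl; first by rewrite !mulr_ge0.
  apply: ler_sum => i il; rewrite -rintZ//; apply: le_modc_cint; first exact: integZ.
    by apply: cmeasM => //; apply: cmeasM => //; exact: cmeas_kern.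
  move=> t; rewrite modcM mulrC ler_pM ?modc_ge0//; first exact: small.
  by have := GW l x i t; rewrite /W eqxx (negbTE il).
rewrite (le_trans (lerD h1 h2))// sum_const_ord.
have n1 : 1 <= n%:R :> R by rewrite ler1n; case: (n) l => [[]|].
have : 0 <= n%:R * S' by exact: mulr_ge0.
have : 0 <= n%:R * dl by exact: mulr_ge0.
have : 0 <= nb * S' by exact: mulr_ge0.
have : 0 <= nb * (n%:R ^+ 2 * dl) by rewrite !mulr_ge0 ?exprn_ge0.
lra.
Qed.

End System.
End PerturbedDiagonalSystem.

(** * The matrix F *)

Section HalfLineClasses.
Variable R : realType.
Local Notation mu := (@lebesgue_measure R).
Implicit Types f g : R -> R[i].

Definition ext0 f x : R[i] := if 0 < x then f x else 0.

Definition L1p f := cinteg (ext0 f).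

Definition L2p f := cmeas (ext0 f) /\ integ (fun t => modc (ext0 f t) ^+ 2).

Lemma measurable_modc f : cmeas f -> measurable_fun setT (fun t => modc (f t)).
Proof.
move=> [mr mi]; under eq_fun do rewrite modcE.
apply: measurableT_comp; last by apply: measurable_funD; exact: measurable_funX.
by apply: continuous_measurable_fun; exact: sqrt_continuous.
Qed.

Lemma measurable_ext0 (v : R -> R) : measurable_fun (@Rplus R) v ->
  measurable_fun setT (fun x : R => if 0 < x then v x else 0).
Proof.
move=> mv; have -> : (fun x => if 0 < x then v x else 0) = v \_ (@Rplus R).
  apply/funext => x; rewrite patchE; case: ifPn => x0.
    by rewrite mem_set.
  by rewrite memNset//; exact/negP.
apply/(measurable_restrictT _ _).1 => //.
by rewrite (_ : Rplus (R:=R) = `]0, +oo[%classic)//; apply/seteqP; split=> x /=;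
  rewrite /Rplus /= in_itv /= andbT.
Qed.

Lemma Lp_ext0 p f : Lp_Rplus p.+1 f ->
  cmeas (ext0 f) /\ integ (fun t => modc (ext0 f t) ^+ p.+1).
Proof.
move=> [mr mi fin]; have mf : cmeas (ext0 f).
  split.
    rewrite (_ : (fun t => _) = fun x => if 0 < x then complex.Re (f x) else 0).
      exact: measurable_ext0.
    by apply/funext => x; rewrite /ext0; case: ifP.
  rewrite (_ : (fun t => _) = fun x => if 0 < x then complex.Im (f x) else 0).
    exact: measurable_ext0.
  by apply/funext => x; rewrite /ext0; case: ifP.
split => //; apply/integrableP; split.
  by apply/measurable_EFinP; apply: measurable_funX; exact: measurable_modc.
apply: le_lt_trans fin; rewrite [leRHS]integral_mkcond le_eqVlt; apply/orP; left; apply/eqP.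
apply: eq_integral => x _; rewrite patchE /= ger0_norm ?exprn_ge0 ?modc_ge0//.
rewrite /ext0; case: ifPn => x0; first by rewrite mem_set.
by rewrite memNset ?modc0 ?expr0n//; exact/negP.
Qed.

Lemma Lp_L1p f : Lp_Rplus 1 f -> L1p f.
Proof. by move=> /Lp_ext0[mf fi]; apply: (cinteg_dom fi mf) => t. Qed.

Lemma Lp_L2p f : Lp_Rplus 2 f -> L2p f.
Proof. by move=> /Lp_ext0. Qed.

Lemma ext0D f g x : ext0 (fun t => f t + g t) x = ext0 f x + ext0 g x.
Proof. by rewrite /ext0; case: ifP; rewrite ?addr0. Qed.

Lemma ext0M f g x : ext0 (fun t => f t * g t) x = ext0 f x * ext0 g x.
Proof. by rewrite /ext0; case: ifP; rewrite ?mulr0. Qed.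

Lemma ext0Z c f x : ext0 (fun t => c * f t) x = c * ext0 f x.
Proof. by rewrite /ext0; case: ifP; rewrite ?mulr0. Qed.

Lemma cinteg_ext f g : f =1 g -> cinteg f -> cinteg g.
Proof. by move=> /funext ->. Qed.

Lemma integ0 : integ (fun=> 0 : R).
Proof. exact: integrable0. Qed.

Lemma L1p0 : L1p (fun=> 0).
Proof.
apply: (@cinteg_ext (fun=> 0)); first by move=> x; rewrite /ext0; case: ifP.
by split; exact: integ0.
Qed.

Lemma cintegD f g : cinteg f -> cinteg g -> cinteg (fun t => f t + g t).
Proof.
move=> [fr fi] [gr gi]; split.
  rewrite (_ : (fun t => _) = fun t => complex.Re (f t) + complex.Re (g t)).
    exact: integD.
  by apply/funext => t; rewrite Re_add.
rewrite (_ : (fun t => _) = fun t => complex.Im (f t) + complex.Im (g t)).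
  exact: integD.
by apply/funext => t; rewrite Im_add.
Qed.

Lemma L1pD f g : L1p f -> L1p g -> L1p (fun t => f t + g t).
Proof.
move=> f1 g1; apply: (cinteg_ext _ (cintegD f1 g1)) => x.
by rewrite ext0D.
Qed.

Lemma L1pZ c f : L1p f -> L1p (fun t => c * f t).
Proof.
move=> f1; apply: (cinteg_ext _ (cintegZ c f1)) => x.
by rewrite ext0Z.
Qed.

Lemma L1p_sum (J : Type) (s : seq J) (f : J -> R -> R[i]) :
  (forall i, L1p (f i)) -> L1p (fun t => \sum_(i <- s) f i t).
Proof.
move=> fi; elim: s => [|i s IH].
  by under eq_fun do rewrite big_nil; exact: L1p0.
by under eq_fun do rewrite big_cons; exact: L1pD.
Qed.

Lemma L2p0 : L2p (fun=> 0).
Proof.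
split; first by apply: (@cmeas_ext _ (fun=> 0) _ _ (cmeas_cst 0)) => x; rewrite /ext0; case: ifP.
rewrite (_ : (fun t => _) = fun=> 0); first exact: integ0.
by apply/funext => x; rewrite /ext0; case: ifP; rewrite modc0 expr0n.
Qed.

Lemma L2pD f g : L2p f -> L2p g -> L2p (fun t => f t + g t).
Proof.
move=> [mf fi] [mg gi].
have mfg : cmeas (ext0 (fun t => f t + g t)).
  by apply: cmeas_ext (cmeasD mf mg) => x; rewrite ext0D.
split => //; apply: (integ_dom (integZ 2 (integD fi gi))) => [|t].
  by apply: measurable_funX; exact: measurable_modc.
rewrite ger0_norm ?exprn_ge0 ?modc_ge0// ext0D.
apply: (@le_trans _ _ ((modc (ext0 f t) + modc (ext0 g t)) ^+ 2)).
  by rewrite ler_pXn2r// ?nnegrE ?addr_ge0 ?modc_ge0// le_modcD.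
have := sqr_ge0 (modc (ext0 f t) - modc (ext0 g t)); rewrite !expr2; lra.
Qed.

Lemma L2pZ c f : L2p f -> L2p (fun t => c * f t).
Proof.
move=> [mf fi].
have mcf : cmeas (ext0 (fun t => c * f t)).
  by apply: cmeas_ext (cmeasM (cmeas_cst c) mf) => x; rewrite ext0Z.
split => //; rewrite (_ : (fun t => _) = fun t => modc c ^+ 2 * modc (ext0 f t) ^+ 2).
  exact: integZ.
by apply/funext => t; rewrite ext0Z modcM exprMn.
Qed.

Lemma L2p_sum (J : Type) (s : seq J) (f : J -> R -> R[i]) :
  (forall i, L2p (f i)) -> L2p (fun t => \sum_(i <- s) f i t).
Proof.
move=> fi; elim: s => [|i s IH].
  by under eq_fun do rewrite big_nil; exact: L2p0.
by under eq_fun do rewrite big_cons; exact: L2pD.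
Qed.

(** The product is dominated by the sum of the squares. *)
Lemma L2pM f g : L2p f -> L2p g -> L1p (fun t => f t * g t).
Proof.
move=> [mf fi] [mg gi]; apply: (cinteg_dom (integD fi gi)) => [|t].
  by apply: cmeas_ext (cmeasM mf mg) => x; rewrite ext0M.
rewrite ext0M modcM.
have := sqr_ge0 (modc (ext0 f t) - modc (ext0 g t)).
have : 0 <= modc (ext0 f t) * modc (ext0 g t) by rewrite mulr_ge0 ?modc_ge0.
rewrite !expr2; lra.
Qed.

End HalfLineClasses.

(** * Shape, integrability and trace of the matrix [F] *)

Section StructureOfF.
Variables (R : realType) (n : nat) (n2 : (2 <= n)%N) (I : 'I_n.-1 -> nat).
Hypothesis hI : singularity_orders I.
Variables (sigma : 'I_n.-1 -> R -> R[i]).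
Local Notation m := (n./2).

Let n_eq : n = (odd n + m.*2)%N.
Proof. by rewrite odd_double_half. Qed.

Lemma chi_eq0 nu i (r j : 'I_m.+1) :
  (forall s, (s <= i + odd nu)%N -> (r == s + nu./2 :> nat)%N ->
     (j == i + odd nu - s + nu./2 :> nat)%N -> False) ->
  chi R m nu i r j = 0.
Proof.
move=> h; rewrite mxE; case: ifP => onu.
  rewrite big_nat_cond big_pred0// => s; apply/negP => /andP[/andP[_ si]] /andP[h1 h2].
  by apply: (h s) => //; rewrite onu ?addn1.
rewrite big_nat_cond big_pred0// => s; apply/negP => /andP[/andP[_ si]] /andP[h1 h2].
by apply: (h s) => //; rewrite onu ?addn0.
Qed.

(** Admissibility in one form for both parities of [nu]: the largest index met by the nonzero
    entries of [chi], namely [I nu + odd nu + kk], is at most [m]. *)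
Lemma max_orderE (nu : 'I_n.-1) : exists kk,
  [/\ nu = (odd nu + kk.*2)%N :> nat, nu./2 = kk,
      (I nu + odd nu <= m - kk)%N, (nu < n.-1)%N & (I nu <= max_order n nu)%N].
Proof.
exists nu./2; split => //; first by rewrite odd_double_half.
have := hI nu; have lt := ltn_ord nu; have e := n_eq; have := odd_double_half nu.
rewrite /max_order; case: (odd nu) => /=; case: (odd n) e => /=; lia.
Qed.

(** Index [m] is reached only if [I nu + odd nu + nu./2 = m], that is, when the order is maximal,
    and this is membership in [K(I)]. *)
Lemma chi_last_row (nu : 'I_n.-1) (r j : 'I_m.+1) : ~~ odd n ->
  nu \notin K_set I -> (r == m :> nat) || (j == m :> nat) ->
  chi R m nu (I nu) r j = 0.
Proof.
move=> en; rewrite inE en /= => nK rj; apply: chi_eq0 => s si /eqP rs /eqP js.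
move: nK; have [kk [e1 e2 e3 e4 e5]] := max_orderE nu.
have := n_eq; move: rj si rs js; rewrite /max_order (negbTE en) {}e2.
case: (odd nu) e1 e3 => /= e1 e3 rj si rs js ee.
  by apply/negP; rewrite negbK; apply/eqP; case/orP: rj => /eqP; lia.
by apply/negP; rewrite negbK; apply/eqP; case/orP: rj => /eqP; lia.
Qed.

(** Nonzero entries lie on the antidiagonal [r + j = I nu + odd nu + 2 kk]; since
    [I nu + odd nu <= m - kk] and [kk < m], its level stays below [2 m]. *)
Lemma chi_corner_odd (nu : 'I_n.-1) (r : 'I_m.+1) : odd n -> r = m :> nat ->
  chi R m nu (I nu) r r = 0.
Proof.
move=> on rm; apply: chi_eq0 => s si /eqP rs /eqP js.
have [kk [e1 e2 e3 e4 e5]] := max_orderE nu.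
have := n_eq; move: rm si rs js e3; rewrite on {}e2 => /=.
by case: (odd nu) e1 => /=; lia.
Qed.

(** Level [2 m - 1] of the antidiagonal is reached only for [nu = 2 m - 2] with order [1], where
    both entries are binomial coefficients equal to [1]. *)
Lemma chi_corner_even (nu : 'I_n.-1) (r j : 'I_m.+1) : ~~ odd n ->
  r = m.-1 :> nat -> j = m :> nat ->
  chi R m nu (I nu) r j = chi R m nu (I nu) j r.
Proof.
move=> en rm jm; have [kk [e1 e2 e3 e4 e5]] := max_orderE nu.
have ee := n_eq; rewrite (negbTE en) add0n in ee.
have [[onu [k1 i1]]|nn] := pselect (odd nu = false /\ (kk = m.-1)%N /\ I nu = 1%N).
  rewrite !mxE onu i1 e2 k1 rm jm.
  have m0 : m = m.-1.+1 by lia.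
  rewrite /index_iota /= !big_cons !big_nil.
  have -> : ((m.-1 == 0 + m.-1) && (m == 1 - 0 + m.-1))%N = true by lia.
  have -> : ((m.-1 == 1 + m.-1) && (m == 1 - 1 + m.-1))%N = false by lia.
  have -> : ((m == 0 + m.-1) && (m.-1 == 1 - 0 + m.-1))%N = false by lia.
  have -> : ((m == 1 + m.-1) && (m.-1 == 1 - 1 + m.-1))%N = true by lia.
  by rewrite bin0 binn.
rewrite (@chi_eq0 nu (I nu) r j); last first.
  move=> s si /eqP rs /eqP js; apply: nn; move: si rs js e1 e3; rewrite {}e2 rm jm.
  by case: (odd nu) => /=; lia.
rewrite (@chi_eq0 nu (I nu) j r)//.
move=> s si /eqP rs /eqP js; apply: nn; move: si rs js e1 e3; rewrite {}e2 rm jm.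
by case: (odd nu) => /=; lia.
Qed.

Lemma Q_mxE x (r j : 'I_m.+1) :
  Q_mx I sigma x r j = \sum_(nu < n.-1) chi R m nu (I nu) r j * sigma nu x.
Proof. by rewrite /Q_mx summxE; apply: eq_bigr => nu _; rewrite mxE mulrC. Qed.

Hypothesis hs : Sigma_set I sigma.

Lemma Q_mx_L1 (r j : 'I_m.+1) : L1p (fun x => Q_mx I sigma x r j).
Proof.
under eq_fun do rewrite Q_mxE; apply: L1p_sum => nu; apply: L1pZ.
by apply: Lp_L1p; exact: hs.1.
Qed.

Lemma Q_mx_L2 (r j : 'I_m.+1) : ~~ odd n -> (r == m :> nat) || (j == m :> nat) ->
  L2p (fun x => Q_mx I sigma x r j).
Proof.
move=> en rj; under eq_fun do rewrite Q_mxE; apply: L2p_sum => nu.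
have [nuK|nuK] := boolP (nu \in K_set I).
  by apply: L2pZ; apply: Lp_L2p; exact: hs.2.
by under eq_fun do rewrite (chi_last_row en nuK rj) mul0r; exact: L2p0.
Qed.

Lemma F_mx_L1 (k j : 'I_n) : (j <= k)%N -> L1p (fun x => F_mx I sigma x k j).
Proof.
move=> jk; rewrite /F_mx /S_mx.
under eq_fun do rewrite mxE ltn_eqF ?ltnS//.
have mE : (inord m : 'I_m.+1) = m :> nat by rewrite inordK.
have [on|en] := boolP (odd n).
  by have [_|_] := boolP (_ && _); [apply: L1pZ; exact: Q_mx_L1|exact: L1p0].
have [_|_] := boolP (_ && _); first by apply: L1pZ; exact: Q_mx_L1.
have [_|_] := boolP (_ && _); first by apply: L1pZ; exact: Q_mx_L1.
have [_|_] := boolP (_ && _); last exact: L1p0.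
(* The only quadratic entries of [F]: both factors come from the last row or column of [Q], hence
   from L2. *)
apply: L1pD; first by apply: L1pZ; exact: Q_mx_L1.
by apply: L1pZ; apply: L2pM; apply: Q_mx_L2; rewrite // mE eqxx ?orbT.
Qed.

Lemma F_mx_upper x (k j : 'I_n) : (k < j)%N -> F_mx I sigma x k j = (j == k.+1 :> nat)%:R.
Proof.
move=> kj; rewrite /F_mx /S_mx mxE eqSS; case: eqP => // jk.
have := n_eq; have := ltn_ord j; move: kj jk.
case: (odd n) => /=; do ![case: ifPn => //]; lia.
Qed.

(** For odd [n] the only candidate is [f_{m+1,m+1}], a multiple of [q_{m,m} = 0]. For even [n] the
    entries [f_{m,m}] and [f_{m+1,m+1}] carry opposite signs and the equal values [q_{m-1,m}] and
    [q_{m,m-1}]. *)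
Lemma trace_F_mx x : \sum_(k < n) F_mx I sigma x k k = 0.
Proof.
have e := n_eq; rewrite /F_mx /S_mx.
have [on|en] := boolP (odd n).
  apply: big1 => k _; rewrite mxE ltn_eqF ?ltnS//; case: ifPn => // /andP[h1 h2].
  have km : k = m :> nat by move: e; rewrite on; lia.
  have -> : inord k.+1.-1 = inord (2 * m + 1 - k.+1) :> 'I_m.+1 by congr inord; lia.
  rewrite Q_mxE big1 ?mulr0// => nu _; rewrite chi_corner_odd ?mul0r//.
  by rewrite inordK; lia.
have m0 : (0 < m)%N by move: e; rewrite (negbTE en); lia.
rewrite (negbTE en) add0n in e.
have l1 : (m.-1 < n)%N by lia.
have l2 : (m < n)%N by lia.
rewrite (bigD1 (Ordinal l1))//= (bigD1 (Ordinal l2)) /=; last first.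
  by rewrite -val_eqE /=; apply/eqP; lia.
rewrite big1 ?addr0 => [|k /andP[k1 k2]]; last first.
  rewrite mxE ltn_eqF ?ltnS//.
  rewrite -val_eqE /= in k1; rewrite -val_eqE /= in k2.
  by do ![case: ifPn => //]; lia.
have nS a : (a == a.+1)%N = false by rewrite ltn_eqF.
rewrite !mxE /= !nS prednK// leqnn eqxx /=.
rewrite ifF; last by lia.
rewrite leqnn eqxx /=.
have -> : (2 * m - m.+1 = m.-1)%N by lia.
set q1 := Q_mx _ _ _ _ _; set q2 := Q_mx _ _ _ _ _.
have -> : q1 = q2.
  rewrite /q1 /q2 !Q_mxE; apply: eq_bigr => nu _; rewrite chi_corner_even//.
    by rewrite inordK; lia.
  by rewrite inordK.
by rewrite [in X in _ + X]exprS mulN1r mulNr subrr.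
Qed.

End StructureOfF.

(** * Uniqueness for linear systems *)

Section Uniqueness.
Variable R : realType.
Local Notation mu := (@lebesgue_measure R).
Variables (n : nat) (A : 'I_n -> 'I_n -> R -> R[i]) (al : R -> R).
Variable Z : 'I_n -> R -> R[i].
Hypotheses (lal : left_integ al) (al0 : forall x, 0 <= al x)
  (Aal : forall j i x, 0 < x -> modc (A j i x) <= al x)
  (acZ : forall j, AC_loc (Z j))
  (dZ : {ae mu, forall x : R, 0 < x -> forall j,
     is_cderive (Z j) x (\sum_i A j i x * Z i x)}).

Let N x : R := \sum_j (complex.Re (Z j x) ^+ 2 + complex.Im (Z j x) ^+ 2).
Let N' x (d : 'I_n -> R[i]) : R := \sum_j (2 * (complex.Re (Z j x) * complex.Re (d j) +
   complex.Im (Z j x) * complex.Im (d j))).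

Let is_derive_N x d : (forall j, is_cderive (Z j) x (d j)) -> is_derive x 1 N (N' x d).
Proof.
move=> h; have hj j : is_derive x 1
    (fun x => complex.Re (Z j x) ^+ 2 + complex.Im (Z j x) ^+ 2)
    (2 * (complex.Re (Z j x) * complex.Re (d j) + complex.Im (Z j x) * complex.Im (d j))).
  have [hr hi] := h j; under eq_fun do rewrite !expr2.
  apply: is_derive_eq (is_deriveD (is_deriveM hr hr) (is_deriveM hi hi)) _.
  by rewrite /GRing.scale /=; ring.
rewrite /N /N'; elim: (index_enum _) => [|j s IH].
  by rewrite big_nil; under eq_fun do rewrite big_nil; exact: is_derive_cst.
rewrite big_cons; under eq_fun do rewrite big_cons.
exact: is_deriveD.
Qed.

Let N'_le x : 0 < x ->
  `|N' x (fun j => \sum_i A j i x * Z i x)| <= 2 * n%:R * al x * N x.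
Proof.
move=> x0; have CS (z w : R[i]) : `|complex.Re z * complex.Re w + complex.Im z * complex.Im w|
    <= modc z * modc w.
  have -> : complex.Re z * complex.Re w + complex.Im z * complex.Im w =
    complex.Re (conjc z * w) by case: z w => [a b] [c d]; rewrite Re_mul /=; ring.
  rewrite (le_trans (Re_le_modc _))// modcM.
  by rewrite le_eqVlt; apply/orP; left; apply/eqP; congr (_ * _); case: z => a b;
    rewrite !modcE /= sqrrN.
apply: (@le_trans _ _ (\sum_j \sum_i al x * (modc (Z j x) ^+ 2 + modc (Z i x) ^+ 2))).
  rewrite /N' (le_trans (ler_norm_sum _ _ _))//; apply: ler_sum => j _.
  rewrite normrM ger0_norm//.
  apply: (@le_trans _ _ (2 * (modc (Z j x) * \sum_i (al x * modc (Z i x))))).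
    rewrite ler_wpM2l// (le_trans (CS _ _))// ler_wpM2l ?modc_ge0//.
    rewrite (le_trans (le_modc_sum _ _ _))//; apply: ler_sum => i _.
    by rewrite modcM ler_wpM2r ?modc_ge0// Aal.
  rewrite !mulr_sumr; apply: ler_sum => i _.
  have := sqr_ge0 (modc (Z j x) - modc (Z i x)).
  have -> : 2 * (modc (Z j x) * (al x * modc (Z i x))) =
    al x * (2 * (modc (Z j x) * modc (Z i x))) by ring.
  move=> h; rewrite ler_wpM2l//; move: h; rewrite !expr2; lra.
have NE : N x = \sum_j modc (Z j x) ^+ 2 by apply: eq_bigr => j _; rewrite sqr_modc.
under eq_bigr do rewrite -mulr_sumr big_split /= -NE sum_const_ord.
rewrite -mulr_sumr big_split /= sum_const_ord -mulr_sumr -NE.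
by rewrite le_eqVlt; apply/orP; left; apply/eqP; ring.
Qed.

Let N_ge0 x : 0 <= N x.
Proof. by apply: sumr_ge0 => j _; rewrite addr_ge0 ?sqr_ge0. Qed.

Let psi := prim al.

(* [|Z|^2 exp (- C psi)] decreases and [|Z|^2 exp (C psi)] increases; [s = 1, -1]
   treats both. *)
Let energy (s a b : R) : s ^+ 2 = 1 -> 0 < a -> a <= b ->
  s * N b * expR (- (s * (2 * n%:R)) * psi b) <=
  s * N a * expR (- (s * (2 * n%:R)) * psi a).
Proof.
move=> s1 a0 ab.
apply: (@rac_nonincreasing R a b
  (fun x => s * N x * expR (- (s * (2 * n%:R)) * psi x))) => //.
  apply: racM.
    apply: racM; first exact: rac_cst.
    apply: rac_sum => j _; have /abs_continuous_onP[hr hi] := acZ j a0 ab.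
    apply: (@rac_ext _ _ _ (fun x => complex.Re (Z j x) * complex.Re (Z j x) +
       complex.Im (Z j x) * complex.Im (Z j x))).
      by move=> x _; rewrite !expr2.
    by apply: racD; exact: racM.
  by apply: rac_expR; apply: racM; [exact: rac_cst|exact: rac_prim].
have dpsi := prim_derive lal.
have := dpsi; have := dZ; apply: filterS2; first exact: (ae_filter_ringOfSetsType mu).
move=> x dZx dpx /andP[ax xb]; have x0 : 0 < x by exact: lt_trans ax.
have dN := is_derive_N (dZx x0).
have de : is_derive x 1 (fun x => expR (- (s * (2 * n%:R)) * psi x))
    (- (s * (2 * n%:R)) * al x * expR (- (s * (2 * n%:R)) * psi x)).
  have lin := is_deriveZ (- (s * (2 * n%:R))) dpx.
  by apply: is_derive_eq (is_derive1_comp (is_derive_expR _) lin) _;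
    rewrite /GRing.scale /= mulrC.
have dsN := is_deriveZ s dN.
eexists; first by apply: is_derive_eq (is_deriveM dsN de) _; reflexivity.
rewrite /GRing.scale /= ; have := N'_le x0; set P := N' _ _; set E := expR _.
move=> PN; have E0 : 0 <= E by exact: expR_ge0.
have -> : s * N x * (- (s * (2 * n%:R)) * al x * E) + E * (s * P) =
  (s * P - s ^+ 2 * (2 * n%:R * al x * N x)) * E by ring.
rewrite mulr_le0_ge0// s1 mul1r subr_le0 (le_trans _ PN)//.
have /orP[/eqP ->|/eqP ->] : (s == 1) || (s == -1) by rewrite -sqrf_eq1 s1.
  by rewrite mul1r ler_norm.
by rewrite mulN1r -normrN ler_norm.
Qed.

Lemma linear_system_unique x0 : 0 < x0 -> (forall j, Z j x0 = 0) ->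
  forall x, 0 < x -> forall j, Z j x = 0.
Proof.
move=> x00 Zx0 x xp j.
have Nx0 : N x0 = 0.
  by rewrite /N big1// => i _; rewrite Zx0 /= expr0n addr0.
suff Nx : N x = 0.
  move/eqP: Nx; rewrite psumr_eq0 => [/allP /(_ j (mem_index_enum _))|i _].
    by rewrite -sqr_modc sqrf_eq0 modc_eq0 => /eqP.
  by rewrite addr_ge0 ?sqr_ge0.
apply/le_anti; rewrite N_ge0 andbT; have [xx0|xx0] := leP x0 x.
  have := @energy 1 _ _ (expr1n _ _) x00 xx0; rewrite Nx0 mulr0 mul0r mul1r.
  by rewrite pmulr_lle0 ?expR_gt0.
have s1 : (-1 : R) ^+ 2 = 1 by rewrite sqrrN expr1n.
have := @energy (-1) _ _ s1 xp (ltW xx0); rewrite Nx0 mulr0 mul0r.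
by rewrite pmulr_lge0 ?expR_gt0// mulN1r oppr_ge0.
Qed.

End Uniqueness.

(** * Minors of consecutive roots of unity *)

Section ConsecutiveRoots.
Variable R : realType.

Definition cis (a : R) : R[i] := cexp (0 +i* a).

Lemma cisD a b : cis (a + b) = cis a * cis b.
Proof. by rewrite /cis -cexpD; congr cexp; apply: complexP; rewrite ?Re_add ?Im_add /= ?addr0. Qed.

Lemma cisX a m : cis a ^+ m = cis (m%:R * a).
Proof.
elim: m => [|m IH]; first by rewrite mul0r /cis /cexp /= expR0 cos0 sin0 mulr1 mulr0.
by rewrite exprS IH -cisD -[in RHS]natr1 mulrDl mul1r addrC.
Qed.

Lemma Re_cis a : complex.Re (cis a) = cos a.
Proof. by rewrite /cis /cexp /= expR0 mul1r. Qed.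

Lemma modc_cis a : modc (cis a) = 1.
Proof. by rewrite modc_cexp expR0. Qed.

Lemma cos_lt1 (a : R) : 0 < a < pi *+ 2 -> cos a < 1.
Proof.
move=> /andP[a0 a2]; have -> : a = (a / 2) *+ 2 by rewrite -mulr_natr divfK.
have s0 : 0 < sin (a / 2).
  by apply: sin_gt0_pi; apply/andP; split; move: a2; rewrite -mulr_natr; lra.
rewrite cos_mulr2n; have := cos2Dsin2 (a / 2).
have : 0 < sin (a / 2) ^+ 2 by rewrite exprn_gt0.
by rewrite -mulr_natr; lra.
Qed.

Definition zeta n : R := pi *+ 2 / n%:R.

Lemma cis_zeta_prim n : (0 < n)%N -> n.-primitive_root (cis (zeta n)).
Proof.
move=> n0; rewrite /primitive_root_of_unity n0; apply/forallP => i.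
have nR : 0 < n%:R :> R by rewrite ltr0n.
have pi2 : 0 < pi *+ 2 :> R by rewrite mulrn_wgt0// pi_gt0.
apply/eqP; have [->|ine] := eqVneq i.+1 n.
  apply/unity_rootP; rewrite cisX mulrC divfK ?gt_eqF//.
  by apply: complexP; rewrite /= expR0 mul1r ?cos2pi ?sin2pi.
apply/negbTE/unity_rootP; rewrite cisX => /(congr1 (@complex.Re R)).
rewrite Re_cis /= => c1; suff : cos (i.+1%:R * zeta n) < 1 :> R by rewrite c1 ltxx.
apply: cos_lt1; rewrite /zeta; apply/andP; split.
  by rewrite mulr_gt0// ?ltr0n// divr_gt0.
rewrite mulrA ltr_pdivrMr// mulrC ltr_pM2l// ltr_nat ltn_neqAle ine /=.
exact: ltn_ord.
Qed.

(** Cosine decreases on [[0, pi]] and increases on [[pi, 2 pi]], so the side of [pi] on which [b]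
    lies decides which neighbour is higher. *)
Lemma cos_valley (a b c : R) : 0 <= a -> a < b -> b < c -> c <= pi *+ 2 ->
  cos b < cos a \/ cos b < cos c.
Proof.
move=> a0 ab bc c2; have pi2 : pi *+ 2 = 2 * pi :> R by rewrite mulr_natl.
rewrite pi2 in c2; have [bp|bp] := leP b pi.
  by left; rewrite ltr_cos// in_itv /=; apply/andP; split; lra.
right; have cosF t : cos t = cos (2 * pi - t) :> R.
  by rewrite -pi2 addrC cosD2pi cosN.
by rewrite (cosF b) (cosF c) ltr_cos// ?in_itv /=; try (apply/andP; split); lra.
Qed.

(** With exponent [a + i] the entry is [(c z^a)^(q s) (z^(q s))^i]: up to column scaling and row
    order this is a Vandermonde matrix with nodes [z^(q s)], distinct because [z] is primitive and
    [q] injective into ['I_n]. Working with a null vector avoids sorting the rows. *)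
Lemma minor_consecutive (n k : nat) (z c : R[i]) (e : 'I_k -> nat) (q : 'I_k -> 'I_n)
    (a : nat) : n.-primitive_root z -> c != 0 -> injective q ->
  (forall i, (i < k)%N -> exists l, e l = (a + i)%N) ->
  \det (\matrix_(l < k, s < k) (c * z ^+ e l) ^+ q s) != 0.
Proof.
move=> zprim c0 qinj econ; rewrite -det_tr; apply/negP => /det0P[v v0 vM].
have z0 : z != 0 by apply/eqP => z0; have := prim_expr_order zprim;
  rewrite z0 expr0n; case: (n) (prim_order_gt0 zprim) => //= n' _ /eqP; rewrite eq_sym oner_eq0.
pose x : 'rV[R[i]]_k := \row_s (z ^+ q s).
pose w : 'rV[R[i]]_k := \row_s (v 0 s * (c * z ^+ a) ^+ q s).
have wV : w *m (Vandermonde k x)^T = 0.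
  apply/matrixP => i0 i; rewrite !mxE.
  have [l el] := econ i (ltn_ord i).
  move/matrixP: vM => /(_ 0 l); rewrite !mxE => vl; rewrite -[RHS]vl.
  apply: eq_bigr => s _.
  rewrite !mxE el -mulrA; congr (_ * _).
  by rewrite exprD mulrA !exprMn -!exprM; congr (_ * _); rewrite mulnC.
have : \det (Vandermonde k x) != 0.
  rewrite det_Vandermonde; apply/prodf_neq0 => i _; apply/prodf_neq0 => j ij.
  rewrite !mxE subr_eq0 (eq_prim_root_expr zprim) !modn_small//.
  apply/eqP => /val_inj /qinj ji; by rewrite ji ltnn in ij.
rewrite -det_tr -unitfE -unitmxE => Vu.
have w0 : w = 0 by rewrite -[w](mulmxK Vu) wV mul0mx.
move/eqP: v0; apply; apply/matrixP => i s; rewrite !ord1 mxE.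
move/matrixP: w0 => /(_ 0 s); rewrite !mxE => /eqP; rewrite mulf_eq0.
by rewrite expf_eq0 mulf_eq0 (negbTE c0) expf_eq0 (negbTE z0) !andbF orbF => /eqP.
Qed.

(* The angles lie on a grid in [0, 2 pi), where [cos] is valley-shaped: the [k] roots
   with the smallest real parts occupy consecutive grid points. *)
Lemma dminor_neq0 n (hn : (0 < n)%N) (omega : 'I_n -> R[i]) (p : 'S_n) (th : R) k
    (hk : (k <= n)%N) :
  0 <= th -> (forall l, omega l ^+ n = 1) ->
  (forall l l' : 'I_n, (l < l')%N ->
     complex.Re (cis th * omega l) < complex.Re (cis th * omega l')) ->
  dminor omega p hk != 0.
Proof.
move=> th0 root ord; have zprim := cis_zeta_prim hn.
have nR : 0 < n%:R :> R by rewrite ltr0n.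
have pi2 : 0 < pi *+ 2 :> R by rewrite mulrn_wgt0// pi_gt0.
have zt0 : 0 < zeta n by rewrite divr_gt0.
(* Moving whole grid steps from the phase into the roots leaves a phase [ph] in [[0, zeta n[], so
   every angle [ph + e l * zeta n] lies in [[0, 2 pi[]. *)
pose z := cis (zeta n); pose M := Num.truncn (th / zeta n).
pose ph := th - M%:R * zeta n.
have /andP[ph0 ph1] : 0 <= ph < zeta n.
  have /andP[h1 h2] := truncn_itv (divr_ge0 th0 (ltW zt0)).
  rewrite /ph subr_ge0 -ler_pdivlMr// h1 /= ltrBlDl -{2}[zeta n]mul1r -mulrDl.
  by rewrite -ltr_pdivrMr// natr1.
have z0 : z != 0 by exact: cexp_neq0.
have /choice[e he] : forall l, exists i : 'I_n, omega l * z ^+ M = z ^+ i.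
  move=> l; have [|i hi] := prim_rootP zprim (x := omega l * z ^+ M); last by exists i.
  by rewrite exprMn root mul1r -exprM mulnC exprM (prim_expr_order zprim) expr1n.
have angle l : cis th * omega l = cis (ph + (e l)%:R * zeta n).
  rewrite cisD -cisX -he mulrA -mulrA [omega l * _]mulrC mulrA -/z; congr (_ * _).
  by rewrite cisX -cisD /ph subrK.
have Rel l : complex.Re (cis th * omega l) = cos (ph + (e l)%:R * zeta n).
  by rewrite angle Re_cis.
have ord' l l' : complex.Re (cis th * omega l) < complex.Re (cis th * omega l') -> (l < l')%N.
  move=> h; rewrite ltnNge leq_eqVlt; apply/negP => /orP[/eqP/val_inj ll|/ord].
    by rewrite ll ltxx in h.
  by move=> /(lt_trans h); rewrite ltxx.
have einj : injective e.
  move=> l l' el; apply/val_inj/eqP; rewrite eqn_leq; apply/andP; split; rewrite leqNgt;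
    by apply/negP => /ord; rewrite !Rel el ltxx.
have [g eg ge] : bijective e by apply: injF_bij.
pose S := [set e (widen_ord hk l) | l : 'I_k]%SET.
have cS : #|S| = k.
  by rewrite card_imset ?card_ord// => l l' /einj /(congr1 (@nat_of_ord n)) /= /ord_inj.
have SP j : (j \in S) = (g j < k)%N.
  apply/imsetP/idP => [[l _ ->]|gk]; first by rewrite eg /= ltn_ord.
  by exists (Ordinal gk) => //; rewrite -[LHS]ge; congr e; exact: val_inj.
have Rg (j : 'I_n) : cos (ph + j%:R * zeta n) = complex.Re (cis th * omega (g j)).
  by rewrite Rel ge.
(* By the valley shape a grid point between two members of [S] has a smaller real part than one of
   them, hence precedes it in the ordering. *)
have convex (i j h : 'I_n) : i \in S -> h \in S -> (i < j < h)%N -> j \in S.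
  rewrite !SP => iS hS /andP[ij jh].
  have hn' : h.+1%:R <= n%:R :> R by rewrite ler_nat.
  have zn : zeta n * n%:R = pi *+ 2 by rewrite divfK ?gt_eqF.
  have := @cos_valley (ph + i%:R * zeta n) (ph + j%:R * zeta n) (ph + h%:R * zeta n).
  case.
  - by rewrite addr_ge0// mulr_ge0// ltW.
  - by rewrite ltrD2l ltr_pM2r// ltr_nat.
  - by rewrite ltrD2l ltr_pM2r// ltr_nat.
  - rewrite -zn; move: hn'; rewrite -natr1 => hn'.
    have : zeta n * (h%:R + 1) <= zeta n * n%:R by rewrite ler_pM2l.
    by rewrite mulrDr mulr1 mulrC; lra.
  - rewrite !Rg => /ord'.
    by move=> /ltn_trans; apply.
  rewrite !Rg => /ord'.
  by move=> /ltn_trans; apply.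
have [k0|k0] := posnP k.
  by rewrite /dminor; move: hk {S cS SP convex}; rewrite k0 => hk; rewrite det_mx00 oner_neq0.
have [i0 i0S] : exists i0, i0 \in S by exists (e (widen_ord hk (Ordinal k0))); apply: imset_f.
have [a aS amin] := arg_minnP (fun i : 'I_n => i : nat) i0S.
(* If [a + i] were missing, convexity would confine [S] to [[a, a + i[], which has fewer than [k]
   points. *)
have Sa i : (i < k)%N -> exists2 j : 'I_n, j \in S & j = (a + i)%N :> nat.
  move=> ik; apply: contrapT => nj.
  have Slt h : h \in S -> (h < a + i)%N.
    move=> hS; rewrite ltnNge leq_eqVlt; apply/negP => /orP[/eqP ha|ha].
      by apply: nj; exists h.
    have ain : (a + i < n)%N by exact: ltn_trans ha _.
    apply: nj; exists (Ordinal ain) => //.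
    have [i_0|i_0] := posnP i.
      by rewrite (_ : Ordinal _ = a)//; apply/val_inj; rewrite /= i_0 addn0.
    by apply: (convex a _ h) => //=; rewrite ha andbT -{1}[val a]addn0 ltn_add2l.
  have : (#|S| <= i)%N.
    have inj (h : {j | j \in S}) : (val h - a < i)%N.
      case: h => h hS /=; have := Slt h hS; have := amin h hS.
      by move=> ? ?; lia.
    rewrite -card_sig -[i in (_ <= i)%N]card_ord.
    apply: (@leq_card _ _ (fun h => Ordinal (inj h))) => h h' /(congr1 val) /= hh.
    apply/val_inj/val_inj => /=.
    have := amin _ (valP h); have := amin _ (valP h'); by move=> /= ? ?; lia.
  by rewrite cS leqNgt ik.
rewrite /dminor.
have := @minor_consecutive n k z (z ^+ M)^-1 (fun l => e (widen_ord hk l))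
  (fun s => p (widen_ord hk s)) a zprim.
rewrite invr_eq0 expf_neq0// => /(_ isT) h.
rewrite (_ : \matrix_(l, s) _ =
  \matrix_(l < k, s < k) ((z ^+ M)^-1 * z ^+ e (widen_ord hk l)) ^+ p (widen_ord hk s)).
  apply: h => [s s' /perm_inj /(congr1 (@nat_of_ord n)) /= /ord_inj //|i /Sa[j /imsetP[l _ ->] jE]].
  by exists l.
apply/matrixP => l s; rewrite !mxE -he mulrC mulfK// expf_neq0//.
Qed.

End ConsecutiveRoots.

(** * Quasi-derivatives and Weyl solutions *)

Section QuasiDerivatives.
Variable R : realType.
Local Notation mu := (@lebesgue_measure R).

Lemma ae_itv (P : R -> Prop) (a b : R) : a < b -> {ae mu, forall x : R, P x} ->
  exists2 x, a < x < b & P x.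
Proof.
move=> ab [N [mN N0 sN]]; apply: contrapT => h.
have : (mu `]a, b[ <= mu N)%E.
  apply: le_measure; rewrite ?inE// => x /=; rewrite in_itv /= => xab.
  by apply: sN => Px; apply: h; exists x.
by rewrite N0 lebesgue_measure_itv /= lte_fin ab -EFinD lee_fin subr_le0 leNgt ab.
Qed.

Lemma AC_loc_cto (f : R -> R[i]) (x : R) : AC_loc f -> 0 < x -> cto (nbhs x) f (f x).
Proof.
move=> acf x0; have x2 : 0 < x / 2 by rewrite divr_gt0.
have x21 : x / 2 <= x + 1 by lra.
have /abs_continuous_onP[fr fi] := acf _ _ x2 x21.
apply: cto_ReIm.
  by apply: (rac_continuous fr); apply/andP; split; lra.
by apply: (rac_continuous fi); apply/andP; split; lra.
Qed.

(** The complement of a null set meets every interval, and both functions are continuous. *)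
Lemma AC_loc_ae_eq (f g : R -> R[i]) : AC_loc f -> AC_loc g ->
  {ae mu, forall x : R, 0 < x -> f x = g x} -> forall x, 0 < x -> f x = g x.
Proof.
move=> acf acg fg x x0; apply/eqP; rewrite -subr_eq0 -modc_eq0.
rewrite eq_le modc_ge0 andbT; apply/ler_addgt0Pl => e e0; rewrite addr0.
have cfg : cto (nbhs x) (fun t => f t + -1 * g t) (f x + -1 * g x).
  apply: ctoD; first exact: AC_loc_cto.
  by apply: ctoM; [exact: cto_cst|exact: AC_loc_cto].
move: cfg => /cvgrPdist_lt /(_ _ e0) /nbhs_ballP [r /= r0 h].
pose d := Num.min r x.
have d0 : 0 < d by rewrite lt_min r0.
have [|t /andP[t1 t2] ft] := @ae_itv _ (x - d) (x + d) _ fg; first by lra.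
have dx : d <= x by rewrite ge_min lexx orbT.
have dr : d <= r by rewrite ge_min lexx.
have t0 : 0 < t by lra.
have xt : `|x - t| < r by rewrite ltr_norml; apply/andP; split; lra.
have := h t xt; rewrite /=.
rewrite ft// mulN1r subrr sub0r sub0r modcN normrN ger0_norm ?modc_ge0//.
by move=> /ltW; rewrite mulN1r.
Qed.

Variables (n : nat) (F : R -> 'M[R[i]]_n).

(** Induction on the order: the lower quasi-derivatives fix the next one almost everywhere, and
    continuity fixes it everywhere. Any explicit vector may therefore replace the chosen [qvec]. *)
Lemma quasi_derivatives_unique y Y Y' : quasi_derivatives F y Y ->
  quasi_derivatives F y Y' -> forall (k : 'I_n) x, 0 < x -> Y x k 0 = Y' x k 0.
Proof.
move=> [acY Y0 dY] [acY' Y0' dY'].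
suff H m : forall k : 'I_n, (k <= m)%N -> forall x, 0 < x -> Y x k 0 = Y' x k 0.
  by move=> k x x0; exact: (H k).
elim: m => [|m IH] k; first by rewrite leqn0 => /eqP k0 x x0; rewrite Y0// Y0'.
rewrite leq_eqVlt => /orP[/eqP km|]; last by rewrite ltnS => /IH.
have mn : (m < n)%N by rewrite -km ltnW// ltn_ord.
pose j := Ordinal mn.
apply: AC_loc_ae_eq => //.
have := dY' j k km; have := dY j k km; apply: filterS2; first exact: (ae_filter_ringOfSetsType mu).
move=> x h1 h2 x0; have [d dd ->] := h1 x0; have [d' dd' ->] := h2 x0.
have -> : d = d'.
  apply: (is_cderive_unique (f := fun t => Y t j 0) dd).
  apply: is_cderive_near dd'; near=> t; apply/esym/IH => //.
  by near: t; exact: lt_nbhsr.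
congr (_ - _); apply: eq_bigr => i ij; rewrite IH//.
Unshelve. all: by end_near. Qed.

Lemma qvecP y : D_F F y -> quasi_derivatives F y (qvec F y).
Proof. by move=> [Y hY]; rewrite /qvec; apply: (xgetI _ hY). Qed.

Lemma qderE y Y (k : 'I_n) x : quasi_derivatives F y Y -> 0 < x ->
  qder F y k x = Y x k 0.
Proof.
by move=> qY x0; apply: (quasi_derivatives_unique (qvecP _) qY) => //; exists Y.
Qed.

Hypothesis F_upper : forall x (k j : 'I_n), (k < j)%N ->
  F x k j = (j == k.+1 :> nat)%:R.

Lemma companion_row lam x (k : 'I_n) (v : 'cV[R[i]]_n) :
  ((F x + Lambda_mx n lam) *m v) k 0 =
  \sum_(j < n | (j <= k)%N) F x k j * v j 0 +
  \sum_(j < n | j == k.+1 :> nat) v j 0 +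
  \sum_(j < n | (k == n.-1 :> nat) && (j == 0%N :> nat)) lam * v j 0.
Proof.
rewrite mxE (bigID (fun j : 'I_n => (j <= k)%N)) /=.
under eq_bigr do rewrite !mxE mulrDl.
under [X in _ + X]eq_bigr do rewrite !mxE mulrDl.
rewrite !big_split /= addrACA; congr (_ + _).
  congr (_ + _); rewrite (bigID (fun j : 'I_n => j == k.+1 :> nat)) /=.
  rewrite [X in _ + X]big1 ?addr0 => [|j /andP[kj jk]]; last first.
    by rewrite F_upper ?ltnNge// (negbTE jk) mul0r.
  rewrite (eq_bigl (fun j : 'I_n => j == k.+1 :> nat)) => [|j].
    by apply: eq_bigr => j /eqP jk; rewrite F_upper jk// eqxx mul1r.
  by apply/andP/idP => [[] //|/eqP ->]; rewrite ltnn.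
rewrite -(bigID (fun j : 'I_n => (j <= k)%N) xpredT
  (fun j => (if (k == n.-1 :> nat) && (j == 0%N :> nat) then lam else 0) * v j 0)) /=.
rewrite [RHS]big_mkcond /=; apply: eq_bigr => j _.
by case: ifP => _; rewrite ?mul0r.
Qed.

End QuasiDerivatives.

(** * From a fundamental system with known growth to the Weyl solution *)

Section FundamentalSystem.
Variable R : realType.
Local Notation mu := (@lebesgue_measure R).

Lemma at0_cto (f : R -> R[i]) v : cto 0^'+ f v -> at0 f = v.
Proof.
move=> fv; apply: complexP => /=; apply/cvg_lim => //.
  exact: cto_Re.
exact: cto_Im.
Qed.

Lemma expR_decay (g : R) : 0 < g -> expR (- g * x) @[x --> +oo] --> (0 : R).
Proof.
move=> g0; apply/cvgrPdist_le => e e0; near=> x.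
have xe : (g * e)^-1 <= x by near: x; apply: nbhs_pinfty_ge; exact: num_real.
have x0 : 0 < x by apply: lt_le_trans xe; rewrite invr_gt0 mulr_gt0.
rewrite sub0r normrN ger0_norm ?expR_ge0// mulNr expRN.
have gx : 0 < g * x by rewrite mulr_gt0.
have h : g * x <= expR (g * x) by rewrite (le_trans _ (expR_ge1Dx _))// lerDr.
rewrite (@le_trans _ _ (g * x)^-1)// ?lef_pV2 ?posrE ?expR_gt0//.
rewrite -[e]invrK lef_pV2 ?posrE ?invr_gt0//.
by move: xe; rewrite invfM -ler_pdivrMl ?invr_gt0// invrK.
Unshelve. all: by end_near. Qed.

Lemma cvgr_sum (T : Type) (G : set_system T) {FG : Filter G} (J : Type) (s : seq J)
    (P : pred J) (f : J -> T -> R) (l : J -> R) :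
  (forall i, P i -> f i t @[t --> G] --> l i) ->
  \sum_(i <- s | P i) f i t @[t --> G] --> \sum_(i <- s | P i) l i.
Proof.
move=> fl; elim: s => [|i s IH].
  by rewrite big_nil; under eq_fun do rewrite big_nil; exact: cvg_cst.
rewrite big_cons; under eq_fun do rewrite big_cons.
by case: ifP => // Pi; apply: cvgD => //; exact: fl.
Qed.

Variables (n : nat) (F : R -> 'M[R[i]]_n) (lam : R[i]).
Hypothesis F_upper : forall x (k j : 'I_n), (k < j)%N ->
  F x k j = (j == k.+1 :> nat)%:R.
Hypothesis F_lower : forall k j : 'I_n, (j <= k)%N -> L1p (fun x => F x k j).
Variable o : 'I_n.
Hypothesis o0 : o = 0%N :> nat.

(** An integrable majorant of the lower triangle alone; the superdiagonal ones are not integrable on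
    the half-line. *)
Definition absF x : R := \sum_(k < n) \sum_(j < n | (j <= k)%N)
  (`|complex.Re (ext0 (fun x => F x k j) x)| + `|complex.Im (ext0 (fun x => F x k j) x)|).

Lemma absF_ge0 x : 0 <= absF x.
Proof. by apply: sumr_ge0 => k _; apply: sumr_ge0 => j _; rewrite addr_ge0. Qed.

Lemma integ_sum (J : Type) (s : seq J) (P : pred J) (f : J -> R -> R) :
  (forall i, P i -> integ (f i)) -> integ (fun x => \sum_(i <- s | P i) f i x).
Proof.
move=> fi; elim: s => [|i s IH].
  by under eq_fun do rewrite big_nil; exact: integ0.
rewrite (_ : (fun x => _) = fun x =>
  if P i then f i x + \sum_(j <- s | P j) f j x else \sum_(j <- s | P j) f j x).
  by have [Pi|_] := boolP (P i); [apply: integD => //; exact: fi|exact: IH].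
by apply/funext => x; rewrite big_cons.
Qed.

Lemma integ_absF : integ absF.
Proof.
apply: integ_sum => k _; apply: integ_sum => j jk; have [fr fi] := F_lower jk.
by apply: integD; exact: integ_norm.
Qed.

Lemma absF_neg x : x <= 0 -> absF x = 0.
Proof.
move=> x0; apply: big1 => k _; apply: big1 => j _.
by rewrite /ext0 ltNge x0 /= normr0 addr0.
Qed.

Lemma F_le_absF (k j : 'I_n) x : (j <= k)%N -> 0 < x -> modc (F x k j) <= absF x.
Proof.
move=> jk x0; rewrite (le_trans (modc_le_ReIm _))// /absF (bigD1 k)//= (bigD1 j)//=.
rewrite /ext0 x0 -addrA lerDl addr_ge0//; apply: sumr_ge0 => i _; first by rewrite addr_ge0.
by apply: sumr_ge0 => l _; rewrite addr_ge0.
Qed.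

(** The superdiagonal ones and [lam] add a constant on the half-line, so this majorant is only left
    integrable. *)
Let al x := absF x + (if 0 < x then 1 + modc lam else 0).

Lemma left_integD (v w : R -> R) : left_integ v -> left_integ w ->
  left_integ (fun x => v x + w x).
Proof.
move=> [mv iv] [mw iw]; split; first exact: measurable_funD.
by move=> y; have := integrableD _ (iv y) (iw y); exact.
Qed.

Lemma left_integ_step (c : R) : left_integ (fun x : R => if 0 < x then c else 0).
Proof.
split=> [|y].
  by apply: measurable_fun_ifT => //; exact: measurable_fun_ltr.
rewrite integrable_mkcond// (_ : _ \_ _ =
  EFin \o (fun x : R => c * \1_(`]0, y]%classic) x)).
  by apply: integZ; exact: integrable_indic_itv.
apply/funext => x; rewrite patchE /= indicE mem_setE mem_setE !in_itv /=.
by case: ifPn => xy; case: (0 < x) => /=; rewrite ?xy ?(negbTE xy) ?mulr0 ?mulr1.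
Qed.

Lemma companion_le (k j : 'I_n) x : 0 < x -> modc ((F x + Lambda_mx n lam) k j) <= al x.
Proof.
move=> x0; rewrite !mxE (le_trans (le_modcD _ _))// /al x0.
have lamle : modc (if (k == n.-1 :> nat) && (j == 0%N :> nat) then lam else 0) <= modc lam.
  by case: ifP => // _; rewrite modc0 modc_ge0.
have [jk|kj] := leqP j k.
  by rewrite lerD ?F_le_absF// (le_trans lamle)// lerDr.
rewrite F_upper// ler_wpDl ?absF_ge0//; apply: lerD => //.
by case: eqP; rewrite ?modc1 ?modc0.
Qed.

Variable Y : 'I_n -> 'I_n -> R -> R[i].
Hypothesis acY : forall l k a b, abs_continuous_on a b (Y l k).
Hypothesis dY : {ae mu, forall x : R, 0 < x -> forall l k,
  is_cderive (Y l k) x (\sum_j (F x + Lambda_mx n lam) k j * Y l j x)}.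
Hypothesis detY : \det (\matrix_(k, l) Y l k 1) != 0.
Variable a : 'I_n -> R.
Hypothesis a_mono : forall l l' : 'I_n, (l < l')%N -> a l < a l'.
Hypothesis Y_lower : forall l x, expR (a l * x) / 2 <= modc (Y l o x).
Hypothesis Y_upper : forall l x, modc (Y l o x) <= 2 * expR (a l * x).

Definition comb (c : 'I_n -> R[i]) k x := \sum_l c l * Y l k x.

Lemma ac_comb c k b b' : abs_continuous_on b b' (comb c k).
Proof. by apply: ac_sum => l _; apply: acM; [exact: ac_cst|exact: acY]. Qed.

Lemma is_cderive_comb c : {ae mu, forall x : R, 0 < x -> forall k,
  is_cderive (comb c k) x (\sum_j (F x + Lambda_mx n lam) k j * comb c j x)}.
Proof.
have := dY; apply: filterS; first exact: (ae_filter_ringOfSetsType mu).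
move=> x h x0 k.
have := @is_cderive_sum _ _ (index_enum 'I_n) xpredT (fun l t => c l * Y l k t) x _
  (fun l _ => is_cderiveM (is_cderive_cst (c l) x) (h x0 l k)).
congr is_cderive; under eq_bigr do rewrite mul0r add0r mulr_sumr.
rewrite exchange_big /=; apply: eq_bigr => j _; rewrite mulr_sumr.
by apply: eq_bigr => l _; rewrite mulrCA.
Qed.

(** Match the values at the base point [1], where the fundamental matrix is invertible; the
    difference vanishes there, hence everywhere. *)
Lemma system_span (Z : 'I_n -> R -> R[i]) : (forall k, AC_loc (Z k)) ->
  {ae mu, forall x : R, 0 < x -> forall k,
    is_cderive (Z k) x (\sum_j (F x + Lambda_mx n lam) k j * Z j x)} ->
  exists c, forall x, 0 < x -> forall k, Z k x = comb c k x.
Proof.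
move=> acZ dZ; pose M := \matrix_(k, l) Y l k 1.
have Mu : M \in unitmx by rewrite unitmxE unitfE.
pose cv := invmx M *m (\col_k Z k 1); pose c l := cv l 0; exists c.
have c1 k : comb c k 1 = Z k 1.
  have : (M *m cv) k 0 = Z k 1 by rewrite mulKVmx// mxE.
  by rewrite mxE => <-; apply: eq_bigr => l _; rewrite mxE mulrC.
pose D k x := Z k x + -1 * comb c k x.
suff D0 x : 0 < x -> forall k, D k x = 0.
  by move=> x x0 k; have := D0 x x0 k; rewrite /D mulN1r => /eqP; rewrite subr_eq0 => /eqP.
apply: (@linear_system_unique R n (fun k j x => (F x + Lambda_mx n lam) k j) al D _ _ _ _ _ 1) => //.
- by apply: left_integD; [exact: integ_left integ_absF|exact: left_integ_step].
- move=> t; rewrite addr_ge0 ?absF_ge0//; case: ifP => // _.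
  by rewrite addr_ge0 ?modc_ge0.
- by move=> k j t t0; exact: companion_le.
- move=> k b b' b0 bb'; apply: acD; first exact: acZ.
  by apply: acM; [exact: ac_cst|exact: ac_comb].
- have := is_cderive_comb c; have := dZ; apply: filterS2; first exact: (ae_filter_ringOfSetsType mu).
  move=> t h1 h2 t0 k.
  have := is_cderiveD (h1 t0 k) (is_cderiveM (is_cderive_cst (-1) t) (h2 t0 k)).
  congr is_cderive; rewrite mul0r add0r mulr_sumr -big_split; apply: eq_bigr => j _ /=.
  by rewrite /D mulrDr [in RHS]mulrCA.
by move=> k; rewrite /D c1 mulN1r subrr.
Qed.

Lemma solution_span y : solution F lam y ->
  exists c, forall x, 0 < x -> forall k, qder F y k x = comb c k x.
Proof.
move=> [Dy dy]; have [acq q0 dq] := qvecP Dy.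
apply: (@system_span (fun k x => qder F y k x)) => //.
have := dy; apply: filterS; first exact: (ae_filter_ringOfSetsType mu).
by move=> x h x0 k; have := h x0 k; rewrite mxE.
Qed.

(** All rows but the last of the companion system are the recursion for quasi-derivatives; [lam]
    enters only the last row, which the definition leaves free. *)
Lemma comb_quasi c : quasi_derivatives F (comb c o) (fun x => \col_k comb c k x).
Proof.
split=> [k b b' b0 bb'|k k0 x x0|k k' kk'].
- by apply: ac_ext (ac_comb c k b b') => x _; rewrite mxE.
- by rewrite mxE; congr comb; apply/ord_inj; rewrite k0 o0.
have := is_cderive_comb c; apply: filterS; first exact: (ae_filter_ringOfSetsType mu).
move=> x h x0; exists (\sum_j (F x + Lambda_mx n lam) k j * comb c j x).
  by have := h x0 k; congr is_cderive; apply/funext => t; rewrite mxE.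
have -> : \sum_j (F x + Lambda_mx n lam) k j * comb c j x =
    ((F x + Lambda_mx n lam) *m (\col_k comb c k x)) k 0.
  by rewrite mxE; apply: eq_bigr => j _; congr (_ * _); rewrite mxE.
rewrite (companion_row F_upper) [X in _ + _ + X]big1 ?addr0 => [|j /andP[/eqP kn _]]; last first.
  by exfalso; have := ltn_ord k'; have := ltn_ord k; rewrite kk' kn; lia.
rewrite addrC addKr (bigD1 k') ?kk'//= big1 ?addr0// => j /andP[/eqP jk jk'].
by case/eqP: jk'; apply/ord_inj; rewrite jk kk'.
Qed.

Lemma comb_qder c k x : 0 < x -> qder F (comb c o) k x = comb c k x.
Proof. by move=> x0; rewrite (qderE _ (comb_quasi c) x0) mxE. Qed.

Lemma comb_solution c : solution F lam (comb c o).
Proof.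
split; first by exists (fun x => \col_k comb c k x); exact: comb_quasi.
have := is_cderive_comb c; apply: filterS; first exact: (ae_filter_ringOfSetsType mu).
move=> x h x0 k; have := h x0 k.
rewrite mxE (_ : \sum_j _ = \sum_j (F x + Lambda_mx n lam) k j * comb c j x); last first.
  by apply: eq_bigr => j _; rewrite -(comb_qder c j x0).
apply: is_cderive_near; near=> t; rewrite comb_qder//.
by near: t; exact: lt_nbhsr.
Unshelve. all: by end_near. Qed.

Lemma at0_comb c k (f : R -> R[i]) : (forall x, 0 < x -> f x = comb c k x) ->
  at0 f = comb c k 0.
Proof.
move=> fE; apply: at0_cto.
apply: (@cto_near _ _ _ _ (comb c k)).
  by near=> x; rewrite fE//; near: x; exact: nbhs_right_gt.
have /abs_continuous_onP[fr fi] := ac_comb c k (-1) 1.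
apply: cto_ReIm; apply: cvg_at_right_filter.
  by apply: (rac_continuous fr); apply/andP; split; lra.
by apply: (rac_continuous fi); apply/andP; split; lra.
Unshelve. all: by end_near. Qed.

(** Take the largest [l > k] with [c l != 0] and divide by [exp (a l x)]: the growth bound and all
    terms below [l] decay, whereas [Y_lower] keeps the [l]-th term at least [modc (c l) / 2]. *)
Lemma growth_coeff c (k : 'I_n) (y : R -> R[i]) :
  (forall x, 0 < x -> y x = comb c o x) ->
  (exists M, \forall x \near +oo, modc (y x) <= M * expR (a k * x)) ->
  forall l : 'I_n, (k < l)%N -> c l = 0.
Proof.
move=> yE [M hM] l0 kl0; apply/eqP; apply: contrapT => /negP cl0.
have : (k < l0)%N && (c l0 != 0) by rewrite kl0.
move=> /(@arg_maxnP _ l0 (fun l => (k < l)%N && (c l != 0)) (fun l : 'I_n => l : nat)).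
move=> [l /andP[kl cl] lmax].
pose rhs x := M * expR (- (a l - a k) * x) +
  \sum_(i < n | (i < l)%N) modc (c i) * 2 * expR (- (a l - a i) * x).
have rhs0 : rhs x @[x --> +oo] --> (0 : R).
  have -> : (0 : R) = M * 0 + \sum_(i < n | (i < l)%N) modc (c i) * 2 * 0.
    by rewrite big1 ?mulr0 ?addr0// => i _; rewrite mulr0.
  apply: cvgD; first by apply: cvgM; [exact: cvg_cst|apply: expR_decay; rewrite subr_gt0 a_mono].
  apply: cvgr_sum => i il; apply: cvgM; first exact: cvg_cst.
  by apply: expR_decay; rewrite subr_gt0 a_mono.
have : modc (c l) / 2 <= 0.
  apply: (@ler_cvg_to _ _ _ _ (fun=> modc (c l) / 2) rhs _ _ (cvg_cst _) rhs0).
  near=> x.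
  have x0 : 0 < x by near: x; apply: nbhs_pinfty_gt; exact: num_real.
  have yx : modc (y x) <= M * expR (a k * x) by near: x.
  have E0 : 0 < expR (a l * x) by exact: expR_gt0.
  rewrite -(ler_pM2r E0) /rhs mulrDl mulr_suml.
  have shift i : expR (- (a l - a i) * x) * expR (a l * x) = expR (a i * x).
    by rewrite -expRD; congr expR; ring.
  rewrite -[M * _ * _]mulrA shift; under eq_bigr do rewrite -[_ * expR _ * expR _]mulrA shift.
  have cY : c l * Y l o x = y x - \sum_(i < n | (i < l)%N) c i * Y i o x.
    rewrite yE// /comb (bigD1 l)//= (bigID (fun i : 'I_n => (i < l)%N)) /=.
    rewrite [X in _ + (_ + X)]big1 => [|i /andP[il nil]].
      rewrite addr0 (eq_bigl (fun i : 'I_n => (i < l)%N)) ?addrK// => i.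
      by apply/andP/idP => [[] //|il]; split=> //; apply/eqP => /(congr1 (@nat_of_ord n)) h; move: il; rewrite h ltnn.
    have li : (l < i)%N.
      rewrite ltn_neqAle leqNgt nil andbT; apply/eqP => /ord_inj h.
      by rewrite h eqxx in il.
    have : c i == 0.
      apply/negPn/negP => ci; have := lmax i; rewrite ci andbT.
      by rewrite (ltn_trans kl li) => /(_ isT); rewrite /= leqNgt li.
    by move/eqP ->; rewrite mul0r.
  apply: (@le_trans _ _ (modc (c l * Y l o x))).
    rewrite modcM -mulrA [2^-1 * _]mulrC; apply: ler_wpM2l; first exact: modc_ge0.
    exact: Y_lower.
  rewrite cY (le_trans (le_modcD _ _))// modcN lerD//.
  rewrite (le_trans (le_modc_sum _ _ _))//; apply: ler_sum => i _.
  by rewrite modcM -mulrA ler_wpM2l ?modc_ge0.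
by rewrite pmulr_lle0 ?invr_gt0// leNgt modc_gt0 cl.
Unshelve. all: by end_near. Qed.

Variables (p : 'S_n) (U : 'M[R[i]]_n) (w rho : R[i]) (k : 'I_n) (c : 'I_n -> R[i]).
Hypotheses (lamE : lam = rho ^+ n) (wE : complex.Re (rho * w) = a k).

Definition bform s l := Y l (p s) 0 + \sum_(j < n | (j < p s)%N) U s j * Y l j 0.

Hypothesis c_tail : forall l : 'I_n, (k < l)%N -> c l = 0.
Hypothesis c_bform : forall s : 'I_n, (s <= k)%N -> \sum_l c l * bform s l = (s == k)%:R.
Hypothesis c_unique : forall c' : 'I_n -> R[i], (forall l : 'I_n, (k < l)%N -> c' l = 0) ->
  (forall s : 'I_n, (s <= k)%N -> \sum_l c' l * bform s l = (s == k)%:R) -> c' =1 c.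

Lemma boundary_form_comb c' y s : (forall x, 0 < x -> forall j, qder F y j x = comb c' j x) ->
  boundary_form F p U s y = \sum_l c' l * bform s l.
Proof.
move=> yE; rewrite /boundary_form.
have atE j : at0 (qder F y j) = comb c' j 0 by apply: at0_comb => x x0; exact: yE.
rewrite atE; under eq_bigr do rewrite atE.
rewrite /bform; under [RHS]eq_bigr do rewrite mulrDr mulr_sumr.
rewrite big_split /= exchange_big /=; congr (_ + _); apply: eq_bigr => j _.
by rewrite mulr_sumr; apply: eq_bigr => l _; rewrite mulrCA.
Qed.

(** As [weyl] is a choice, existence comes first: [comb c o] meets the conditions, so the chosen
    function meets them too. Its own coefficients vanish beyond [k] by growth and satisfy the same
    boundary equations, and [c_unique] identifies them. *)
Lemma weyl_comb x j : 0 < x -> qder F (weyl F p U w k rho) j x = comb c j x.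
Proof.
have mE t : modc (cexp (rho * w * t%:C)) = expR (a k * t).
  by rewrite modc_cexp mulrC ReZ wE mulrC.
have : weyl_conditions F p U w k rho (weyl F p U w k rho).
  apply: xgetPex; exists (comb c o); split.
  - by rewrite -lamE; exact: comb_solution.
  - move=> s sk; rewrite (@boundary_form_comb c) ?c_bform// => t t0 i.
    exact: comb_qder.
  exists (\sum_l modc (c l) * 2); near=> t.
  have t0 : 0 < t by near: t; apply: nbhs_pinfty_gt; exact: num_real.
  rewrite mE /comb (le_trans (le_modc_sum _ _ _))// mulr_suml.
  apply: ler_sum => l _; have [kl|lk] := ltnP k l.
    by rewrite c_tail// mul0r modc0 !mul0r.
  rewrite modcM -mulrA ler_wpM2l ?modc_ge0// (le_trans (Y_upper _ _))//.
  rewrite ler_wpM2l// ler_expR ler_wpM2r ?(ltW t0)//.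
  move: lk; rewrite leq_eqVlt => /orP[/eqP/ord_inj -> //|/a_mono /ltW //].
move=> [sol bf gr] x0; rewrite -lamE in sol.
have [c' c'E] := solution_span sol.
have tail : forall l : 'I_n, (k < l)%N -> c' l = 0.
  apply: (@growth_coeff c' k (weyl F p U w k rho)) => [t t0|].
    rewrite -c'E//; have [_ q0 _] := qvecP sol.1.
    by rewrite /qder q0.
  by case: gr => M hM; exists M; apply: filterS hM => t; rewrite mE.
rewrite c'E//; apply: eq_bigr => l _; congr (_ * _); apply: c_unique => // s sk.
by rewrite -(boundary_form_comb _ c'E) bf.
Unshelve. all: by end_near. Qed.

End FundamentalSystem.

(** * Birkhoff solutions *)

Section BirkhoffSolutions.
Variable R : realType.
Local Notation mu := (@lebesgue_measure R).
Variables (n : nat) (n0 : (0 < n)%N) (F : R -> 'M[R[i]]_n).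
Hypothesis F_upper : forall x (k j : 'I_n), (k < j)%N ->
  F x k j = (j == k.+1 :> nat)%:R.
Hypothesis F_lower : forall k j : 'I_n, (j <= k)%N -> L1p (fun x => F x k j).
Hypothesis F_trace : forall x, \sum_k F x k k = 0.
Variables (omega : 'I_n -> R[i]) (phi : R).
Hypothesis omega_root : forall l, omega l ^+ n = 1.
Hypothesis omega_order : forall l l' : 'I_n, (l < l')%N ->
  complex.Re (cis phi * omega l) < complex.Re (cis phi * omega l').

Definition ray_pt (t : R) : R[i] := t%:C * cis phi.

Lemma modc_omega l : modc (omega l) = 1.
Proof.
have : modc (omega l) ^+ n = 1 by rewrite -modcX omega_root modc1.
by move/eqP; rewrite pexpr_eq1 ?modc_ge0// => /eqP.
Qed.

Lemma omega_neq0 l : omega l != 0.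
Proof. by rewrite -modc_gt0 modc_omega. Qed.

Lemma omega_inj : injective omega.
Proof.
move=> l l' ll; apply/ord_inj/eqP; rewrite eqn_leq; apply/andP; split;
  by rewrite leqNgt; apply/negP => /omega_order; rewrite ll ltxx.
Qed.

Lemma modc_ray_pt t : 0 <= t -> modc (ray_pt t) = t.
Proof. by move=> t0; rewrite modcM modc_real modc_cis mulr1 ger0_norm. Qed.

Lemma ray_pt_neq0 t : 0 < t -> ray_pt t != 0.
Proof. by move=> t0; rewrite -modc_gt0 modc_ray_pt// ltW. Qed.

Let natC : n%:R = (n%:R : R)%:C :> R[i].
Proof. by rewrite rmorph_nat. Qed.

Let nC : n%:R != 0 :> R[i].
Proof. by rewrite -modc_gt0 natC modc_real normr_gt0 pnatr_eq0 -lt0n. Qed.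

(** The product in the other order consists of geometric sums in [omega_j / omega_i]; a one-sided
    inverse of a square matrix is two-sided. *)
Lemma omega_orthogonal (k k' : 'I_n) :
  \sum_i omega i ^+ k * (omega i)^-1 ^+ k' = n%:R * (k == k')%:R.
Proof.
pose A := \matrix_(k < n, i < n) omega i ^+ k.
pose W := \matrix_(i < n, k < n) (n%:R^-1 * (omega i)^-1 ^+ k).
have WA : W *m A = 1%:M.
  apply/matrixP => i j; rewrite !mxE.
  under eq_bigr do rewrite !mxE -mulrA -exprMn.
  rewrite -mulr_sumr; have [->|ij] := eqVneq i j.
    under eq_bigr do rewrite mulVf ?omega_neq0// expr1n.
    by rewrite sumr_const card_ord mulVf.
  have q1 : (omega i)^-1 * omega j - 1 != 0.
    rewrite subr_eq0; apply/eqP => h; case/eqP: ij; apply: omega_inj.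
    by rewrite -[omega j](mulKf (omega_neq0 i)) mulrCA h mulr1.
  have := subrX1 ((omega i)^-1 * omega j) n.
  rewrite exprMn exprVn !omega_root invr1 mul1r subrr => /esym/eqP.
  by rewrite mulf_eq0 (negbTE q1) => /eqP ->; rewrite mulr0.
have /matrixP /(_ k k') := mulmx1C WA; rewrite !mxE => <-.
rewrite mulr_sumr; apply: eq_bigr => i _; rewrite !mxE.
by rewrite mulrCA mulVKf.
Qed.

(** With [pert], this is the lower triangle of [F] conjugated by [diag (rho^k)] and the Fourier
    matrix of the roots. As [i <= k], only nonnegative powers of [1 / rho] occur. *)
Definition pert_row t (k j : 'I_n) x : R[i] := \sum_(i < n | (i <= k)%N)
  (ray_pt t)^-1 ^+ (k - i) * omega j ^+ i * ext0 (fun x => F x k i) x.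

Definition pert t (l j : 'I_n) x : R[i] :=
  n%:R^-1 * \sum_(k < n) (omega l)^-1 ^+ k * pert_row t k j x.

Lemma cmeas_pert t l j : cmeas (pert t l j).
Proof.
apply: cmeasM; first exact: cmeas_cst.
apply: cmeas_sum => k _; apply: cmeasM; first exact: cmeas_cst.
apply: cmeas_sum => i ik; apply: cmeasM; first exact: cmeas_cst.
by have [fr fi] := F_lower ik; split; exact: integ_meas.
Qed.

Let summand_le t (l j k i : 'I_n) x : 1 <= t -> (i <= k)%N ->
  modc ((omega l)^-1 ^+ k * ((ray_pt t)^-1 ^+ (k - i) * omega j ^+ i *
    ext0 (fun x => F x k i) x)) = t^-1 ^+ (k - i) * modc (ext0 (fun x => F x k i) x).
Proof.
move=> t1 ik; have t0 : 0 <= t by rewrite (le_trans ler01).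
by rewrite !modcM !modcX !modcV !modc_omega invr1 !expr1n mul1r mulr1 modc_ray_pt.
Qed.

Let modc_nV : modc (n%:R^-1 : R[i]) <= 1.
Proof.
rewrite modcV natC modc_real ger0_norm//.
by rewrite invf_le1 ?ltr0n// ler1n.
Qed.

Lemma pert_le t l j x : 1 <= t -> modc (pert t l j x) <= absF F x.
Proof.
move=> t1; have t0 : 0 < t by rewrite (lt_le_trans ltr01).
rewrite modcM -[leRHS]mul1r ler_pM ?modc_ge0//.
rewrite (le_trans (le_modc_sum _ _ _))//; apply: ler_sum => k _.
rewrite mulr_sumr (le_trans (le_modc_sum _ _ _))//; apply: ler_sum => i ik.
rewrite summand_le// (le_trans _ (modc_le_ReIm _))// ler_piMl ?modc_ge0//.
by rewrite exprn_ile1 ?invr_ge0 ?(ltW t0)// invf_le1.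
Qed.

(** For equal root indices the terms with [i = k] have coefficient [1] and sum to the trace; each
    remaining term has a factor [1 / rho]. *)
Lemma pert_diag_le t l x : 1 <= t -> modc (pert t l l x) <= t^-1 * absF F x.
Proof.
move=> t1; have t0 : 0 < t by rewrite (lt_le_trans ltr01).
rewrite modcM -[leRHS]mul1r ler_pM ?modc_ge0//.
have tr0 : \sum_k ext0 (fun x => F x k k) x = 0.
  by rewrite /ext0; case: (0 < x); [exact: F_trace|rewrite big1].
rewrite -[X in modc X]subr0 -[in X in modc (_ - X)]tr0 -sumrB.
rewrite (le_trans (le_modc_sum _ _ _))// /absF mulr_sumr; apply: ler_sum => k _.
rewrite /pert_row (bigD1 k)//= subnn expr0 mul1r mulrDr mulrA -exprMn mulVf ?omega_neq0//.
rewrite expr1n mul1r addrAC subrr add0r [in leRHS](bigD1 k)//= mulrDr ler_wpDl//.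
  by rewrite mulr_ge0 ?invr_ge0 ?(ltW t0)// addr_ge0.
rewrite !mulr_sumr (le_trans (le_modc_sum _ _ _))//; apply: ler_sum => i /andP[ik ki].
rewrite summand_le//; apply: ler_pM; rewrite ?modc_ge0 ?exprn_ge0 ?invr_ge0 ?(ltW t0)//.
  have : (0 < k - i)%N by rewrite subn_gt0 ltn_neqAle ik andbT; apply: contraNneq ki => /ord_inj ->.
  case: (k - i)%N => // m _; rewrite exprS ler_piMr ?invr_ge0 ?(ltW t0)//.
  by rewrite exprn_ile1 ?invr_ge0 ?(ltW t0)// invf_le1.
exact: modc_le_ReIm.
Qed.

Lemma pert_system t x (v : 'I_n -> R[i]) (k : 'I_n) : 0 < t -> 0 < x ->
  ray_pt t ^+ k * (\sum_i omega i ^+ k *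
      (ray_pt t * omega i * v i + \sum_j pert t i j x * v j)) =
  \sum_j (F x + Lambda_mx n (ray_pt t ^+ n)) k j *
     (ray_pt t ^+ j * \sum_i omega i ^+ j * v i).
Proof.
move=> t0 x0; have r0 := ray_pt_neq0 t0.
pose Sv : 'cV_n := \col_j (ray_pt t ^+ j * \sum_i omega i ^+ j * v i).
have -> : \sum_j (F x + Lambda_mx n (ray_pt t ^+ n)) k j *
     (ray_pt t ^+ j * \sum_i omega i ^+ j * v i) =
  ((F x + Lambda_mx n (ray_pt t ^+ n)) *m Sv) k 0.
  by rewrite [RHS]mxE; apply: eq_bigr => j _; congr (_ * _); rewrite mxE.
rewrite (companion_row F_upper).
under eq_bigr do rewrite mulrDr; rewrite big_split /= mulrDr addrC -addrA.
congr (_ + _).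
  have rowE : \sum_i omega i ^+ k * (\sum_j pert t i j x * v j) =
      \sum_j pert_row t k j x * v j.
    under eq_bigr do rewrite mulr_sumr.
    rewrite exchange_big /=; apply: eq_bigr => j _.
    under eq_bigr do rewrite mulrA; rewrite -mulr_suml; congr (_ * _).
    under eq_bigr do rewrite /pert mulrCA mulr_sumr mulr_sumr.
    rewrite exchange_big /=.
    rewrite (eq_bigr (fun k' : 'I_n => (k == k')%:R * pert_row t k' j x)); last first.
      move=> k' _; under eq_bigr do rewrite [omega _ ^+ k * _]mulrA mulrA.
      by rewrite -mulr_suml -mulr_sumr omega_orthogonal mulKf.
    rewrite (bigD1 k)//= eqxx mul1r big1 ?addr0// => k' kk'.
    by rewrite eq_sym (negbTE kk') mul0r.
  rewrite rowE mulr_sumr (eq_bigr (fun j : 'I_n => \sum_(i < n | (i <= k)%N)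
    ray_pt t ^+ k * ((ray_pt t)^-1 ^+ (k - i) * omega j ^+ i *
      ext0 (fun x => F x k i) x * v j))); last first.
    by move=> j _; rewrite /pert_row mulr_suml mulr_sumr.
  rewrite exchange_big /=; apply: eq_bigr => i ik.
  rewrite mxE !mulr_sumr; apply: eq_bigr => j _; rewrite /ext0 x0.
  have -> : ray_pt t ^+ k = ray_pt t ^+ (k - i) * ray_pt t ^+ i by rewrite -exprD subnK.
  rewrite exprVn; have := expf_neq0 (k - i) r0; set r1 := _ ^+ (k - i) => r10.
  by field.
under eq_bigr do rewrite mulrA [omega _ ^+ k * _]mulrCA -exprSr -mulrA.
rewrite -mulr_sumr mulrA -exprSr.
have kn := ltn_ord k; have [kn1|kn1] := ltnP k.+1 n.
  rewrite [X in _ + X]big1 ?addr0 => [|j /andP[/eqP h _]]; last by lia.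
  rewrite [in RHS](bigD1 (Ordinal kn1))//= [in RHS]big1 ?addr0 ?mxE// => j /andP[/eqP h].
  by case/negP; apply/eqP/ord_inj.
rewrite [in RHS]big1 ?add0r => [|j /eqP h]; last by have := ltn_ord j; lia.
(* In the last row [omega^n = 1] turns the power [rho^n] into the entry of [Lambda] acting on
   component [0]. *)
have kE : k = n.-1 :> nat by lia.
rewrite [in RHS](bigD1 (Ordinal n0))/= ?kE ?eqxx// [X in _ = _ + X]big1 ?addr0 => [|j /andP[/eqP h]]; last first.
  by case/negP; apply/eqP/ord_inj.
rewrite mxE /= expr0 mul1r (_ : n.-1.+1 = n) ?prednK//; congr (_ * _).
by apply: eq_bigr => i _; rewrite omega_root expr0.
Qed.

(** The inverse of one plus the sum of the inverses replaces a minimum and also covers an empty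
    index set. *)
Lemma positive_lower_bound (I : finType) (P : pred I) (f : I -> R) :
  (forall i, P i -> 0 < f i) -> exists2 g, 0 < g & forall i, P i -> g <= f i.
Proof.
move=> f0; have s0 : 0 <= \sum_(i | P i) (f i)^-1.
  by apply: sumr_ge0 => i Pi; rewrite invr_ge0 ltW// f0.
exists (1 + \sum_(i | P i) (f i)^-1)^-1; first by rewrite invr_gt0 ltr_wpDr.
move=> i Pi; rewrite -[leRHS]invrK lef_pV2 ?posrE ?invr_gt0 ?f0//; last by rewrite ltr_wpDr.
rewrite (bigD1 i)//= addrCA lerDl addr_ge0//; apply: sumr_ge0 => j /andP[Pj _].
by rewrite invr_ge0 ltW// f0.
Qed.

Lemma omega_gap : exists2 g, 0 < g & forall l j : 'I_n, j != l ->
  g <= `|complex.Re (cis phi * (omega j - omega l))|.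
Proof.
have [|g g0 hg] := @positive_lower_bound ('I_n * 'I_n)%type (fun lj => lj.2 != lj.1)
  (fun lj => `|complex.Re (cis phi * (omega lj.2 - omega lj.1))|).
  move=> [l j] /= jl; rewrite normr_gt0 mulrBr Re_add Re_opp subr_eq0.
  have : (j < l)%N || (l < j)%N by rewrite -neq_ltn.
  by case/orP => /omega_order h; [rewrite lt_eqF|rewrite gt_eqF].
by exists g => // l j jl; exact: (hg (l, j)).
Qed.

(** The factor [exp (rho omega_l x)] is already divided out, so the diagonal coefficient vanishes
    for [j = l]. *)
Definition birkhoff_z t l (z : 'I_n -> R -> R[i]) :=
  (forall j a b, abs_continuous_on a b (z j)) /\
  {ae mu, forall x : R, forall j, is_cderive (z j) x
    (ray_pt t * (omega j - omega l) * z j x + \sum_i pert t j i x * z i x)}.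

Lemma birkhoff_exists : exists (T0 : R) (z : R -> 'I_n -> 'I_n -> R -> R[i]),
  [/\ 1 <= T0, forall t l, T0 <= t -> birkhoff_z t l (z t l) &
      forall e, 0 < e -> exists T, forall t, T <= t -> forall l j x,
        modc (z t l j x - (j == l)%:R) <= e].
Proof.
have iF := integ_absF F_lower; have F0 := absF_ge0 F.
have [g g0 hg] := omega_gap.
set nb := rint (absF F); have nb0 : 0 <= nb by exact: rint_ge0.
have nR : 0 < n%:R :> R by rewrite ltr0n.
set wt := 4 * n%:R * nb + 1.
have wt0 : 0 < wt by rewrite /wt ltr_wpDl// !mulr_ge0.
pose S0 := 1 / (2 * wt) / n%:R.
have S00 : 0 < S0 by rewrite !divr_gt0// mulr_gt0.
have [K0 K00 hK0] := kernel_small iF F0 S00.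
(* The summands ensure, in order, [|rho| >= 1], [nb / t <= 1 / 4] for the diagonal, and a decay rate
   [t g >= K0] that brings the kernel integrals below [S0]. *)
pose T0 := 1 + 4 * nb + K0 / g.
have Kg0 : 0 < K0 / g by rewrite divr_gt0.
have T01 : 1 <= T0 by rewrite /T0; lra.
have D0 : 0 <= 2 * n%:R + nb * (2 * n%:R ^+ 2 + 2).
  by rewrite addr_ge0 ?mulr_ge0// addr_ge0 ?mulr_ge0 ?exprn_ge0.
set D := 2 * n%:R + _ in D0.
(* The estimate for arbitrary [S'] is chosen together with the solution, since one family [z] has to
   serve every tolerance. *)
have /choice[z hz] : forall tl : R * 'I_n, exists z : 'I_n -> R -> R[i], T0 <= tl.1 ->
    birkhoff_z tl.1 tl.2 z /\
    forall S', (forall x, rint (fun s => expR (- (tl.1 * g) * `|x - s|) * absF F s) <= S') ->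
      forall j x, modc (z j x - (j == tl.2)%:R) <= D * (S' + tl.1^-1).
  move=> [t l] /=; have [tT|tT] := leP T0 t; last first.
    by exists (fun _ _ => 0).
  have t1 : 1 <= t by exact: le_trans tT.
  have t0 : 0 < t by exact: lt_le_trans t1.
  have [|||||||||||||z [zac zd zb]] := @perturbed_system R n l (pert t) (absF F)
    (fun j => ray_pt t * (omega j - omega l)) t^-1 (t * g) S0 => //.
  - exact: absF_neg.
  - by move=> j i; exact: cmeas_pert.
  - by move=> j i s; exact: pert_le.
  - by rewrite invr_ge0 ltW.
  - by move=> s; exact: pert_diag_le.
  - by rewrite subrr mulr0.
  - by rewrite mulr_ge0 ?ltW.
  - move=> j jl; rewrite /ray_pt -mulrA ReZ normrM (gtr0_norm t0) ler_pM2l//.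
    exact: hg.
  - move=> x; apply: hK0; move: tT; rewrite /T0 -ler_pdivrMr//; lra.
  - by rewrite /S0 divfK ?gt_eqF.
  - have tn : 4 * nb <= t by move: tT; rewrite /T0; lra.
    by rewrite mulrC ler_pdivrMr// -/nb; lra.
  by exists z => _; split; [split|].
exists T0, (fun t l => z (t, l)); split => // [t l tT|e e0].
  by have [] := hz (t, l) tT.
have e2 : 0 < e / (2 * (D + 1)) by rewrite divr_gt0// mulr_gt0// ltr_wpDl.
have [K1 K10 hK1] := kernel_small iF F0 e2.
(* Makes [S'] and [1 / t] each at most [e / (2 (D + 1))]; [D + 1] majorizes the constant [D] of the
   estimate. *)
exists (T0 + K1 / g + 2 * (D + 1) / e) => t tT l j x.
have Kg1 : 0 < K1 / g by rewrite divr_gt0.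
have De : 0 < 2 * (D + 1) / e by rewrite divr_gt0// mulr_gt0// ltr_wpDl.
have t0 : 0 < t by lra.
have tT0 : T0 <= t by lra.
have [_ hb] := hz (t, l) tT0.
have /hb /(_ j x) h : forall x, rint (fun s => expR (- (t * g) * `|x - s|) * absF F s)
    <= e / (2 * (D + 1)).
  by move=> y; apply: hK1; rewrite -ler_pdivrMr//; lra.
rewrite (le_trans h)//.
have tinv : t^-1 <= e / (2 * (D + 1)).
  rewrite -[leRHS]invrK lef_pV2 ?posrE ?invr_gt0// invf_div; lra.
apply: (@le_trans _ _ ((D + 1) * (e / (2 * (D + 1)) + e / (2 * (D + 1))))).
  apply: ler_pM => //; first by rewrite addr_ge0 ?invr_ge0 ?(ltW t0)// ltW.
    by rewrite lerDl.
  by rewrite lerD2l.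
rewrite le_eqVlt; apply/orP; left; apply/eqP; field.
by rewrite gt_eqF// ltr_wpDl.
Qed.

Definition birkhoff_Y t (z : 'I_n -> 'I_n -> R -> R[i]) (l k : 'I_n) x : R[i] :=
  ray_pt t ^+ k * \sum_i omega i ^+ k * (z l i x * cexp (ray_pt t * omega l * x%:C)).

Lemma ac_birkhoff_Y t z l k a b : birkhoff_z t l (z l) ->
  abs_continuous_on a b (birkhoff_Y t z l k).
Proof.
move=> [zac _]; apply: acM; first exact: ac_cst.
apply: ac_sum => i _; apply: acM; first exact: ac_cst.
by apply: acM; [exact: zac|exact: ac_cexp].
Qed.

Lemma is_cderive_birkhoff_Y t z : 0 < t -> (forall l, birkhoff_z t l (z l)) ->
  {ae mu, forall x : R, 0 < x -> forall l k, is_cderive (birkhoff_Y t z l k) x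
    (\sum_j (F x + Lambda_mx n (ray_pt t ^+ n)) k j * birkhoff_Y t z l j x)}.
Proof.
move=> t0 hz; have h l := (hz l).2.
have := ae_forall_fin h; apply: filterS; first exact: (ae_filter_ringOfSetsType mu).
move=> x {}h x0 l k; set e := fun y : R => cexp (ray_pt t * omega l * y%:C).
have := @is_cderive_sum _ _ (index_enum 'I_n) xpredT
  (fun i y => omega i ^+ k * (z l i y * e y)) x _
  (fun i _ => is_cderiveM (is_cderive_cst _ x)
     (is_cderiveM (h l i) (is_cderive_cexp (ray_pt t * omega l) x))).
move=> /(is_cderiveM (is_cderive_cst (ray_pt t ^+ k) x)).
congr is_cderive; rewrite mul0r add0r.
rewrite -(pert_system (fun i => z l i x * e x) k t0 x0); congr (_ * _).
apply: eq_bigr => i _; rewrite mul0r add0r; congr (_ * _).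
(* Differentiating the exponential adds [rho omega_l] and restores the coefficient [rho omega_i]. *)
rewrite mulrDl addrAC; congr (_ + _); first by rewrite /e; ring.
by rewrite mulr_suml; apply: eq_bigr => j _; rewrite mulrA.
Qed.

Lemma birkhoff_Y_det t z x : 0 < t ->
  \det (\matrix_(i < n, l < n) z l i x) != 0 ->
  \det (\matrix_(k < n, l < n) birkhoff_Y t z l k x) != 0.
Proof.
move=> t0 zdet; have r0 := ray_pt_neq0 t0.
pose A := \matrix_(k < n, i < n) omega i ^+ k.
have -> : \matrix_(k < n, l < n) birkhoff_Y t z l k x =
  diag_mx (\row_k ray_pt t ^+ k) *m A *m (\matrix_(i < n, l < n) z l i x) *m
  diag_mx (\row_l cexp (ray_pt t * omega l * x%:C)).
  rewrite mul_mx_diag -mulmxA mul_diag_mx; apply/matrixP => k l; rewrite !mxE.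
  rewrite -mulrA; congr (_ * _); rewrite mulr_suml; apply: eq_bigr => i _.
  by rewrite !mxE mulrA.
rewrite !det_mulmx !det_diag !mulf_neq0//.
- by apply/prodf_neq0 => k _; rewrite mxE expf_neq0.
- pose W := \matrix_(i < n, k < n) (n%:R^-1 * (omega i)^-1 ^+ k).
  have AW : A *m W = 1%:M.
    apply/matrixP => k k'; rewrite !mxE.
    under eq_bigr do rewrite !mxE mulrCA.
    by rewrite -mulr_sumr omega_orthogonal mulKf.
  by apply/eqP => dA; have := congr1 determinant AW; rewrite det_mulmx dA mul0r det1 => /esym/eqP; rewrite oner_eq0.
by apply/prodf_neq0 => l _; rewrite mxE cexp_neq0.
Qed.

End BirkhoffSolutions.

(** * Asymptotics *)

Section TriangularCoefficients.
Variables (K : fieldType) (n : nat) (k : 'I_n).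
Local Notation wid := (widen_ord (ltn_ord k)).

Lemma sum_tail (c f : 'I_n -> K) : (forall l : 'I_n, (k < l)%N -> c l = 0) ->
  \sum_l c l * f l = \sum_(l < k.+1) c (wid l) * f (wid l).
Proof.
move=> ck; transitivity (\sum_(l < n | (l < k.+1)%N) c l * f l); last exact: big_ord_narrow.
rewrite [RHS]big_mkcond; apply: eq_bigr => l _; rewrite ltnS; case: leqP => // kl.
by rewrite ck// mul0r.
Qed.

Variables (r : 'I_n -> K) (b : 'I_n -> 'I_n -> K).
Hypothesis r0 : forall s, r s != 0.

(** Dividing column [s] by [r s], later [rho^(p s)], gives a matrix with a finite limit. *)
Definition leading_mx := \matrix_(l < k.+1, s < k.+1) ((r (wid s))^-1 * b (wid s) (wid l)).

(** Only the condition [s = k] has a nonzero right-hand side, so the solution is the last row of the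
    inverse, rescaled by [(r k)^-1]. *)
Definition leading_coef (l : 'I_n) : K :=
  if (l <= k)%N then (r k)^-1 * invmx leading_mx ord_max (inord l) else 0.

Lemma leading_coef_tail (l : 'I_n) : (k < l)%N -> leading_coef l = 0.
Proof. by move=> kl; rewrite /leading_coef leqNgt kl. Qed.

Hypothesis lead_unit : leading_mx \in unitmx.

Let target : 'rV_k.+1 := (r k)^-1 *: delta_mx 0 ord_max.

Let wid_max (s : 'I_k.+1) : (wid s == k) = (s == ord_max).
Proof. by apply/eqP/eqP => [/(congr1 (@nat_of_ord n)) h|->]; exact/ord_inj. Qed.

Let equiv (c : 'I_n -> K) : (forall l : 'I_n, (k < l)%N -> c l = 0) ->
  (forall s : 'I_n, (s <= k)%N -> \sum_l c l * b s l = (s == k)%:R) <->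
  (\row_l c (wid l)) *m leading_mx = target.
Proof.
move=> ck; split=> [h|/matrixP h s sk].
  apply/matrixP => i s; rewrite !mxE ord1 eqxx /=.
  have := h (wid s) (leq_ord s); rewrite (sum_tail _ ck) wid_max => hs.
  rewrite (_ : \sum_j _ = (r (wid s))^-1 * (s == ord_max)%:R).
    have [->|_] := eqVneq s ord_max; last by rewrite !mulr0.
    by rewrite (_ : wid ord_max = k)//; exact/ord_inj.
  by rewrite -hs mulr_sumr; apply: eq_bigr => j _; rewrite !mxE mulrCA.
have sk' : (s < k.+1)%N by [].
have -> : s = wid (Ordinal sk') by exact/ord_inj.
have := h 0 (Ordinal sk'); rewrite !mxE eqxx /= => hs.
rewrite (sum_tail _ ck) wid_max; apply: (mulfI (invr_neq0 (r0 (wid (Ordinal sk'))))).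
rewrite mulr_sumr (eq_bigr (fun j : 'I_k.+1 => (\row_l c (wid l)) 0 j * leading_mx j (Ordinal sk'))).
  rewrite hs; case: eqVneq => [e|_]; last by rewrite !mulr0.
  by rewrite (_ : wid _ = k)//; apply/ord_inj => /=; exact: (congr1 (@nat_of_ord _) e).
by move=> j _; rewrite !mxE mulrCA.
Qed.

Lemma row_leading_coef : \row_l leading_coef (wid l) = target *m invmx leading_mx.
Proof.
apply/matrixP => i l; rewrite !ord1 !mxE /leading_coef /= -ltnS ltn_ord.
rewrite (bigD1 ord_max)//= !mxE !eqxx mulr1 big1 ?addr0 => [|j jm].
  by congr (_ * invmx _ _ _); apply/ord_inj; rewrite inordK.
by rewrite !mxE (negbTE jm) andbF mulr0 mul0r.
Qed.

Lemma leading_coef_eq (s : 'I_n) : (s <= k)%N ->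
  \sum_l leading_coef l * b s l = (s == k)%:R.
Proof.
move: s; apply: (equiv leading_coef_tail).2.
by rewrite row_leading_coef mulmxKV.
Qed.

Lemma leading_coef_unique (c : 'I_n -> K) : (forall l : 'I_n, (k < l)%N -> c l = 0) ->
  (forall s : 'I_n, (s <= k)%N -> \sum_l c l * b s l = (s == k)%:R) -> c =1 leading_coef.
Proof.
move=> ck /(equiv ck).1 ce l; have [kl|lk] := ltnP k l.
  by rewrite ck// leading_coef_tail.
have lk' : (l < k.+1)%N by [].
have -> : l = wid (Ordinal lk') by exact/ord_inj.
have : \row_l c (wid l) = \row_l leading_coef (wid l).
  by rewrite row_leading_coef -ce mulmxK.
by move/matrixP => /(_ 0 (Ordinal lk')); rewrite !mxE.
Qed.

End TriangularCoefficients.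

(** * Limits along the ray of the boundary matrix and of the Weyl coefficients *)

Section Asymptotics.
Variable R : realType.

(** Near the limit the determinant is nonzero and the inverse is the adjugate divided by it,
    continuous in the entries. *)
Lemma cto_invmx (T : Type) (G : set_system T) {FG : Filter G} m
    (A : T -> 'M[R[i]]_m) (A0 : 'M[R[i]]_m) i j : \det A0 != 0 ->
  (forall i j, cto G (fun t => A t i j) (A0 i j)) ->
  cto G (fun t => invmx (A t) i j) ((\det A0)^-1 * cofactor A0 j i).
Proof.
move=> dA0 AA0; apply: (@cto_near _ _ _ _ (fun t => (\det (A t))^-1 * cofactor (A t) j i)).
  near=> t; have dt : \det (A t) != 0 by near: t; exact: (cto_neq0 dA0 (cto_det AA0)).
  by rewrite /invmx unitmxE unitfE dt !mxE.
apply: ctoM; first by apply: ctoV => //; exact: cto_det.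
apply: ctoM; first exact: cto_cst.
by apply: cto_det => a b; rewrite !mxE; under eq_fun do rewrite !mxE; exact: AA0.
Unshelve. all: by end_near. Qed.

Variables (n : nat) (n0 : (0 < n)%N) (omega : 'I_n -> R[i]) (phi : R).
Hypothesis omega_root : forall l, omega l ^+ n = 1.
Hypothesis omega_order : forall l l' : 'I_n, (l < l')%N ->
  complex.Re (cis phi * omega l) < complex.Re (cis phi * omega l').
Variable z : R -> 'I_n -> 'I_n -> R -> R[i].
Hypothesis z_cvg : forall e, 0 < e -> exists T, forall t, T <= t -> forall l j x,
  modc (z t l j x - (j == l)%:R) <= e.

Local Notation rho := (ray_pt phi).

Lemma cto_z l j x : cto +oo (fun t => z t l j x) (j == l)%:R.
Proof.
apply/cvgrPdist_le => e /z_cvg [T hT]; near=> t.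
rewrite sub0r normrN ger0_norm ?modc_ge0//; apply: hT.
by near: t; apply: nbhs_pinfty_ge; exact: num_real.
Unshelve. all: by end_near. Qed.

Lemma cto_ray_inv : cto +oo (fun t => (rho t)^-1) 0.
Proof.
apply/cvgrPdist_le => e e0; near=> t.
have te : e^-1 <= t by near: t; apply: nbhs_pinfty_ge; exact: num_real.
have t0 : 0 < t by apply: lt_le_trans te; rewrite invr_gt0.
rewrite sub0r normrN ger0_norm ?modc_ge0// subr0 modcV modc_ray_pt ?(ltW t0)//.
by rewrite -[leRHS]invrK lef_pV2 ?posrE ?invr_gt0.
Unshelve. all: by end_near. Qed.

Lemma cto_ray_invX m : (0 < m)%N -> cto +oo (fun t => (rho t)^-1 ^+ m) 0.
Proof.
case: m => // m _; have -> : (0 : R[i]) = \prod_(i < m.+1) 0.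
  by rewrite prodr_const card_ord expr0n.
under eq_fun do rewrite -[m.+1]card_ord -prodr_const.
by apply: cto_prod => i _; exact: cto_ray_inv.
Qed.

Lemma sum_delta (l : 'I_n) : \sum_i (i == l)%:R = 1 :> R[i].
Proof. by rewrite (bigD1 l)//= eqxx big1 ?addr0// => i il; rewrite (negbTE il). Qed.

Definition amplitude t l (k : 'I_n) x := \sum_i omega i ^+ k * z t l i x.

Lemma cto_amplitude l k x : cto +oo (fun t => amplitude t l k x) (omega l ^+ k).
Proof.
have -> : omega l ^+ k = \sum_i omega i ^+ k * (i == l)%:R.
  rewrite (bigD1 l)//= eqxx mulr1 big1 ?addr0// => i il.
  by rewrite (negbTE il) mulr0.
apply: cto_sum => i _; apply: ctoM; first exact: cto_cst.
exact: cto_z.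
Qed.

Lemma birkhoff_YE t l k x : birkhoff_Y omega phi t (z t) l k x =
  rho t ^+ k * amplitude t l k x * cexp (rho t * omega l * x%:C).
Proof.
rewrite /birkhoff_Y /amplitude -[RHS]mulrA; congr (_ * _); rewrite mulr_suml.
by apply: eq_bigr => i _; rewrite mulrA.
Qed.

Variables (p : 'S_n) (U : 'M[R[i]]_n).

(** Dividing by [rho^(p s)] leaves the terms with [j < p s] a negative power of [rho]. The
    amplitudes are taken at [x = 0], where [z] is still controlled. *)
Lemma cto_bform s l : cto +oo
  (fun t => (rho t ^+ p s)^-1 * bform (birkhoff_Y omega phi t (z t)) p U s l)
  (omega l ^+ p s).
Proof.
pose g t := amplitude t l (p s) 0 +
  \sum_(j < n | (j < p s)%N) U s j * ((rho t)^-1 ^+ (p s - j) * amplitude t l j 0).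
apply: (@cto_near _ _ _ _ g).
  near=> t; have t0 : 0 < t by near: t; apply: nbhs_pinfty_gt; exact: num_real.
  have r0 := ray_pt_neq0 phi t0.
  have e0 : cexp (rho t * omega l * 0%:C) = 1 by rewrite mulr0 cexp0.
  rewrite /g /bform mulrDr birkhoff_YE e0 mulr1 mulKf ?expf_neq0//; congr (_ + _).
  rewrite mulr_sumr; apply: eq_bigr => j js; rewrite birkhoff_YE e0 mulr1.
  rewrite [RHS]mulrCA; congr (_ * _); rewrite mulrA; congr (_ * _).
  rewrite -[in RHS](subnK (ltnW js)) exprD exprVn invfM -mulrA mulVf ?mulr1//.
  by rewrite expf_neq0.
have -> : omega l ^+ p s = omega l ^+ p s +
    \sum_(j < n | (j < p s)%N) U s j * (0 * omega l ^+ j).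
  by rewrite big1 ?addr0// => j _; rewrite mul0r mulr0.
apply: ctoD; first exact: cto_amplitude.
apply: cto_sum => j js; apply: ctoM; first exact: cto_cst.
by apply: ctoM; [apply: cto_ray_invX; rewrite subn_gt0|exact: cto_amplitude].
Unshelve. all: by end_near. Qed.

Variable k : 'I_n.
Hypothesis dm0 : dminor omega p (ltn_ord k) != 0.

Let A0 : 'M[R[i]]_k.+1 := \matrix_(l < k.+1, s < k.+1)
  omega (widen_ord (ltn_ord k) l) ^+ p (widen_ord (ltn_ord k) s).

Definition weyl_mx t := leading_mx k (fun s => rho t ^+ p s)
  (bform (birkhoff_Y omega phi t (z t)) p U).

Definition weyl_coef t := leading_coef k (fun s => rho t ^+ p s)
  (bform (birkhoff_Y omega phi t (z t)) p U).

Lemma cto_weyl_mx i j : cto +oo (fun t => weyl_mx t i j) (A0 i j).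
Proof.
rewrite mxE; under eq_fun do rewrite mxE.
exact: cto_bform.
Qed.

(** Deleting the last row and column of the minor of order [k + 1] leaves the one of order [k], with
    an even sign. *)
Lemma cofactor_corner : (\det A0)^-1 * cofactor A0 ord_max ord_max = a0 omega p k.
Proof.
rewrite /a0 mulrC; congr (_ / _).
rewrite /cofactor exprD -expr2 sqrr_sign mul1r /dminor; congr (\det _).
apply/matrixP => l s; rewrite !mxE.
by congr (omega _ ^+ p _); apply/ord_inj; rewrite /= /bump leqNgt ltn_ord.
Qed.

(** For [l < k] only convergence matters, because an exponentially small factor follows; the value
    of the limit is needed for [l = k]. *)
Lemma cto_weyl_coef (l : 'I_n) : exists2 L, cto +oo (fun t => rho t ^+ p k * weyl_coef t l) L &
  l = k -> L = a0 omega p k.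
Proof.
have [kl|lk] := ltnP k l.
  exists 0; last by move=> lk; rewrite lk ltnn in kl.
  by under eq_fun do rewrite /weyl_coef leading_coef_tail// mulr0; exact: cto_cst.
exists ((\det A0)^-1 * cofactor A0 (inord l) ord_max).
  apply: (@cto_near _ _ _ _ (fun t => invmx (weyl_mx t) ord_max (inord l))).
    near=> t; have t0 : 0 < t by near: t; apply: nbhs_pinfty_gt; exact: num_real.
    by rewrite /weyl_coef /leading_coef lk mulVKf// expf_neq0// ray_pt_neq0.
  by apply: cto_invmx => // i j; exact: cto_weyl_mx.
move=> ->; rewrite -cofactor_corner; congr (_ * cofactor _ _ _).
by apply/ord_inj; rewrite inordK.
Unshelve. all: by end_near. Qed.

Lemma cto_cexp_diff (l : 'I_n) x : (l < k)%N -> 0 < x ->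
  cto +oo (fun t => cexp (rho t * (omega l - omega k) * x%:C)) 0.
Proof.
move=> lk x0; pose g := (complex.Re (cis phi * omega k) - complex.Re (cis phi * omega l)) * x.
have g0 : 0 < g by rewrite mulr_gt0// subr_gt0; exact: omega_order.
apply: cto_squeeze (expR_decay g0); near=> t.
rewrite subr0 modc_cexp ler_expR mulrC ReZ /ray_pt -mulrA ReZ mulrBr Re_add Re_opp /g.
by rewrite le_eqVlt; apply/orP; left; apply/eqP; ring.
Unshelve. all: by end_near. Qed.

Lemma cto_weyl_ratio (j : 'I_n) x : 0 < x -> a0 omega p k != 0 ->
  cto +oo (fun t => comb (birkhoff_Y omega phi t (z t)) (weyl_coef t) j x /
    (rho t ^- p k * a0 omega p k * (rho t * omega k) ^+ j * cexp (rho t * omega k * x%:C))) 1.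
Proof.
move=> x0 a00; have wk0 := omega_neq0 n0 omega_root k.
pose h l t := rho t ^+ p k * weyl_coef t l * (amplitude t l j x *
  (cexp (rho t * (omega l - omega k) * x%:C) * (a0 omega p k * omega k ^+ j)^-1)).
apply: (@cto_near _ _ _ _ (fun t => \sum_l h l t)).
  near=> t; have t0 : 0 < t by near: t; apply: nbhs_pinfty_gt; exact: num_real.
  have r0 := ray_pt_neq0 phi t0.
  rewrite /comb mulr_suml; apply: eq_bigr => l _; rewrite /h birkhoff_YE.
  have -> : rho t * (omega l - omega k) * x%:C =
    rho t * omega l * x%:C + - (rho t * omega k * x%:C) by ring.
  rewrite cexpD cexpN [(rho t * omega k) ^+ j]exprMn.
  have := cexp_neq0 (rho t * omega k * x%:C); set E := cexp (rho t * omega k * x%:C) => E0.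
  have := expf_neq0 j r0; have := expf_neq0 (p k) r0.
  set r1 := rho t ^+ p k; set r2 := rho t ^+ j => r10 r20.
  have := expf_neq0 j wk0; set w1 := omega k ^+ j => w10.
  by field; rewrite ?E0 ?r10 ?r20 ?w10 ?a00.
have hl l : cto +oo (h l) (l == k)%:R.
  have [L cL Lk] := cto_weyl_coef l.
  have [lk|kl|lk] := ltngtP l k.
  - have -> : (l == k)%:R = L * (omega l ^+ j * (0 * (a0 omega p k * omega k ^+ j)^-1)) :> R[i].
      by rewrite mul0r !mulr0 -val_eqE /= ltn_eqF.
    apply: ctoM => //; apply: ctoM; first exact: cto_amplitude.
    by apply: ctoM; [exact: cto_cexp_diff|exact: cto_cst].
  - rewrite -val_eqE /= gtn_eqF//.
    rewrite (_ : h l = fun=> 0); first exact: cto_cst.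
    by apply/funext => t; rewrite /h /weyl_coef leading_coef_tail// mulr0 mul0r.
  have {}lk : l = k by exact/ord_inj.
  have -> : (l == k)%:R = L * (omega l ^+ j * (1 * (a0 omega p k * omega k ^+ j)^-1)) :> R[i].
    rewrite (Lk lk) lk eqxx /=; have := expf_neq0 j wk0; set w1 := omega k ^+ j => w10.
    by field; rewrite w10 a00.
  apply: ctoM => //; apply: ctoM; first exact: cto_amplitude.
  apply: ctoM; last exact: cto_cst.
  rewrite lk (_ : (fun t => _) = fun=> 1); first exact: cto_cst.
  by apply/funext => t; rewrite subrr mulr0 mul0r cexp0.
rewrite -(sum_delta k); by apply: cto_sum => l _; exact: hl.
Unshelve. all: by end_near. Qed.

Lemma amplitude_bounds (o : 'I_n) : o = 0%N :> nat -> exists T, forall t, T <= t ->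
  forall l x, expR (t * complex.Re (cis phi * omega l) * x) / 2 <=
     modc (birkhoff_Y omega phi t (z t) l o x) <=
     2 * expR (t * complex.Re (cis phi * omega l) * x).
Proof.
move=> oE; have nR : 0 < n%:R :> R by rewrite ltr0n.
(* The [n] errors then sum to at most [1 / 2], keeping the amplitude between [1 / 2] and [2] in
   modulus, uniformly in [x]. *)
have e0 : 0 < 1 / (2 * n%:R) :> R by rewrite divr_gt0// mulr_gt0.
have [T hT] := z_cvg e0; exists T => t /hT {}hT l x.
have ReE : complex.Re (rho t * omega l * x%:C) = t * complex.Re (cis phi * omega l) * x.
  by rewrite mulrC ReZ /ray_pt -mulrA ReZ mulrC.
rewrite birkhoff_YE oE expr0 mul1r modcM modc_cexp ReE.
set E := expR _; have E0 : 0 < E by exact: expR_gt0.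
have near1 : modc (amplitude t l o x - 1) <= 1 / 2.
  have -> : amplitude t l o x - 1 = \sum_i (z t l i x - (i == l)%:R).
    rewrite sumrB sum_delta.
    by congr (_ - _); apply: eq_bigr => i _; rewrite oE expr0 mul1r.
  rewrite (le_trans (le_modc_sum _ _ _))//.
  apply: (@le_trans _ _ (\sum_(i < n) 1 / (2 * n%:R))); first by apply: ler_sum.
  rewrite sum_const_ord le_eqVlt; apply/orP; left; apply/eqP; field.
  by rewrite gt_eqF.
have lo : 1 / 2 <= modc (amplitude t l o x).
  have := le_modcD (amplitude t l o x) (1 - amplitude t l o x).
  by rewrite addrC subrK modc1 modcB; lra.
have up : modc (amplitude t l o x) <= 2.
  have := le_modcD 1 (amplitude t l o x - 1).
  by rewrite addrC subrK modc1; lra.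
apply/andP; split; last by rewrite ler_pM2r.
by rewrite [leRHS]mulrC ler_pM2l// -[leLHS]mul1r.
Qed.

End Asymptotics.

Theorem lemma4p2 (R : realType) (n : nat) (hn : (2 <= n)%N)
  (I : 'I_n.-1 -> nat) (hI : singularity_orders I)
  (sigma : 'I_n.-1 -> R -> R[i]) (hsigma : Sigma_set I sigma)
  (p : 'S_n) (LU : 'M[R[i]]_n)
  (hLtrig : is_trig_mx LU) (hLunit : forall k : 'I_n, LU k k = 1)
  (r : nat) (hr : (1 <= r <= 2 * n)%N)
  (omega : 'I_n -> R[i])
  (hroot : forall l : 'I_n, omega l ^+ n = 1)
  (horder : forall rho : R[i], sector n r rho ->
     forall l l' : 'I_n, (l < l')%N ->
       complex.Re (rho * omega l) < complex.Re (rho * omega l'))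
  (x : R) (hx : 0 < x)
  (phi : R) (hphi : ray phi `<=` sector n r) :
  let F := F_mx I sigma in
  let U := perm_mx p *m LU in
  let rho (t : R) : R[i] := t%:C * cexp (0 +i* phi) in
  forall k : 'I_n,
    [/\ dminor omega p (ltn_ord k) != 0,
        a0 omega p k != 0 &
        forall j : 'I_n, exists2 eps : R -> R[i],
          modc (eps t) @[t --> +oo] --> (0 : R) &
          \forall t \near +oo,
            qder F (weyl F p U (omega k) k (rho t)) j x =
            rho t ^- p k * a0 omega p k * (rho t * omega k) ^+ j
              * cexp (rho t * omega k * x%:C) * (1 + eps t)].
Proof.
move=> F U rho k.
have n0 : (0 < n)%N by exact: ltn_trans hn.
have u_sector : sector n r (cis phi).
  by apply: hphi; exists 1 => //; rewrite [1%:C]/(1 : R[i]) mul1r.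
have u_order := horder _ u_sector.
(* [phi] may be any representative of the argument; the sector supplies a nonnegative [th] with the
   same [cis], as the grid argument requires. *)
have [th /andP[th1 th2] [s s0 phiE]] := u_sector.
have s1 : s = 1.
  have := congr1 (@modc R) phiE.
  by rewrite modcM modc_real !modc_cis mulr1 gtr0_norm.
have th0 : 0 <= th.
  by rewrite (le_trans _ (ltW th1))// divr_ge0// mulr_ge0// pi_ge0.
have phi_th : cis phi = cis th by rewrite phiE s1 mul1r.
have dm m (hm : (m <= n)%N) : dminor omega p hm != 0.
  by apply: (@dminor_neq0 R n n0 omega p th) => //; rewrite -phi_th.
have a00 : a0 omega p k != 0 by rewrite /a0 mulf_neq0 ?invr_neq0.
split=> // j.
have Fup : forall y (i i' : 'I_n), (i < i')%N -> F y i i' = (i' == i.+1 :> nat)%:R.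
  by move=> y i i' ii'; exact: F_mx_upper.
have Flow : forall i i' : 'I_n, (i' <= i)%N -> L1p (fun y => F y i i').
  by move=> i i' ii'; exact: F_mx_L1.
have Ftr y : \sum_i F y i i = 0 by exact: trace_F_mx.
have [T0 [z [T01 hz zcvg]]] := birkhoff_exists n0 Flow Ftr hroot u_order.
pose o := Ordinal n0.
have [T1 hT1] := amplitude_bounds n0 omega phi zcvg (erefl : o = 0%N :> nat).
pose main t := rho t ^- p k * a0 omega p k * (rho t * omega k) ^+ j
  * cexp (rho t * omega k * x%:C).
pose f t := qder F (weyl F p U (omega k) k (rho t)) j x / main t.
have qE : \forall t \near +oo, qder F (weyl F p U (omega k) k (rho t)) j x =
    comb (birkhoff_Y omega phi t (z t)) (weyl_coef omega phi z p U k t) j x.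
  near=> t.
  have tT0 : T0 <= t by near: t; apply: nbhs_pinfty_ge; exact: num_real.
  have tT1 : T1 <= t by near: t; apply: nbhs_pinfty_ge; exact: num_real.
  have t0 : 0 < t by rewrite (lt_le_trans ltr01)// (le_trans T01).
  have rp0 (s' : 'I_n) : ray_pt phi t ^+ p s' != 0.
    by rewrite expf_neq0// ray_pt_neq0.
  have zt l : birkhoff_z F omega phi t l (z t l) by exact: hz.
  (* The matrix tends to the identity, so its determinant is eventually nonzero. *)
  have detz : \det (\matrix_(i < n, l < n) z t l i 1) != 0.
    near: t; apply: (@cto_neq0 _ _ _ _ _ (\det (1%:M : 'M[R[i]]_n))).
      by rewrite det1 oner_neq0.
    by apply: cto_det => i l; rewrite mxE; under eq_fun do rewrite mxE; exact: cto_z.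
  have unit : weyl_mx omega phi z p U k t \in unitmx.
    rewrite unitmxE unitfE; near: t.
    apply: cto_neq0; last by apply: cto_det => i l; exact: cto_weyl_mx zcvg _ _ _ _ _.
    exact: dm.
  apply: (@weyl_comb R n F (rho t ^+ n) Fup Flow o erefl _ _ _ _
    (fun l => t * complex.Re (cis phi * omega l))) => //.
  - by move=> l i a b; exact: ac_birkhoff_Y.
  - exact: is_cderive_birkhoff_Y.
  - exact: birkhoff_Y_det.
  - by move=> l l' ll'; rewrite ltr_pM2l// u_order.
  - by move=> l y; have /andP[] := hT1 _ tT1 l y.
  - by move=> l y; have /andP[] := hT1 _ tT1 l y.
  - by rewrite /rho -mulrA ReZ.
  - by move=> l; exact: leading_coef_tail.
  - by move=> i ik; exact: (leading_coef_eq rp0 unit).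
  - by move=> c c1 c2; exact: (leading_coef_unique rp0 unit).
(* The error is the ratio to the main term minus one; it is meaningful because [main] is nonzero for
   [t > 0]. *)
exists (fun t => f t - 1).
  apply: (@cto_near _ _ _ _ (fun t =>
    comb (birkhoff_Y omega phi t (z t)) (weyl_coef omega phi z p U k t) j x / main t)).
    by apply: filterS qE => t e; rewrite /f e.
  exact: (cto_weyl_ratio n0 hroot u_order zcvg).
near=> t; have t0 : 0 < t by near: t; apply: nbhs_pinfty_gt; exact: num_real.
have r0 : rho t != 0 by exact: (ray_pt_neq0 phi t0).
have main0 : main t != 0.
  have w0 := omega_neq0 n0 hroot k.
  apply: mulf_neq0 (cexp_neq0 _); apply: mulf_neq0; last by rewrite expf_neq0// mulf_neq0.
  by rewrite mulf_neq0// invr_neq0// expf_neq0.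
by rewrite addrC subrK mulrC /f divfK.
Unshelve. all: by end_near. Qed.
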